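(* Let $K_1,K_2$ be positive integers. There is a constant $C>1$, depending only on the cover parameters $K_1,K_2$, such that the following holds. Let $0<T\le 1$ and $0<R_0\le\sqrt{T}$, and let $u$ be a global-in-time local Leray solution of the 3D Navier-Stokes equations (with viscosity $1$) on $\mathbb{R}^3\times(0,\infty)$ which is regular on $(0,T)$; let $\omega=\operatorname{curl}u$, and let $$M_0=\sup_{t\in(0,T)}\int_{B(0,2R_0)}|u(x,t)|^2\,dx<\infty .$$ Suppose that, for some $t\in(2T/3,T)$, $$C\,\max\{M_0^{1/2},R_0^{1/2}\}\,\sigma_{0,t}^{1/2}<R_0 .$$ Then $$\frac1C\,P_{0,t}\le\langle VST\rangle_{R,t}\le C\,P_{0,t}$$ for all $R$ satisfying $$C\,\max\{M_0^{1/2},R_0^{1/2}\}\,\sigma_{0,t}^{1/2}\le R\le R_0 ,$$ where $\langle VST\rangle_{R,t}$ is the ensemble average of the localized vortex-stretching terms over any $(K_1,K_2)$-cover of $B(0,R_0)$ at scale $R$, with $P_{0,t}$, $\sigma_{0,t}$, $\langle VST\rangle_{R,t}$ and the associated cut-off functions as defined in the context.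
   Context: **Equations.** The 3D Navier-Stokes equations with viscosity $1$ are $u_t+(u\cdot\nabla)u=-\nabla p+\triangle u$, $\operatorname{div}u=0$. The vorticity $\omega=\operatorname{curl}u$ satisfies $\omega_t+(u\cdot\nabla)\omega=(\omega\cdot\nabla)u+\triangle\omega$. **Local Leray solution** (in the sense of Lemarié-Rieusset). The initial datum $u_0$ is divergence-free and lies in the closure of the test functions in $L^2_{uloc}(\mathbb{R}^3)$ (uniformly locally square integrable with decay at infinity). A global-in-time local Leray solution is a distributional solution $u$ on $\mathbb{R}^3\times(0,\infty)$, with a pressure $p\in L^{3/2}_{loc}$, such that for every finite $T'>0$, $$\sup_{0<t<T'}\sup_{x_0}\int_{B(x_0,1)}|u(x,t)|^2dx<\infty \quad\text{and}\quad \sup_{x_0}\int_0^{T'}\int_{B(x_0,1)}|\nabla u|^2dx\,dt<\infty ,$$ with $u(t)\to u_0$ in $L^2_{loc}$ as $t\to0^+$, with $u$ decaying at spatial infinity in the corresponding local $L^2$ sense (for every finite $T'$, $\int_0^{T'}\int_{B(x_0,1)}|u|^2dx\,dt\to0$ as $|x_0|\to\infty$), and satisfying the local energy inequality $$2\iint|\nabla u|^2\varphi\,dx\,dt\le\iint|u|^2(\varphi_t+\triangle\varphi)\,dx\,dt+\iint(|u|^2+2p)\,u\cdot\nabla\varphi\,dx\,dt$$ for all nonnegative $\varphi\in C_c^\infty(\mathbb{R}^3\times(0,\infty))$. ''Regular on $(0,T)$'' means that $u$ is a smooth solution on $\mathbb{R}^3\times(0,T)$. ($T$ plays the role of the first possible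 singular time.) **Notation.** $B(x,r)$ is the open ball, and $S(x,r)$ the sphere, of center $x$ and radius $r$ in $\mathbb{R}^3$. $\mathcal{D}(U)$ is the set of smooth functions compactly supported in $U$. **Covers.** For $0<R\le R_0$, a cover $\{B(x_i,R)\}_{i=1}^n$ of $B(0,R_0)$ is a $(K_1,K_2)$-cover at scale $R$ if $(R_0/R)^3\le n\le K_1(R_0/R)^3$ and any point $x\in B(0,R_0)$ is covered by at most $K_2$ of the balls $B(x_i,2R)$. **Cut-off functions.** Fix $\rho_1=\rho_2=7/8$ and a fixed (sufficiently large) absolute constant $C_0$, on which the dependence of other constants is suppressed. * Temporal: $\eta=\eta_T\in C^\infty(0,T)$ with $0\le\eta\le1$, $\eta=0$ on $(0,T/3)$, $\eta=1$ on $(2T/3,T)$, and $|\eta'|/\eta^{\rho_1}\le C_0/T$. * Spatial: for a center $x_0$ and scale $R$, $\psi=\psi_{x_0,R}\in\mathcal{D}(B(x_0,2R))$ with $0\le\psi\le1$, $\psi=1$ on $B(x_0,R)$, $|\nabla\psi|/\psi^{\rho_2}\le C_0/R$, and $|\triangle\psi|/\psi^{2\rho_2-1}\le C_0/R^2$. * $\psi_0$ denotes such a spatial cut-off for center $0$ and scale $R_0$, and $\phi_0=\psi_0\eta$. * For cover elements near the boundary $S(0,R_0)$ it is additionally required that $0\le\psi\le\psi_0$ (this holds automatically when $B(x_0,2R)\subset B(0,R_0)$). * If $B(x_0,R)\not\subset B(0,R_0)$, the support and plateau requirements are replaced by: $\psi\in\mathcal{D}(B(0,2R_0))$ and $\psi=1$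 on $B(x_0,R)\cap B(0,R_0)$, with the same derivative bounds, and moreover (a) $\psi=\psi_0$ on the part, between $S(0,R_0)$ and $S(0,2R_0)$, of the cone centered at zero and passing through $S(0,R_0)\cap B(x_0,R)$; (b) $\psi=0$ on $B(0,R_0)\setminus B(x_0,2R)$ and outside the part, between $S(0,R_0)$ and $S(0,2R_0)$, of the cone centered at zero and passing through $S(0,R_0)\cap B(x_0,2R)$. (In (b) the second requirement concerns points of the region between $S(0,R_0)$ and $S(0,2R_0)$.) * For a cover $\{B(x_i,R)\}_{i=1}^n$, let $\psi_i=\psi_{x_i,R}$ and $\phi_i=\psi_i\,\eta$. **Averaged vortex-stretching.** For $t\in(2T/3,T)$, $$VST_{x_i,R,t}=\frac1t\int_0^t\frac1{R^3}\int(\omega\cdot\nabla)u\cdot\phi_i\,\omega\,dx\,ds,\qquad \langle VST\rangle_{R,t}=\frac1n\sum_{i=1}^nVST_{x_i,R,t}.$$ **Macro-scale quantities.** $$E_{0,t}=\frac1t\int_0^t\frac1{R_0^3}\int\frac12|\omega|^2\phi_0^{1/2}\,dx\,ds,$$ $$P_{0,t}=\frac1t\int_0^t\frac1{R_0^3}\int|\nabla\omega|^2\phi_0\,dx\,ds+\frac1t\frac1{R_0^3}\int\frac12|\omega(x,t)|^2\psi_0(x)\,dx,$$ $$\sigma_{0,t}=\Bigl(\frac{E_{0,t}}{P_{0,t}}\Bigr)^{1/2}\quad(\text{defined when }P_{0,t}>0).$$ *)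

(* Defs.v *)
From HB Require Import structures.
From mathcomp Require Import all_boot all_order all_algebra.
From mathcomp Require Import all_classical all_reals all_analysis.

Set Implicit Arguments.
Unset Strict Implicit.
Unset Printing Implicit Defensive.
Import Order.TTheory GRing.Theory Num.Theory.
Import numFieldNormedType.Exports.

Local Open Scope classical_set_scope.
Local Open Scope ring_scope.

(* R^3 as a product rather than 'rV[R]_3: the product carries both the normed
   space structure (derivatives) and the product measure (integrals). *)
Notation R3 R := (R * R * R)%type.

Section EuclideanSpace.
Context {R : realType}.
Implicit Types (x y : R3 R) (i j : 'I_3).

Definition crd x i : R :=
  if i == 0 then x.1.1 else if i == 1 then x.1.2 else x.2.

Definition vec (f : 'I_3 -> R) : R3 R := (f 0, f 1, f 2).

Definition unit_vec i : R3 R := vec (fun j => (i == j)%:R).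

Definition dot x y : R := \sum_(i < 3) crd x i * crd y i.

(* The library norm on a product is the sup norm, so Euclidean lengths, balls
   and spheres are defined separately; the topology is the same. *)
Definition enorm x : R := Num.sqrt (dot x x).
Definition eball x (r : R) : set (R3 R) := [set y | enorm (y - x) < r].
Definition esphere x (r : R) : set (R3 R) := [set y | enorm (y - x) = r].

Local Notation RM := (measurableTypeR R).

Definition leb3 : {measure set (RM * RM * RM)%type -> \bar R} :=
  (@lebesgue_measure R \x @lebesgue_measure R \x @lebesgue_measure R)%E.

(* Space-time points are pairs (x, t). *)
Definition leb4 : {measure set (RM * RM * RM * RM)%type -> \bar R} :=
  (leb3 \x @lebesgue_measure R)%E.

Definition borel3 (D : set (R3 R)) (f : R3 R -> R) : Prop :=
  @measurable_fun _ _ (RM * RM * RM)%type RM D f.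

Definition borel4 (D : set (R3 R * R)) (f : R3 R * R -> R) : Prop :=
  @measurable_fun _ _ (RM * RM * RM * RM)%type RM D f.

End EuclideanSpace.

Section Calculus.
Context {R : realType}.

Definition component (w : R3 R -> R3 R) (i : 'I_3) : R3 R -> R :=
  fun x => crd (w x) i.

Definition partial (i : 'I_3) (f : R3 R -> R) : R3 R -> R :=
  fun x => 'D_(unit_vec i) f x.

Definition grad (f : R3 R -> R) (x : R3 R) : R3 R :=
  vec (fun i => partial i f x).

Definition divergence (w : R3 R -> R3 R) (x : R3 R) : R :=
  \sum_(i < 3) partial i (component w i) x.

Definition laplacian (f : R3 R -> R) (x : R3 R) : R :=
  \sum_(i < 3) partial i (partial i f) x.

(* Indices are added modulo 3. *)
Definition curl (w : R3 R -> R3 R) (x : R3 R) : R3 R :=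
  vec (fun i => partial (i + 1) (component w (i + 2)) x
              - partial (i + 2) (component w (i + 1)) x).

(* (a . nabla) w *)
Definition advect (a : R3 R) (w : R3 R -> R3 R) (x : R3 R) : R3 R :=
  vec (fun j => \sum_(i < 3) crd a i * partial i (component w j) x).

(* |nabla w|^2 *)
Definition gradsq (w : R3 R -> R3 R) (x : R3 R) : R :=
  \sum_(i < 3) \sum_(j < 3) partial i (component w j) x ^+ 2.

Definition dt (f : R -> R3 R -> R) (t : R) (x : R3 R) : R :=
  derive1 (fun s => f s x) t.

Fixpoint iter_derive (V : normedModType R) (vs : seq V) (f : V -> R) : V -> R :=
  if vs is v :: vs' then fun x => 'D_v (iter_derive vs' f) x else f.

(* C^infty on the open set U: on U, every iterated directional derivative is
   continuous and can be differentiated again in every direction. *)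
Definition smooth_on (V : normedModType R) (U : set V) (f : V -> R) : Prop :=
  forall (vs : seq V) (x : V), U x ->
    {for x, continuous (iter_derive vs f)} /\
    forall v, derivable (iter_derive vs f) x v.

(* The space D(U): smooth functions on V compactly supported in U. *)
Definition test_function (V : normedModType R) (U : set V) (f : V -> R) :
    Prop :=
  smooth_on setT f /\
  exists K : set V, [/\ compact K, K `<=` U & forall x, ~ K x -> f x = 0].

Definition uncurry4 (A : Type) (f : R -> R3 R -> A) : R3 R * R -> A :=
  fun z => f z.2 z.1.

End Calculus.

Section NavierStokes.
Context {R : realType}.
Local Notation mu := (@lebesgue_measure R).

Definition halfspace : set (R3 R * R) := [set z | 0 < z.2].
Definition slab (T : R) : set (R3 R * R) := [set z | 0 < z.2 < T].

Definition initial_datum (u0 : R3 R -> R3 R) : Prop :=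
  [/\ forall i, borel3 setT (component u0 i),
      forall theta : R3 R -> R, test_function setT theta ->
        \int[leb3]_x dot (u0 x) (grad theta x) = 0
    & forall e : R, 0 < e -> exists w : R3 R -> R3 R,
        (forall i, test_function setT (component w i)) /\
        forall x0, (\int[leb3]_(x in eball x0 1)
                      (enorm (u0 x - w x) ^+ 2)%:E <= e%:E)%E].

(* The solution is given by a Borel representative, defined at every time, for
   which the supremum over times is an actual supremum.
   [Du i j] is the weak derivative of the j-th component of [u] in the i-th
   space variable. *)
Record local_leray (u0 : R3 R -> R3 R) (u : R -> R3 R -> R3 R)
    (p : R -> R3 R -> R) (Du : 'I_3 -> 'I_3 -> R -> R3 R -> R) : Prop := {
  leray_datum : initial_datum u0;
  leray_borel_u : forall i,
    borel4 halfspace (uncurry4 (fun t => component (u t) i));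
  leray_borel_p : borel4 halfspace (uncurry4 p);
  leray_borel_Du : forall i j, borel4 halfspace (uncurry4 (Du i j));
  leray_pressure : forall K : set (R3 R * R), compact K -> K `<=` halfspace ->
    (\int[leb4]_(z in K) (`|p z.2 z.1| `^ (3 / 2))%:E < +oo)%E;
  leray_weak_gradient : forall (i j : 'I_3) (phi : R -> R3 R -> R),
    test_function halfspace (uncurry4 phi) ->
    \int[leb4]_(z in halfspace)
       (crd (u z.2 z.1) j * partial i (phi z.2) z.1)
    = - \int[leb4]_(z in halfspace) (Du i j z.2 z.1 * phi z.2 z.1);
  leray_divergence : forall phi : R -> R3 R -> R,
    test_function halfspace (uncurry4 phi) ->
    \int[leb4]_(z in halfspace) dot (u z.2 z.1) (grad (phi z.2) z.1) = 0;
  (* u_t + div (u (x) u) + grad p - laplacian u = 0 in distributions *)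
  leray_momentum : forall (i : 'I_3) (phi : R -> R3 R -> R),
    test_function halfspace (uncurry4 phi) ->
    \int[leb4]_(z in halfspace)
      (crd (u z.2 z.1) i * (dt phi z.2 z.1 + laplacian (phi z.2) z.1)
       + crd (u z.2 z.1) i * dot (u z.2 z.1) (grad (phi z.2) z.1)
       + p z.2 z.1 * partial i (phi z.2) z.1) = 0;
  leray_energy : forall T' : R, 0 < T' -> exists M : R,
    forall (t : R) (x0 : R3 R), 0 < t < T' ->
    (\int[leb3]_(x in eball x0 1) (enorm (u t x) ^+ 2)%:E <= M%:E)%E;
  leray_dissipation : forall T' : R, 0 < T' -> exists M : R,
    forall x0 : R3 R,
    (\int[leb4]_(z in eball x0 1 `*` `]0%R, T'[)
       (\sum_(i < 3) \sum_(j < 3) Du i j z.2 z.1 ^+ 2)%R%:E <= M%:E)%E;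
  leray_initial : forall r : R, 0 < r ->
    (fun t : R => \int[leb3]_(x in eball (0 : R3 R)%R r)
                    (enorm (u t x - u0 x) ^+ 2)%:E)%E @ 0^'+ --> 0%E;
  leray_decay : forall T' : R, 0 < T' -> forall e : R, 0 < e ->
    exists rho : R, forall x0 : R3 R, rho < enorm x0 ->
    (\int[leb4]_(z in eball x0 1 `*` `]0%R, T'[)
       (enorm (u z.2 z.1) ^+ 2)%:E <= e%:E)%E;
  leray_local_energy : forall phi : R -> R3 R -> R,
    test_function halfspace (uncurry4 phi) -> (forall t x, 0 <= phi t x) ->
    2 * \int[leb4]_(z in halfspace)
          ((\sum_(i < 3) \sum_(j < 3) Du i j z.2 z.1 ^+ 2) * phi z.2 z.1)
    <= \int[leb4]_(z in halfspace)
         (enorm (u z.2 z.1) ^+ 2 * (dt phi z.2 z.1 + laplacian (phi z.2) z.1))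
     + \int[leb4]_(z in halfspace)
         ((enorm (u z.2 z.1) ^+ 2 + 2 * p z.2 z.1)
          * dot (u z.2 z.1) (grad (phi z.2) z.1))
}.

Definition local_leray_solution (u : R -> R3 R -> R3 R) : Prop :=
  exists u0 p Du, local_leray u0 u p Du.

(* The pressure [q] of the classical equations may differ from the one in
   [local_leray] by a function of time. *)
Definition regular_on (T : R) (u : R -> R3 R -> R3 R) : Prop :=
  (forall i, smooth_on (slab T) (uncurry4 (fun t => component (u t) i))) /\
  exists q : R -> R3 R -> R, smooth_on (slab T) (uncurry4 q) /\
    forall (t : R) (x : R3 R), 0 < t < T ->
      divergence (u t) x = 0 /\
      forall i : 'I_3,
        dt (fun s => component (u s) i) t x + crd (advect (u t x) (u t) x) i
        = - partial i (q t) x + laplacian (component (u t) i) x.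

Definition vorticity (u : R -> R3 R -> R3 R) (t : R) : R3 R -> R3 R :=
  curl (u t).

End NavierStokes.

Section CutOffs.
Context {R : realType}.

Definition rho1 : R := 7 / 8.
Definition rho2 : R := 7 / 8.

(* In the bounds on derivatives of cut-offs the denominators are cleared. *)
Definition temporal_cutoff (C0 T : R) (eta : R -> R) : Prop :=
  [/\ smooth_on [set t | 0 < t < T] eta,
      forall t : R, 0 < t < T -> 0 <= eta t <= 1,
      forall t : R, 0 < t < T / 3 -> eta t = 0,
      forall t : R, 2 * T / 3 < t < T -> eta t = 1
    & forall t : R, 0 < t < T -> `|derive1 eta t| <= C0 / T * eta t `^ rho1].

Definition cutoff_bounds (C0 r : R) (psi : R3 R -> R) : Prop :=
  [/\ forall x, 0 <= psi x <= 1,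
      forall x, enorm (grad psi x) <= C0 / r * psi x `^ rho2
    & forall x, `|laplacian psi x| <= C0 / r ^+ 2 * psi x `^ (2 * rho2 - 1)].

Definition spatial_cutoff (C0 : R) (x0 : R3 R) (r : R)
    (psi : R3 R -> R) : Prop :=
  [/\ test_function (eball x0 (2 * r)) psi,
      forall x, eball x0 r x -> psi x = 1
    & cutoff_bounds C0 r psi].

(* The cone with vertex zero passing through A. *)
Definition cone (A : set (R3 R)) : set (R3 R) :=
  [set x | exists s y, [/\ 0 < s, A y & x = s *: y]].

Definition shell (R0 : R) : set (R3 R) := [set x | R0 < enorm x < 2 * R0].

Definition boundary_cutoff (C0 R0 : R) (psi0 : R3 R -> R) (x0 : R3 R) (r : R)
    (psi : R3 R -> R) : Prop :=
  [/\ test_function (eball 0 (2 * R0)) psi,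
      forall x, (eball x0 r `&` eball 0 R0) x -> psi x = 1,
      cutoff_bounds C0 r psi,
      forall x, shell R0 x -> cone (esphere 0 R0 `&` eball x0 r) x ->
        psi x = psi0 x
    & (forall x, (eball 0 R0 `\` eball x0 (2 * r)) x -> psi x = 0) /\
      (forall x, shell R0 x -> ~ cone (esphere 0 R0 `&` eball x0 (2 * r)) x ->
        psi x = 0)].

(* psi <= psi0 is automatic when the ball of radius 2r lies in the ball of
   radius R0, so it is required of every element of the cover. *)
Definition cover_cutoff (C0 R0 : R) (psi0 : R3 R -> R) (x0 : R3 R) (r : R)
    (psi : R3 R -> R) : Prop :=
  [/\ eball x0 r `<=` eball 0 R0 -> spatial_cutoff C0 x0 r psi,
      ~ eball x0 r `<=` eball 0 R0 -> boundary_cutoff C0 R0 psi0 x0 r psi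
    & forall x, 0 <= psi x <= psi0 x].

Definition is_cover (K1 K2 : nat) (R0 r : R) (n : nat) (c : 'I_n -> R3 R) :
    Prop :=
  [/\ 0 < r <= R0,
      eball 0 R0 `<=` \bigcup_i eball (c i) r,
      (R0 / r) ^+ 3 <= n%:R <= K1%:R * (R0 / r) ^+ 3
    & forall x, eball 0 R0 x ->
        (#|[pred i : 'I_n | (enorm (x - c i) < 2 * r)%R]| <= K2)%N].

End CutOffs.

Section Averages.
Context {R : realType}.
Local Notation mu := (@lebesgue_measure R).
Implicit Types (u : R -> R3 R -> R3 R) (eta : R -> R).

Definition vst u eta (psi_i : R3 R -> R) (r t : R) : R :=
  t^-1 * \int[mu]_(s in `]0, t[) ((r ^+ 3)^-1 * \int[leb3]_x
    dot (advect (vorticity u s x) (u s) x)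
        ((psi_i x * eta s) *: vorticity u s x)).

(* Cut-offs are a family indexed by center and scale; in particular the one at
   center 0 and scale R0 is the macro-scale cut-off psi_0. *)
Definition mean_vst u eta (psi : R3 R -> R -> R3 R -> R) (r : R) (n : nat)
    (c : 'I_n -> R3 R) (t : R) : R :=
  n%:R^-1 * \sum_(i < n) vst u eta (psi (c i) r) r t.

Definition macro_E u eta (psi0 : R3 R -> R) (R0 t : R) : R :=
  t^-1 * \int[mu]_(s in `]0, t[) ((R0 ^+ 3)^-1 * \int[leb3]_x
    (1 / 2 * enorm (vorticity u s x) ^+ 2 * Num.sqrt (psi0 x * eta s))).

Definition macro_P u eta (psi0 : R3 R -> R) (R0 t : R) : R :=
  t^-1 * \int[mu]_(s in `]0, t[) ((R0 ^+ 3)^-1 * \int[leb3]_x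
    (gradsq (vorticity u s) x * (psi0 x * eta s)))
  + t^-1 * ((R0 ^+ 3)^-1 * \int[leb3]_x
    (1 / 2 * enorm (vorticity u t x) ^+ 2 * psi0 x)).

(* Meaningful only when [macro_P] is positive. *)
Definition macro_sigma u eta (psi0 : R3 R -> R) (R0 t : R) : R :=
  Num.sqrt (macro_E u eta psi0 R0 t / macro_P u eta psi0 R0 t).

End Averages.

(* Main.v *)
(** Let phi_0 = psi_0 eta and let Psi be the sum of the cut-offs of the cover. The
    cut-offs are nested so that psi_0 <= Psi <= K2 psi_0, with gradient and
    Laplacian of Psi bounded by K2 C0 / R and K2 C0 / R^2 times powers of psi_0.
    Testing the vorticity equation with Psi eta omega expresses the total
    stretching as A_Psi plus an error, where A_Psi (the dissipation plus the
    enstrophy at time t, weighted by Psi) is comparable to A = t R0^3 P.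

    The linear part of the error is at most a multiple of e / R^2, with
    e = t R0^3 E = sigma^2 A. In the transport part,
    |omega|^2 |u| phi_0^(7/8) / R is estimated by Cauchy-Schwarz, by interpolating
    |omega|^4 phi_0^(7/4) between phi_0^(1/4) omega in L^2 and phi_0^(1/2) omega in
    L^6, and by the Sobolev inequality; Young's inequality with weight
    lam = R / (C max(M0^(1/2), R0^(1/2))) >= sigma^(1/2) bounds it by a multiple of
    lam M0^(1/2) A / R <= A / C. Hence for C large the error is at most A / 2. *)

Require Import Defs.
From HB Require Import structures.
From mathcomp Require Import all_boot all_order all_algebra.
From mathcomp Require Import all_classical all_reals all_analysis.
From mathcomp Require Import measurable_realfun ring lra.
Import Order.TTheory GRing.Theory Num.Theory.
Import numFieldNormedType.Exports.
Local Open Scope classical_set_scope.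
Local Open Scope ring_scope.

(** * Integrals of bounded functions with bounded support *)

(** The exponent 7/8 is what closes the transport estimate. With p = phi_0^(1/8) and m = |omega| the
    gradient bound leaves m^2 p^7 |u|; the square m^4 p^14 of its first factor splits exactly as (m
    p^2) (m p^4)^3, where m p^2 is controlled by E and m p^4 by the Sobolev inequality. The obstacle
    is that |omega| and the roots of the cut-offs need not be differentiable at their zeros, so
    derivatives are taken only of polynomials in the velocity, the vorticity, the cut-offs and their
    derivatives. Both entries of the maximum in the lower bound on R are used: M0 absorbs the
    transport term, and R0 gives R >= C^2 sigma, which absorbs e / R^2. The term with eta' is of the
    latter kind because R^2 <= T. Outside the ball of radius R0 the cover says nothing directly;
    there both comparisons of Psi with psi_0 come from moving points radially towards the sphere.
    Space-time integrals are finite for one reason: eta vanishes on (0, T/3) and t < T, so the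
    integrands live on a compact part of the slab, where u is smooth. *)

Section BoundedSupport.
Context {d} {T : measurableType d} {R : realType}.
Implicit Types (A : set T) (f g : T -> R).

(** Integrands are kept total and vanish off [A], so that all integrals run over the whole space.
    The class is stable under algebraic operations, sections and partial integrals, and it yields
    integrability as soon as [A] has finite measure. *)
Definition bounded_support A f := [/\ measurable_fun setT f,
  exists M : R, forall x, `|f x| <= M & forall x, ~ A x -> f x = 0].

Lemma bs0 A : bounded_support A (fun=> 0).
Proof. by split => //; exists 0 => x; rewrite normr0. Qed.

Lemma bsD {A f g} : bounded_support A f -> bounded_support A g -> bounded_support A (fun x => f x + g x).
Proof.
move=> [mf [M fM] f0] [mg [N gN] g0]; split.
- exact: measurable_funD.
- exists (M + N) => x; apply: (le_trans (ler_normD _ _)).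
  by apply: lerD; [exact: fM|exact: gN].
- by move=> x Ax; rewrite f0// g0// addr0.
Qed.

Lemma bsM {A f g} : bounded_support A f -> bounded_support A g -> bounded_support A (fun x => f x * g x).
Proof.
move=> [mf [M fM] f0] [mg [N gN] g0]; split.
- exact: measurable_funM.
- by exists (M * N) => x; rewrite normrM ler_pM.
- by move=> x Ax; rewrite f0// mul0r.
Qed.

Lemma bsZ {A} r {f} : bounded_support A f -> bounded_support A (fun x => r * f x).
Proof.
move=> [mf [M fM] f0]; split.
- exact: measurable_funM.
- by exists (`|r| * M) => x; rewrite normrM ler_wpM2l.
- by move=> x Ax; rewrite f0// mulr0.
Qed.

Lemma bsN {A f} : bounded_support A f -> bounded_support A (fun x => - f x).
Proof.
by move=> /(bsZ (-1)); congr bounded_support; apply/funext => x; rewrite mulN1r.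
Qed.

Lemma bsB {A f g} : bounded_support A f -> bounded_support A g -> bounded_support A (fun x => f x - g x).
Proof. by move=> bf /bsN; exact: bsD. Qed.

Lemma bs_norm {A f} : bounded_support A f -> bounded_support A (fun x => `|f x|).
Proof.
move=> [mf [M fM] f0]; split.
- exact: measurableT_comp.
- by exists M => x; rewrite normr_id.
- by move=> x Ax; rewrite f0// normr0.
Qed.

Lemma bs_sqrt {A f} : bounded_support A f -> bounded_support A (fun x => Num.sqrt (f x)).
Proof.
move=> [mf [M fM] f0]; split.
- apply: measurableT_comp mf.
  by apply: continuous_measurable_fun; exact: sqrt_continuous.
- exists (Num.sqrt M) => x; rewrite ger0_norm ?sqrtr_ge0// ler_wsqrtr//.
  exact: le_trans (ler_norm _) (fM x).
- by move=> x Ax; rewrite f0// sqrtr0.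
Qed.

Lemma bs_sum {A} (n : nat) (F : 'I_n -> T -> R) :
  (forall i, bounded_support A (F i)) -> bounded_support A (fun x => \sum_(i < n) F i x).
Proof.
move=> bF; have : forall s : seq 'I_n, bounded_support A (fun x => \sum_(i <- s) F i x).
  elim=> [|i s IH].
    by under [X in bounded_support _ X]funext do rewrite big_nil; exact: bs0.
  by under [X in bounded_support _ X]funext do rewrite big_cons; exact: bsD.
exact.
Qed.

End BoundedSupport.

Definition finite_measurable {d} {T : measurableType d} {R : realType}
  (mu : {measure set T -> \bar R}) (A : set T) :=
  measurable A /\ (mu A < +oo)%E.

Section Integration.
Context {d} {T : measurableType d} {R : realType}.
Context {mu : {measure set T -> \bar R}}.
Implicit Types (A : set T) (f g : T -> R).

Lemma bs_integrable {A f} : finite_measurable mu A -> bounded_support A f -> mu.-integrable setT (EFin \o f).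
Proof.
move=> [mA Aoo] [mf [M fM] f0].
suff : mu.-integrable A (EFin \o f).
  move/(integrable_mkcond (EFin \o f) mA); apply: eq_integrable => // x _.
  rewrite patchE; case: ifPn => // /negP xA /=.
  by rewrite f0// => Ax; apply: xA; rewrite inE.
apply: measurable_bounded_integrable => //; first exact: measurable_funS mf.
by exists M; split; [exact: num_real|move=> N MN x _ /=; rewrite (le_trans (fM x))// ltW].
Qed.

Lemma bs_intD {A f g} : finite_measurable mu A -> bounded_support A f -> bounded_support A g ->
  \int[mu]_x (f x + g x) = \int[mu]_x f x + \int[mu]_x g x.
Proof. by move=> fA bf bg; rewrite RintegralD//; exact: (bs_integrable fA). Qed.

Lemma bs_intB {A f g} : finite_measurable mu A -> bounded_support A f -> bounded_support A g ->
  \int[mu]_x (f x - g x) = \int[mu]_x f x - \int[mu]_x g x.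
Proof. by move=> fA bf bg; rewrite RintegralB//; exact: (bs_integrable fA). Qed.

Lemma bs_intZ {A} r {f} : finite_measurable mu A -> bounded_support A f ->
  \int[mu]_x (r * f x) = r * \int[mu]_x f x.
Proof. by move=> fA bf; rewrite RintegralZl//; exact: (bs_integrable fA). Qed.

Lemma bs_int_sum {A} (n : nat) (F : 'I_n -> T -> R) : finite_measurable mu A ->
  (forall i, bounded_support A (F i)) ->
  \int[mu]_x (\sum_(i < n) F i x) = \sum_(i < n) \int[mu]_x F i x.
Proof.
move=> fA bF; have : forall s : seq 'I_n, bounded_support A (fun x => \sum_(i <- s) F i x) /\
   \int[mu]_x (\sum_(i <- s) F i x) = \sum_(i <- s) \int[mu]_x F i x.
  elim=> [|i s [IH1 IH2]].
    under [X in bounded_support _ X]funext do rewrite big_nil; split; first exact: bs0.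
    under eq_Rintegral do rewrite big_nil.
    by rewrite big_nil Rintegral_cst// mul0r.
  under [X in bounded_support _ X]funext do rewrite big_cons; split; first exact: bsD.
  by under eq_Rintegral do rewrite big_cons; rewrite big_cons -IH2 (bs_intD fA).
by move=> /(_ (index_enum 'I_n))[].
Qed.

Lemma bs_int_le {A f g} : finite_measurable mu A -> bounded_support A f -> bounded_support A g ->
  (forall x, f x <= g x) -> \int[mu]_x f x <= \int[mu]_x g x.
Proof.
by move=> fA bf bg fg; apply: le_Rintegral => //; exact: (bs_integrable fA).
Qed.

Lemma bs_int_norm {A f} : finite_measurable mu A -> bounded_support A f ->
  `|\int[mu]_x f x| <= \int[mu]_x `|f x|.
Proof. by move=> fA bf; apply: le_normr_Rintegral => //; exact: (bs_integrable fA). Qed.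

(** The integral of (s f + t g)^2 is a nonnegative quadratic form in (s, t); its value at (-b, a) is
    a (a c - b^2). *)
Lemma bs_cauchy_schwarz {A f g} : finite_measurable mu A -> bounded_support A f -> bounded_support A g ->
  (\int[mu]_x (f x * g x)) ^+ 2 <=
    \int[mu]_x (f x ^+ 2) * \int[mu]_x (g x ^+ 2).
Proof.
move=> fA bf bg.
have bff := bsM bf bf; have bgg := bsM bg bg; have bfg := bsM bf bg.
set a := \int[mu]_x (f x ^+ 2); set b := \int[mu]_x (f x * g x).
set c := \int[mu]_x (g x ^+ 2).
have H s t : 0 <= s ^+ 2 * a + (2 * s * t) * b + t ^+ 2 * c.
  have : 0 <= \int[mu]_x ((s * f x + t * g x) ^+ 2).
    by apply: Rintegral_ge0 => x _; exact: sqr_ge0.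
  under eq_Rintegral.
    move=> x _.
    rewrite (_ : _ ^+ 2 = s ^+ 2 * (f x * f x) + (2 * s * t) * (f x * g x)
      + t ^+ 2 * (g x * g x)); last by ring.
    over.
  rewrite (bs_intD fA) ?(bs_intD fA) ?(bs_intZ _ fA)//;
    by [exact: bsZ|apply: bsD; exact: bsZ].
have a0 : 0 <= a by apply: Rintegral_ge0 => x _; exact: sqr_ge0.
have c0 : 0 <= c by apply: Rintegral_ge0 => x _; exact: sqr_ge0.
have [a00|a00] := eqVneq a 0.
  have [->|b0] := eqVneq b 0; first by rewrite expr0n mulr_ge0.
  (* With a = 0 the form at (s, 1) is 2 s b + c; this s makes it equal to -1. *)
  have := H (- (c + 1) / (2 * b)) 1.
  rewrite a00 (_ : _ + _ = -1); last by field.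
  by rewrite leNgt ltrN10.
have ap : 0 < a by rewrite lt0r a00.
have := H (- b) a; rewrite (_ : _ + _ = a * (a * c - b ^+ 2)); last by ring.
by rewrite pmulr_rge0// subr_ge0.
Qed.

Lemma bs_int_sqrt {A f g} : finite_measurable mu A -> bounded_support A f -> bounded_support A g ->
  (forall x, 0 <= f x) -> (forall x, 0 <= g x) ->
  \int[mu]_x (Num.sqrt (f x * g x)) <=
    Num.sqrt (\int[mu]_x f x * \int[mu]_x g x).
Proof.
move=> fA bf bg f0 g0.
have i0 : 0 <= \int[mu]_x (Num.sqrt (f x * g x)).
  by apply: Rintegral_ge0 => x _; exact: sqrtr_ge0.
rewrite -(ger0_norm i0) -sqrtr_sqr ler_wsqrtr//.
have := bs_cauchy_schwarz fA (bs_sqrt bf) (bs_sqrt bg).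
under eq_Rintegral do rewrite -sqrtrM//.
move/le_trans; apply.
by under eq_Rintegral do rewrite sqr_sqrtr//; under [X in _ * X <= _]eq_Rintegral do rewrite sqr_sqrtr//.
Qed.

Lemma bs_le_int {D : set T} {g : T -> R} {M : R} : finite_measurable mu D -> bounded_support D g ->
  (forall x, `|g x| <= M) -> `|\int[mu]_x g x| <= M * fine (mu D).
Proof.
move=> fD bg gM; have [mD Doo] := fD.
apply: (le_trans (bs_int_norm fD bg)).
rewrite -(Rintegral_cst mu mD) (Rintegral_mkcond mu D).
apply: (bs_int_le fD) => //.
- exact: bs_norm.
- split.
  + rewrite -(measurable_restrictT)//.
  + exists `|M| => x; rewrite patchE; case: ifPn; rewrite ?normr0//.
  + by move=> x Dx; rewrite patchE memNset.
- move=> x; rewrite patchE; case: ifPn => // /negP Dx.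
  by case: bg => _ _ ->; rewrite ?normr0// => ?; apply: Dx; rewrite inE.
Qed.

Lemma EFin_Rintegral (D : set T) (g : T -> R) : measurable D -> mu.-integrable D (EFin \o g) ->
  (\int[mu]_(x in D) (g x)%:E)%E = (\int[mu]_(x in D) g x)%:E.
Proof. by move=> mD ig; rewrite fineK//; exact: integrable_fin_num. Qed.

End Integration.

Section Fubini.
Context {d1 d2} {T1 : measurableType d1} {T2 : measurableType d2} {R : realType}.
Context {m1 : {sigma_finite_measure set T1 -> \bar R}}.
Context {m2 : {sigma_finite_measure set T2 -> \bar R}}.
Context {A : set T1} {B : set T2}.
Hypotheses (fA : finite_measurable m1 A) (fB : finite_measurable m2 B).

Lemma finite_measurableX : finite_measurable (m1 \x m2)%E (A `*` B).
Proof.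
case: fA fB => mA Aoo [mB Boo]; split; first exact: measurableX.
have := product_measure1E m1 m2 mA mB.
rewrite /= => ->; by rewrite lte_mul_pinfty// ge0_fin_numE.
Qed.

Context {f : T1 * T2 -> R}.
Hypothesis bf : bounded_support (A `*` B) f.

Lemma bs_section1 x : bounded_support B (fun y => f (x, y)).
Proof.
case: bf => mf [M fM] f0; split; first exact: measurable_fun_pair2.
- by exists M.
- by move=> y By; apply: f0 => -[].
Qed.

Lemma bs_section2 y : bounded_support A (fun x => f (x, y)).
Proof.
case: bf => mf [M fM] f0; split; first exact: measurable_fun_pair1.
- by exists M.
- by move=> x Ax; apply: f0 => -[].
Qed.

Let intf := bs_integrable finite_measurableX bf.

Lemma bs_int1 : bounded_support A (fun x => \int[m2]_y f (x, y)).
Proof.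
split.
- apply: measurableT_comp => //.
  exact: (measurable_fubini_F intf).
- case: bf => _ [M fM] _; exists (M * fine (m2 B)) => x.
  by apply: (bs_le_int fB (bs_section1 x)).
- move=> x Ax; case: bf => _ _ f0; under eq_Rintegral do rewrite f0 => [|[]]//.
  by rewrite Rintegral_cst// mul0r.
Qed.

Lemma bs_int2 : bounded_support B (fun y => \int[m1]_x f (x, y)).
Proof.
split.
- apply: measurableT_comp => //.
  exact: (measurable_fubini_G intf).
- case: bf => _ [M fM] _; exists (M * fine (m1 A)) => y.
  by apply: (bs_le_int fA (bs_section2 y)).
- move=> y By; case: bf => _ _ f0; under eq_Rintegral do rewrite f0 => [|[]]//.
  by rewrite Rintegral_cst// mul0r.
Qed.

Lemma bs_fubini1 :
  \int[(m1 \x m2)%E]_z f z = \int[m1]_x \int[m2]_y f (x, y).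
Proof.
rewrite [LHS]/Rintegral -(integral12_prod_meas1 intf); congr fine.
apply: eq_integral => x _; rewrite /fubini_F /=.
by rewrite EFin_Rintegral//; exact: bs_integrable fB (bs_section1 x).
Qed.

Lemma bs_fubini2 :
  \int[(m1 \x m2)%E]_z f z = \int[m2]_y \int[m1]_x f (x, y).
Proof.
rewrite [LHS]/Rintegral -(integral21_prod_meas1 intf); congr fine.
apply: eq_integral => x _; rewrite /fubini_G /=.
by rewrite EFin_Rintegral//; exact: bs_integrable fA (bs_section2 x).
Qed.

End Fubini.

(* The library's sigma-finite instance on products is shadowed by the one for
   subprobabilities, so the product is rebuilt under a new name. *)
Section ProductSigmaFinite.
Context {d1 d2} {T1 : measurableType d1} {T2 : measurableType d2} {R : realType}.
Variable m1 : {sigma_finite_measure set T1 -> \bar R}.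
Variable m2 : {sigma_finite_measure set T2 -> \bar R}.

Definition sigma_finite_prod : set (T1 * T2) -> \bar R := (m1 \x m2)%E.

HB.instance Definition _ := Measure.on sigma_finite_prod.

Lemma sigma_finite_prodP : sigma_finite setT sigma_finite_prod.
Proof.
have /sigma_finiteP[F [FT Fnd Foo]] := sigma_finiteT m1.
have /sigma_finiteP[G [GT Gnd Goo]] := sigma_finiteT m2.
exists (fun n => F n `*` G n).
  apply/seteqP; split => // -[x y] _.
  have [n _ Fnx] : (\bigcup_i F i) x by rewrite -FT.
  have [k _ Gky] : (\bigcup_i G i) y by rewrite -GT.
  exists (maxn n k) => //; split => /=.
    by apply: (subsetPset _ _ (Fnd _ _ (leq_maxl n k))).
  by apply: (subsetPset _ _ (Gnd _ _ (leq_maxr n k))).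
by move=> n; exact: finite_measurableX (Foo n) (Goo n).
Qed.

HB.instance Definition _ := Measure_isSigmaFinite.Build _ _ _ sigma_finite_prod
  sigma_finite_prodP.

End ProductSigmaFinite.

(** * Continuous functions on space and space-time *)

Section CountableBasis.
Context {R : realType}.
Local Notation RM := (measurableTypeR R).

(** The link between the topology and the product sigma-algebra. [N] is an arbitrary assignment of
    neighbourhoods, so that the notion passes to products through [filter_prod]. *)
Definition countable_basis {d} {T : measurableType d} (N : T -> set (set T)) :=
  exists B : nat -> set T, (forall n, measurable (B n)) /\
    forall x U, N x U -> exists n, B n x /\ B n `<=` U.

Lemma countable_basis_R : @countable_basis _ RM (fun x : R => nbhs x).
Proof.
exists (fun n => if unpickle n is Some (a, b) then `]ratr a, ratr b[%classic
  else set0); split.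
  by move=> n; case: (unpickle n) => [[a b]|//]; exact: measurable_itv.
move=> x U /nbhs_ballP[e /= e0 xU].
have [a] : exists q : rat, ratr q \in `](x - e), x[.
  by apply: rat_in_itvoo; rewrite ltrBlDr ltrDl.
have [b] : exists q : rat, ratr q \in `]x, (x + e)[.
  by apply: rat_in_itvoo; rewrite ltrDl.
rewrite !in_itv/= => /andP[xb be] /andP[ea ax].
exists (pickle (a, b)); rewrite pickleK; split => /=; first by rewrite in_itv/= ax.
move=> y /=; rewrite in_itv/= => /andP[ay yb]; apply: xU.
rewrite /ball/= ltr_norml; apply/andP; split; lra.
Qed.

Lemma countable_basis_prod {d1 d2} {T1 : measurableType d1}
  {T2 : measurableType d2} (N1 : T1 -> set (set T1)) (N2 : T2 -> set (set T2)) :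
  countable_basis N1 -> countable_basis N2 ->
  @countable_basis _ (T1 * T2)%type
    (fun z => filter_prod (N1 z.1) (N2 z.2)).
Proof.
move=> [B1 [mB1 B1N]] [B2 [mB2 B2N]].
exists (fun n => if unpickle n is Some (a, b) then B1 a `*` B2 b else set0).
split.
  by move=> n; case: (unpickle n) => [[a b]|//]; exact: measurableX.
move=> [x y] U [[V W] /= [Vx Wy] VWU].
have [a [B1x B1V]] := B1N _ _ Vx; have [b [B2y B2W]] := B2N _ _ Wy.
exists (pickle (a, b)); rewrite pickleK; split => // -[x' y'] [/= ? ?].
by apply: VWU; split => /=; [exact: B1V|exact: B2W].
Qed.

(** A set that is a neighbourhood of each of its points is the union of the basis members it
    contains, a countable union of measurable sets. Taken with a constant [f], the first conjunct
    gives the measurability of open sets. *)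
Lemma countable_basis_measurable {d} {T : measurableType d}
    (N : T -> set (set T)) (U : set T) (f : T -> R) :
  countable_basis N -> (forall x, U x -> N x U) ->
  (forall x, N x `<=` [set V | V x]) ->
  (forall x V W, N x V -> N x W -> N x (V `&` W)) ->
  (forall x (V : set R), U x -> nbhs (f x) V -> N x (f @^-1` V)) ->
  measurable U /\ @measurable_fun _ _ T RM U f.
Proof.
move=> [B [mB BN]] NU Nx NI cf.
have key V : (forall x, V x -> N x V) -> measurable V.
  move=> VN; rewrite (_ : V = \bigcup_(n in [set n | B n `<=` V]) B n).
    by apply: bigcup_measurable.
  apply/seteqP; split => [x Vx|x [n /= BV Bx]]; last exact: BV.
  by have [n [Bx BV]] := BN _ _ (VN _ Vx); exists n.
split; first exact: key.
apply: (measurability _ (RGenOpens.measurableE R)).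
move=> _ [_ [a [b ->] <-]]; apply: key => x [Ux fx].
apply: NI; first exact: NU.
by apply: cf => //; apply: open_nbhs_nbhs; split => //; exact: interval_open.
Qed.

Lemma countable_basis_R3 :
  @countable_basis _ (RM * RM * RM)%type (fun x : R3 R => nbhs x).
Proof.
have := countable_basis_prod _ _ (countable_basis_prod _ _ countable_basis_R
  countable_basis_R) countable_basis_R.
exact.
Qed.

Lemma countable_basis_R4 :
  @countable_basis _ (RM * RM * RM * RM)%type (fun x : R3 R * R => nbhs x).
Proof.
have := countable_basis_prod _ _ countable_basis_R3 countable_basis_R; exact.
Qed.

Lemma continuous_borel3 (f : R3 R -> R) : continuous f ->
  @measurable_fun _ _ (RM * RM * RM)%type RM setT f.
Proof.
move=> cf; apply: (countable_basis_measurable _ _ f countable_basis_R3 _ _ _ _).2.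
- by move=> x _; exact: filterT.
- by move=> x V /= /nbhs_singleton.
- by move=> x V W; exact: filterI.
- by move=> x V _ /cf.
Qed.

Lemma continuous_borel4 (U : set (R3 R * R)) (f : R3 R * R -> R) : open U ->
  (forall z, U z -> {for z, continuous f}) ->
  @measurable_fun _ _ (RM * RM * RM * RM)%type RM U f.
Proof.
move=> oU cf; apply: (countable_basis_measurable _ _ f countable_basis_R4 _ _ _ _).2.
- by move=> x Ux; apply: open_nbhs_nbhs.
- by move=> x V /= /nbhs_singleton.
- by move=> x V W; exact: filterI.
- by move=> x V Ux /(cf _ Ux).
Qed.

End CountableBasis.

Section ContinuousCompactSupport.
Context {R : realType}.
Local Notation RM := (measurableTypeR R).
Local Notation mu := (@lebesgue_measure R).
Implicit Types L t : R.

(** The same products as in [leb3], now carrying the sigma-finiteness that Fubini's theorem asks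
    for. *)
Definition lebesgue2 : {sigma_finite_measure set (RM * RM)%type -> \bar R} :=
  sigma_finite_prod mu mu.
Definition lebesgue3 : {sigma_finite_measure set (RM * RM * RM)%type -> \bar R} :=
  sigma_finite_prod lebesgue2 mu.

Definition seg L : set RM := `[- L, L]%classic.
Definition box2 L : set (RM * RM)%type := seg L `*` seg L.
Definition box3 L : set (RM * RM * RM)%type := box2 L `*` seg L.

Lemma finite_measurable_itv (a b : R) (c e : bool) :
  finite_measurable mu [set` Interval (BSide c a) (BSide e b)].
Proof.
split; first exact: measurable_itv.
rewrite [X in (X < _)%E]lebesgue_measure_itv; case: ifPn => // _; exact: ltry.
Qed.

Lemma finite_measurable_seg L : finite_measurable mu (seg L).
Proof. exact: finite_measurable_itv. Qed.

Lemma finite_measurable_box2 L : finite_measurable lebesgue2 (box2 L).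
Proof. exact: (@finite_measurableX _ _ _ _ _ mu mu _ _ (finite_measurable_seg L) (finite_measurable_seg L)). Qed.

Lemma finite_measurable_box3 L : finite_measurable leb3 (box3 L).
Proof. exact: (@finite_measurableX _ _ _ _ _ lebesgue2 mu _ _ (finite_measurable_box2 L) (finite_measurable_seg L)). Qed.

Lemma seg_compact L : compact (seg L : set R).
Proof. exact: segment_compact. Qed.

Lemma box3_compact L : compact (box3 L : set (R3 R)).
Proof.
apply: compact_setX; last exact: seg_compact.
by apply: compact_setX; exact: seg_compact.
Qed.

Lemma notin_box3 L (x : R3 R) : ~ box3 L x -> L < `|x|.
Proof.
move=> xL; rewrite ltNge; apply/negP => Lx; apply: xL.
have le (y : R) : `|y| <= `|x| -> seg L y.
  by move=> yx; rewrite /seg/= in_itv/= -ler_norml (le_trans yx).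
by split; [split|]; apply: le; rewrite !prod_normE/= !le_max lexx ?orbT.
Qed.

Lemma continuous_bs3 L (f : R3 R -> R) : continuous f ->
  (forall x, L < `|x| -> f x = 0) -> bounded_support (box3 L) f.
Proof.
move=> cf f0; split; first exact: continuous_borel3.
- have /compact_bounded[M [Mr HM]] : compact (f @` (box3 L)).
    apply: continuous_compact; last exact: box3_compact.
    exact: continuous_subspaceT.
  exists (`|M| + 1) => x.
  have [xL|/notin_box3 xL] := pselect (box3 L x).
    apply: HM; last by exists x.
    by rewrite (le_lt_trans (ler_norm M))// ltrDl.
  by rewrite f0// normr0 addr_ge0.
- by move=> x /notin_box3 /f0.
Qed.

Lemma slab_open T : open (slab T : set (R3 R * R)).
Proof.
rewrite (_ : slab T = snd @^-1` `]0, T[%classic); last first.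
  by apply/seteqP; split => z /=; rewrite in_itv.
by apply: open_comp => [z _|]; [exact: cvg_snd|exact: interval_open].
Qed.

Section SpaceTime.
Variables (T t a L : R) (f : R3 R * R -> R).
Hypotheses (a0 : 0 < a) (tT : t < T).
Hypothesis cf : forall z, slab T z -> {for z, continuous f}.
Hypothesis fa : forall x s, 0 < s < a -> f (x, s) = 0.
Hypothesis fL : forall x s, 0 < s < T -> L < `|x| -> f (x, s) = 0.

Let D : set (RM * RM * RM * RM)%type := setT `*` `]0, t[%classic.

(** Continuity of [f] is known only on the slab, hence the restriction to [D]. Since 0 < a and t <
    T, the product of the box with [a, t] is a compact subset of the slab, on which [f] is
    bounded. *)
Lemma bs_restrict4 : bounded_support (box3 L `*` `[a, t]%classic) (f \_ D).
Proof.
have Dslab : D `<=` slab T.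
  by move=> [x s] [_ /=]; rewrite /slab/= in_itv/= => /andP[-> /lt_trans ->].
split.
- have mD : measurable D by apply: measurableX => //; exact: measurable_itv.
  apply/(measurable_restrictT f mD).
  apply: (measurable_funS _ Dslab); last first.
    by apply: continuous_borel4; [exact: slab_open|].
  apply: (countable_basis_measurable _ _ (fun=> 0 : R) countable_basis_R4 _ _ _ _).1.
  + by move=> x Ux; apply: open_nbhs_nbhs; split => //; exact: slab_open.
  + by move=> x V /= /nbhs_singleton.
  + by move=> x V W; exact: filterI.
  + by move=> x V _ V0; apply: filterE => y /=; exact: nbhs_singleton V0.
- have /compact_bounded[M [Mr HM]] :
      compact (f @` (box3 L `*` `[a, t]%classic : set (R3 R * R))).
    apply: continuous_compact; last first.
      by apply: compact_setX; [exact: box3_compact|exact: segment_compact].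
    apply: continuous_in_subspaceT => -[x s] /set_mem[_ /=].
    rewrite in_itv/= => /andP[as_ st]; apply: cf.
    by rewrite /slab/= (lt_le_trans a0)// (le_lt_trans st).
  exists (`|M| + 1) => -[x s]; rewrite patchE; case: ifPn => [/set_mem[_ /=]|_].
    rewrite in_itv/= => /andP[s0 st].
    have [xL|/notin_box3 xL] := pselect (box3 L x); last first.
      by rewrite fL ?normr0 ?addr_ge0// s0 (lt_trans st).
    have [sa|as_] := ltP s a; first by rewrite fa ?normr0 ?addr_ge0// s0.
    apply: HM; last by exists (x, s) => //; split => //=; rewrite in_itv/= as_ ltW.
    by rewrite (le_lt_trans (ler_norm M))// ltrDl.
  by rewrite normr0 addr_ge0.
- move=> [x s] xs; rewrite patchE; case: ifPn => // /set_mem[_ /=].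
  rewrite in_itv/= => /andP[s0 st].
  have [xL|/notin_box3 xL] := pselect (box3 L x); last first.
    by rewrite fL// s0 (lt_trans st).
  have [sa|as_] := ltP s a; first by rewrite fa// s0.
  by exfalso; apply: xs; split => //=; rewrite in_itv/= as_ ltW.
Qed.

Let restrictE x s : (f \_ D) (x, s) = ((fun s => f (x, s)) \_ `]0, t[%classic) s.
Proof.
rewrite !patchE; congr (if _ then _ else _); apply/idP/idP.
- by move=> /set_mem[_ /mem_set].
- by move=> /set_mem st; apply/mem_set.
Qed.

Let fat : finite_measurable mu `[a, t]%classic := finite_measurable_itv a t true false.

Let int_restrict s : \int[leb3]_x (f \_ D) (x, s) =
  ((fun s => \int[leb3]_x f (x, s)) \_ `]0, t[%classic) s.
Proof.
rewrite patchE; under eq_Rintegral do rewrite restrictE patchE.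
by case: ifPn => // _; rewrite Rintegral_cst// mul0r.
Qed.

Lemma spacetime_integrable :
  mu.-integrable `]0, t[%classic (EFin \o (fun s => \int[leb3]_x f (x, s))).
Proof.
have /(bs_integrable fat) := @bs_int2 _ _ _ _ _ lebesgue3 mu _ _ (finite_measurable_box3 L) fat _ bs_restrict4.
under [X in _.-integrable _ X]funext do rewrite /= int_restrict.
move=> H; apply: ((integrable_mkcond _ _).2 _); first exact: measurable_itv.
apply: eq_integrable H => // s _ /=.
by rewrite !patchE; case: ifPn.
Qed.

Lemma spacetime_fubini :
  \int[mu]_(s in `]0, t[) \int[leb3]_x f (x, s) =
  \int[leb3]_x \int[mu]_(s in `]0, t[) f (x, s).
Proof.
rewrite Rintegral_mkcond; under eq_Rintegral do rewrite -int_restrict.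
rewrite -(@bs_fubini2 _ _ _ _ _ lebesgue3 mu _ _ (finite_measurable_box3 L) fat _ bs_restrict4).
rewrite (@bs_fubini1 _ _ _ _ _ lebesgue3 mu _ _ (finite_measurable_box3 L) fat _ bs_restrict4).
apply: eq_Rintegral => x _; rewrite [RHS]Rintegral_mkcond.
by apply: eq_Rintegral => s _; rewrite restrictE.
Qed.

End SpaceTime.
End ContinuousCompactSupport.

(** * Directional derivatives and the fundamental theorem of calculus *)

Section DirectionalDerivatives.
Context {R : realType} {V : normedModType R}.
Implicit Types (f g : V -> R) (x v : V).

Lemma is_derive_add f g x v (a b : R) : is_derive x v f a -> is_derive x v g b ->
  is_derive x v (fun y => f y + g y) (a + b).
Proof. by move=> fa gb; exact: (is_deriveD fa gb). Qed.

Lemma is_derive_neg f x v (a : R) : is_derive x v f a ->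
  is_derive x v (fun y => - f y) (- a).
Proof. by move=> fa; exact: (is_deriveN fa). Qed.

Lemma is_derive_sub f g x v (a b : R) : is_derive x v f a -> is_derive x v g b ->
  is_derive x v (fun y => f y - g y) (a - b).
Proof. by move=> fa gb; exact: (is_deriveB fa gb). Qed.

Lemma is_derive_mul f g x v (a b : R) : is_derive x v f a -> is_derive x v g b ->
  is_derive x v (fun y => f y * g y) (a * g x + f x * b).
Proof.
move=> fa gb; apply: (is_derive_eq (is_deriveM fa gb)).
by rewrite /GRing.scale/= addrC mulrC.
Qed.

Lemma is_derive_const (c : R) x v : is_derive x v (fun _ : V => c) 0.
Proof. exact: is_derive_cst. Qed.

Lemma is_derive_scale f x v (c a : R) : is_derive x v f a ->
  is_derive x v (fun y => c * f y) (c * a).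
Proof. by move=> fa; apply: (is_derive_eq (is_derive_mul _ _ _ _ _ _ (is_derive_const c x v) fa)); ring. Qed.

Lemma is_derive_square f x v (a : R) : is_derive x v f a ->
  is_derive x v (fun y => f y ^+ 2) (2 * f x * a).
Proof. by move=> fa; apply: (is_derive_eq (is_derive_mul _ _ _ _ _ _ fa fa)); ring. Qed.

Lemma is_derive_bigsum n (F : 'I_n -> V -> R) (a : 'I_n -> R) x v :
  (forall i, is_derive x v (F i) (a i)) ->
  is_derive x v (fun y => \sum_(i < n) F i y) (\sum_(i < n) a i).
Proof.
move=> dF; have : forall s : seq 'I_n,
    is_derive x v (fun y => \sum_(i <- s) F i y) (\sum_(i <- s) a i).
  elim=> [|i s IH].
    by under [X in is_derive _ _ X]funext do rewrite big_nil; rewrite big_nil; exact: is_derive_const.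
  by under [X in is_derive _ _ X]funext do rewrite big_cons; rewrite big_cons; exact: is_derive_add.
exact.
Qed.

Lemma is_derive_val {f x v} {a : R} : is_derive x v f a -> 'D_v f x = a.
Proof. by case. Qed.

Lemma is_derive_near_eq f g x v (a : R) : (\near x, f x = g x) -> is_derive x v f a ->
  is_derive x v g a.
Proof.
move=> fg [df <-]; split; last by rewrite -(near_eq_derive _ fg).
exact: (near_eq_derivable fg df).
Qed.

Lemma derive_near0 f x v : (\near x, f x = 0) -> 'D_v f x = 0.
Proof.
move=> f0; by rewrite (near_eq_derive _ (f0 : \near x, f x = cst 0 x)) derive_cst.
Qed.

End DirectionalDerivatives.

Section Slices.
Context {R : realType} {V W : normedModType R}.
Variables (c : V -> W) (v : V) (w : W) (y : V) (g : W -> R).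
Hypothesis cvw : forall h : R, c (h *: v + y) = h *: w + c y.

(** As [c] carries the line through [y] along [v] to the line through [c y] along [w], the two
    difference quotients are the same function of h, and the equality holds whether or not they
    converge. *)
Lemma derive_slice : 'D_v (g \o c) y = 'D_w g (c y).
Proof.
rewrite /derive; set f1 := (fun h => _); set f2 := (fun h => _).
suff -> : f1 = f2 by [].
by apply/funext => h; rewrite /f1 /f2 /= cvw.
Qed.

Lemma derivable_slice : derivable (g \o c) y v <-> derivable g (c y) w.
Proof.
rewrite /derivable; set f1 := (fun h => _); set f2 := (fun h => _).
suff -> : f1 = f2 by [].
by apply/funext => h; rewrite /f1 /f2 /= cvw.
Qed.

End Slices.

Section OneDim.
Context {R : realType}.
Local Notation mu := (@lebesgue_measure R).
Implicit Types (f : R -> R) (a b L : R).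

Lemma Rintegral_FTC f a b : a < b ->
  (forall x, a <= x <= b -> derivable f x 1 /\ {for x, continuous (derive1 f)}) ->
  \int[mu]_(x in `[a, b]) derive1 f x = f b - f a.
Proof.
move=> ab H.
have cf x : a <= x <= b -> {for x, continuous f}.
  by move=> /H[df _]; apply: differentiable_continuous; exact/derivable1_diffP.
rewrite /Rintegral (@continuous_FTC2 _ _ f _ _ ab) => [//|||//].
- apply: continuous_in_subspaceT => x /set_mem /=; rewrite in_itv/= => /H[_].
  exact.
- split.
  + by move=> x; rewrite in_itv/= => /andP[/ltW ax /ltW xb]; apply: (H x _).1; rewrite ax.
  + by apply: cvg_at_right_filter; apply: cf; rewrite lexx ltW.
  + by apply: cvg_at_left_filter; apply: cf; rewrite lexx ltW.
Qed.

Variables (f : R -> R) (L : R).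
Hypothesis df : forall x, derivable f x 1.
Hypothesis cf' : continuous (derive1 f).
Hypothesis fL : forall x, L < `|x| -> f x = 0.

(** [L] may be negative; the maximum makes [-M, M] a genuine interval. *)
Let M := Num.max L 0.

Let f'0 x : M < `|x| -> derive1 f x = 0.
Proof.
move=> Mx; rewrite derive1E derive_near0//.
have : \forall y \near x, M < `|y|.
  apply: (@norm_continuous _ R^o x [set z | M < z]).
  by apply: open_nbhs_nbhs; split => //; exact: open_gt.
apply: filterS => y My; apply: fL.
by rewrite (le_lt_trans _ My)// le_max lexx.
Qed.

Let bsf' : bounded_support (seg M) (derive1 f).
Proof.
split; first exact: continuous_measurable_fun.
- have /compact_bounded[B [_ HB]] : compact (derive1 f @` (seg M : set R)).
    apply: continuous_compact; last exact: seg_compact.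
    exact: continuous_subspaceT.
  exists (`|B| + 1) => x; have [Mx|xM] := ltP M `|x|.
    by rewrite f'0// normr0 addr_ge0.
  apply: HB; last by exists x => //; rewrite /seg/= in_itv/= -ler_norml.
  by rewrite (le_lt_trans (ler_norm B))// ltrDl.
- move=> x xM; apply: f'0; rewrite ltNge; apply/negP => ?; apply: xM.
  by rewrite /seg/= in_itv/= -ler_norml.
Qed.

Lemma int_derive1_compact : \int[mu]_x derive1 f x = 0.
Proof.
have M0 : 0 <= M by rewrite le_max lexx orbT.
(* [fL] gives zeros of [f] only strictly beyond [L], hence the margin 1 at both endpoints. *)
have -> : \int[mu]_x derive1 f x = \int[mu]_(x in `[- (M + 1), M + 1]) derive1 f x.
  rewrite [RHS]Rintegral_mkcond; apply: eq_Rintegral => x _.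
  rewrite patchE; case: ifPn => // /negP xM; apply: f'0.
  rewrite ltNge; apply/negP => xM'; apply: xM; apply/mem_set => /=.
  by rewrite in_itv/= -ler_norml (le_trans xM')// lerDl.
have LM : L < M + 1 by rewrite (@le_lt_trans _ _ M)// ?ltrDl// le_max lexx.
rewrite Rintegral_FTC ?fL ?subrr//.
- by rewrite normrN ger0_norm// addr_ge0.
- by rewrite ger0_norm// addr_ge0.
- lra.
- by move=> x _; split; [exact: df|exact: cf'].
Qed.

Lemma le_int_derive1 x : f x <= \int[mu]_y `|derive1 f y|.
Proof.
(* A starting point to the left of [x] and strictly to the left of the support, so that f a = 0. *)
pose a := Num.min x (- M) - 1.
have M0 : 0 <= M by rewrite le_max lexx orbT.
have ax : a < x by rewrite /a ltrBlDr (@le_lt_trans _ _ x) ?ltrDl// ge_min lexx.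
have fa : f a = 0.
  have aM : a < - M by rewrite /a ltrBlDr (@le_lt_trans _ _ (- M)) ?ltrDl// ge_min lexx orbT.
  have : M < `|a| by rewrite ltr0_norm; lra.
  by move=> Ma; apply: fL; rewrite (le_lt_trans _ Ma)// le_max lexx.
have := Rintegral_FTC f a x ax; rewrite fa subr0 => <-; last first.
  by move=> y _; split; [exact: df|exact: cf'].
have fM := finite_measurable_seg M.
rewrite Rintegral_mkcond; apply: (bs_int_le fM); last 1 first.
- by move=> y; rewrite patchE; case: ifPn => _; rewrite ?normr_ge0 ?ler_norm.
- case: bsf' => mf' [B HB] f'00; split.
  + apply/(measurable_restrictT _ (measurable_itv _)).
    exact: measurable_funS mf'.
  + by exists B => y; rewrite patchE; case: ifPn => // _; rewrite normr0 (le_trans _ (HB 0)).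
  + by move=> y yM; rewrite patchE; case: ifPn => // _; rewrite f'00.
- exact: bs_norm.
Qed.

End OneDim.

(** * The Loomis-Whitney and Gagliardo-Nirenberg inequalities *)

Section IteratedIntegrals.
Context {R : realType}.
Local Notation RM := (measurableTypeR R).
Local Notation mu := (@lebesgue_measure R).
Implicit Types (L : R) (f g h : R3 R -> R).

Lemma bs3_slice {L f} (bf : bounded_support (box3 L) f) z :
  @bounded_support _ (RM * RM)%type R (box2 L) (fun p => f (p, z)).
Proof. exact: bs_section2 bf z. Qed.

Lemma int3_last {L f} : bounded_support (box3 L) f ->
  \int[leb3]_x f x = \int[mu]_z \int[lebesgue2]_p f (p, z).
Proof.
by move=> bf; exact: (@bs_fubini2 _ _ _ _ _ lebesgue2 mu _ _ (finite_measurable_box2 L) (finite_measurable_seg L) _ bf).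
Qed.

Lemma bs3_int_last {L f} : bounded_support (box3 L) f ->
  bounded_support (seg L) (fun z => \int[lebesgue2]_p f (p, z)).
Proof.
by move=> bf; exact: (@bs_int2 _ _ _ _ _ lebesgue2 mu _ _ (finite_measurable_box2 L) (finite_measurable_seg L) _ bf).
Qed.

Lemma int3_first {L f} : bounded_support (box3 L) f ->
  \int[leb3]_x f x = \int[lebesgue2]_p \int[mu]_z f (p, z).
Proof.
by move=> bf; exact: (@bs_fubini1 _ _ _ _ _ lebesgue2 mu _ _ (finite_measurable_box2 L) (finite_measurable_seg L) _ bf).
Qed.

Lemma bs3_int_first {L f} : bounded_support (box3 L) f ->
  @bounded_support _ (RM * RM)%type R (box2 L) (fun p => \int[mu]_z f (p, z)).
Proof.
by move=> bf; exact: (@bs_int1 _ _ _ _ _ lebesgue2 mu _ _ (finite_measurable_box2 L) (finite_measurable_seg L) _ bf).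
Qed.

Section Plane.
Context {L : R} {f : R * R -> R}.
Hypothesis bf : @bounded_support _ (RM * RM)%type R (box2 L) f.

Lemma int2_xy : \int[lebesgue2]_p f p = \int[mu]_x \int[mu]_y f (x, y).
Proof. exact: (@bs_fubini1 _ _ _ _ _ mu mu _ _ (finite_measurable_seg L) (finite_measurable_seg L) _ bf). Qed.

Lemma int2_yx : \int[lebesgue2]_p f p = \int[mu]_y \int[mu]_x f (x, y).
Proof. exact: (@bs_fubini2 _ _ _ _ _ mu mu _ _ (finite_measurable_seg L) (finite_measurable_seg L) _ bf). Qed.

Lemma bs2_int_y : bounded_support (seg L) (fun x => \int[mu]_y f (x, y)).
Proof. exact: (@bs_int1 _ _ _ _ _ mu mu _ _ (finite_measurable_seg L) (finite_measurable_seg L) _ bf). Qed.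

Lemma bs2_int_x : bounded_support (seg L) (fun y => \int[mu]_x f (x, y)).
Proof. exact: (@bs_int2 _ _ _ _ _ mu mu _ _ (finite_measurable_seg L) (finite_measurable_seg L) _ bf). Qed.

Lemma bs2_slice_y y : bounded_support (seg L) (fun x => f (x, y)).
Proof. exact: (bs_section2 bf y). Qed.

End Plane.

Lemma int_ge0 {d} {T : measurableType d} (m : {measure set T -> \bar R})
  (f : T -> R) : (forall x, 0 <= f x) -> 0 <= \int[m]_x f x.
Proof. by move=> f0; apply: Rintegral_ge0. Qed.

(** Three applications of Cauchy-Schwarz, in x, then y, then z: at each stage one of the three
    factors does not depend on the variable of integration and comes out, and the other two are
    integrated under the square root. The factors are line integrals of functions on R^3 because
    they will be the integrals of |d_i g| along the coordinate lines. *)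
Lemma loomis_whitney L f0 f1 f2 h :
  bounded_support (box3 L) f0 -> bounded_support (box3 L) f1 -> bounded_support (box3 L) f2 -> bounded_support (box3 L) h ->
  (forall p, 0 <= f0 p) -> (forall p, 0 <= f1 p) -> (forall p, 0 <= f2 p) ->
  (forall x y z, h (x, y, z) <= Num.sqrt (
    (\int[mu]_a f0 (a, y, z)) *
    ((\int[mu]_b f1 (x, b, z)) * (\int[mu]_c f2 (x, y, c))))) ->
  \int[leb3]_p h p <= Num.sqrt ((\int[leb3]_p f0 p) *
    ((\int[leb3]_p f1 p) * (\int[leb3]_p f2 p))).
Proof.
move=> b0 b1 b2 bh p0 p1 p2 hle.
have fL := finite_measurable_seg L.
pose G0 z y := \int[mu]_a f0 (a, y, z).
pose G1 z x := \int[mu]_b f1 (x, b, z).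
pose G2 p := \int[mu]_c f2 (p, c).
have G00 z y : 0 <= G0 z y by exact: int_ge0.
have G10 z x : 0 <= G1 z x by exact: int_ge0.
have G20 p : 0 <= G2 p by exact: int_ge0.
have bG0 z : bounded_support (seg L) (G0 z) by exact: (bs2_int_x (bs3_slice b0 z)).
have bG1 z : bounded_support (seg L) (G1 z) by exact: (bs2_int_y (bs3_slice b1 z)).
have bG2 : bounded_support (box2 L : set (RM * RM)%type) G2 by exact: bs3_int_first.
pose al z := \int[mu]_y G0 z y.
pose be z := \int[mu]_x G1 z x.
pose ga y := \int[mu]_x G2 (x, y).
have al0 z : 0 <= al z by exact: int_ge0.
have be0 z : 0 <= be z by exact: int_ge0.
have ga0 z : 0 <= ga z by exact: int_ge0.
have alE : al = fun z => \int[lebesgue2]_p f0 (p, z).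
  by apply/funext => z; rewrite /al /G0 (int2_yx (bs3_slice b0 z)).
have beE : be = fun z => \int[lebesgue2]_p f1 (p, z).
  by apply/funext => z; rewrite /be /G1 (int2_xy (bs3_slice b1 z)).
have bal : bounded_support (seg L) al by rewrite alE; exact: bs3_int_last.
have bbe : bounded_support (seg L) be by rewrite beE; exact: bs3_int_last.
have bga : bounded_support (seg L) ga by exact: bs2_int_x bG2.
have IA : \int[leb3]_p f0 p = \int[mu]_z al z by rewrite (int3_last b0) alE.
have IB : \int[leb3]_p f1 p = \int[mu]_z be z by rewrite (int3_last b1) beE.
have IG : \int[leb3]_p f2 p = \int[mu]_y ga y.
  exact: etrans (int3_first b2) (int2_yx bG2).
set Ga := \int[leb3]_p f2 p in IG *.
have Ga0 : 0 <= Ga by exact: int_ge0.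
have inner z y : \int[mu]_x h (x, y, z) <= Num.sqrt (be z) * Num.sqrt (G0 z y * ga y).
  apply: (@le_trans _ _ (\int[mu]_x (Num.sqrt (G0 z y) *
      Num.sqrt (G1 z x * G2 (x, y))))).
    apply: (bs_int_le fL).
    - exact: (bs2_slice_y (bs3_slice bh z) y).
    - apply: bsZ; apply: bs_sqrt; apply: bsM => //; exact: (bs2_slice_y bG2 y).
    - by move=> x; rewrite -sqrtrM//; exact: hle.
  have b12 : bounded_support (seg L) (fun x => G2 (x, y)) by exact: (bs2_slice_y bG2 y).
  rewrite (bs_intZ _ fL); last by apply: bs_sqrt; exact: bsM.
  rewrite [X in _ <= _ * X]sqrtrM// mulrCA -sqrtrM//.
  by rewrite ler_wpM2l ?sqrtr_ge0// (bs_int_sqrt fL).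
have middle z : \int[mu]_y \int[mu]_x h (x, y, z) <=
    Num.sqrt Ga * Num.sqrt (al z * be z).
  apply: (@le_trans _ _ (\int[mu]_y (Num.sqrt (be z) * Num.sqrt (G0 z y * ga y)))).
    apply: (bs_int_le fL) => //.
    - exact: (bs2_int_x (bs3_slice bh z)).
    - by apply: bsZ; apply: bs_sqrt; exact: bsM.
  rewrite (bs_intZ _ fL); last by apply: bs_sqrt; exact: bsM.
  rewrite [al z * _]mulrC [Num.sqrt (be z * _)]sqrtrM// mulrCA -sqrtrM//.
  by rewrite ler_wpM2l ?sqrtr_ge0// [Ga * _]mulrC IG (bs_int_sqrt fL).
rewrite (int3_last bh).
apply: (@le_trans _ _ (\int[mu]_z (Num.sqrt Ga * Num.sqrt (al z * be z)))).
  apply: (bs_int_le fL) => [||z].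
  - exact: bs3_int_last.
  - by apply: bsZ; apply: bs_sqrt; exact: bsM.
  - by rewrite (int2_yx (bs3_slice bh z)).
rewrite (bs_intZ _ fL); last by apply: bs_sqrt; exact: bsM.
rewrite mulrA [_ * Ga]mulrC sqrtrM//.
by rewrite ler_wpM2l ?sqrtr_ge0// IA IB (bs_int_sqrt fL).
Qed.

End IteratedIntegrals.

(** * Compactly supported functions along coordinate lines *)

Section CompactlySupportedGradient.
Context {R : realType}.
Local Notation RM := (measurableTypeR R).
Local Notation mu := (@lebesgue_measure R).

Lemma unit_vecE : (unit_vec 0 = (1, 0, 0) :> R3 R) *
  (unit_vec 1 = (0, 1, 0) :> R3 R) * (unit_vec 2 = (0, 0, 1) :> R3 R).
Proof. by []. Qed.

Lemma ord3P (i : 'I_3) : [\/ i = 0, i = 1 | i = 2].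
Proof.
case: i => -[|[|[|//]]] Hi; [apply: Or31|apply: Or32|apply: Or33]; exact: val_inj.
Qed.

(** One formula for the three families of coordinate lines, so that statements can be uniform in
    [i]: the parameter [s] replaces the i-th of x, y, z, and the replaced argument is a dummy. *)
Definition axis (i : 'I_3) (x y z s : R) : R3 R :=
  if i == 0 then (s, y, z) else if i == 1 then (x, s, z) else (x, y, s).

Lemma axisD i x y z s h :
  axis i x y z (h *: 1 + s) = h *: unit_vec i + axis i x y z s.
Proof.
by case: (ord3P i) => ->; rewrite /axis/= unit_vecE;
  congr ((_, _), _); rewrite /= ?(scaler0, add0r).
Qed.

Lemma continuous_pair {T U V : topologicalType} (f : T -> U) (g : T -> V) x :
  {for x, continuous f} -> {for x, continuous g} ->
  {for x, continuous (fun y => (f y, g y))}.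
Proof. by move=> cf cg; exact: cvg_pair cf cg. Qed.

Lemma axis_continuous i x y z : continuous (axis i x y z).
Proof.
move=> s; case: (ord3P i) => ->; rewrite /axis/=;
  repeat first [exact: cvg_cst|exact: cvg_id|apply: continuous_pair].
Qed.

Lemma axis_norm i x y z s : `|s| <= `|axis i x y z s|.
Proof.
by case: (ord3P i) => ->; rewrite /axis/= !prod_normE/= !le_max lexx ?orbT.
Qed.

Variables (g : R3 R -> R) (L : R).
Hypothesis dg : forall i x, derivable g x (unit_vec i).
Hypothesis cg : forall i, continuous (partial i g).
Hypothesis gL : forall x, L < `|x| -> g x = 0.

Lemma derive1_axis i x y z s :
  derive1 (g \o axis i x y z) s = partial i g (axis i x y z s).
Proof.
rewrite derive1E /partial; apply: derive_slice => h; exact: axisD.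
Qed.

Lemma partial_support i x : L < `|x| -> partial i g x = 0.
Proof.
move=> Lx; rewrite /partial derive_near0//.
have : \forall y \near x, L < `|y|.
  apply: (@norm_continuous _ _ x [set z | L < z]).
  by apply: open_nbhs_nbhs; split => //; exact: open_gt.
by apply: filterS => y; exact: gL.
Qed.

Lemma bs_partial i : bounded_support (box3 L) (partial i g).
Proof. by apply: continuous_bs3 => //; exact: partial_support. Qed.

Let along i x y z : [/\ forall s, derivable (g \o axis i x y z) s 1,
  continuous (derive1 (g \o axis i x y z)) &
  forall s, L < `|s| -> (g \o axis i x y z) s = 0].
Proof.
split.
- by move=> s; apply/(derivable_slice _ _ _ _ _ (axisD i x y z s)).
- rewrite (_ : derive1 _ = partial i g \o axis i x y z); last first.
    by apply/funext => s; rewrite derive1_axis.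
  by move=> s; apply: continuous_comp; [exact: axis_continuous|exact: cg].
- by move=> s Ls; apply: gL; apply: (lt_le_trans Ls); exact: axis_norm.
Qed.

Lemma int_axis i x y z : \int[mu]_s partial i g (axis i x y z s) = 0.
Proof.
have [d c s] := along i x y z.
by rewrite -(int_derive1_compact _ _ d c s); apply: eq_Rintegral => a _; rewrite derive1_axis.
Qed.

Lemma int_partial i : \int[leb3]_x partial i g x = 0.
Proof.
have bp := bs_partial i.
have z0 d (T : measurableType d) (m : {measure set T -> \bar R}) (f : T -> R) :
    (forall x, f x = 0) -> \int[m]_x f x = 0.
  by move=> f0; under eq_Rintegral do rewrite f0; rewrite Rintegral_cst// mul0r.
case: (ord3P i) bp => -> bp.
- rewrite (int3_last bp); apply: (z0 _ _ _ _) => z; rewrite (int2_yx (bs3_slice bp z)).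
  by apply: (z0 _ _ _ _) => y; exact: (int_axis 0 0 y z).
- rewrite (int3_last bp); apply: (z0 _ _ _ _) => z; rewrite (int2_xy (bs3_slice bp z)).
  by apply: (z0 _ _ _ _) => x; exact: (int_axis 1 x 0 z).
- rewrite (int3_first bp); apply: (z0 _ _ _ _) => -[x y]; exact: (int_axis 2 x y 0).
Qed.

Lemma le_int_axis i x y z s :
  g (axis i x y z s) <= \int[mu]_a `|partial i g (axis i x y z a)|.
Proof.
have [d c e] := along i x y z.
apply: (le_trans (le_int_derive1 _ _ d c e s)).
by under eq_Rintegral do rewrite derive1_axis.
Qed.

(* h plays the role of g^(3/2). *)
Lemma gagliardo (h : R3 R -> R) : bounded_support (box3 L) h -> (forall x, 0 <= g x) ->
  (forall x, h x <= Num.sqrt (g x ^+ 3)) ->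
  \int[leb3]_x h x <= Num.sqrt (\int[leb3]_x `|partial 0 g x| *
    (\int[leb3]_x `|partial 1 g x| * \int[leb3]_x `|partial 2 g x|)).
Proof.
move=> bh g0 hg; apply: (loomis_whitney L) => //; try exact: bs_norm (bs_partial _).
move=> x y z; apply: (le_trans (hg _)); rewrite ler_wsqrtr//.
rewrite !exprS expr0 mulr1.
apply: ler_pM => //; first exact: mulr_ge0.
  exact: (le_int_axis 0 0 y z x).
apply: ler_pM => //.
  exact: (le_int_axis 1 x 0 z y).
exact: (le_int_axis 2 x y 0 z).
Qed.

End CompactlySupportedGradient.

(** * Smooth functions and the vorticity equation *)

Section SmoothCalculus.
Context {R : realType} {V : normedModType R}.
Implicit Types (f g : V -> R) (U : set V) (v w x : V).

Lemma iter_derive_rcons vs v f :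
  iter_derive (rcons vs v) f = iter_derive vs ('D_v f).
Proof. by elim: vs => //= w vs ->. Qed.

Lemma smooth_continuous {U f} : smooth_on U f -> forall x, U x -> {for x, continuous f}.
Proof. by move=> sf x Ux; exact: (sf [::] x Ux).1. Qed.

Lemma smooth_derivable {U f} : smooth_on U f -> forall v x, U x -> derivable f x v.
Proof. by move=> sf v x Ux; exact: (sf [::] x Ux).2. Qed.

Lemma smooth_is_derive {U f} : smooth_on U f ->
  forall v x, U x -> is_derive x v f ('D_v f x).
Proof. by move=> sf v x Ux; apply/derivableP; exact: smooth_derivable sf v x Ux. Qed.

Lemma smooth_derive {U f} v : smooth_on U f -> smooth_on U ('D_v f).
Proof. by move=> sf vs x Ux; rewrite -iter_derive_rcons; exact: sf. Qed.

Lemma iter_deriveB {U f g} : open U -> smooth_on U f -> smooth_on U g ->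
  forall vs x, U x -> iter_derive vs (fun y => f y - g y) x =
    iter_derive vs f x - iter_derive vs g x.
Proof.
move=> oU sf sg; elim=> //= v vs IH x Ux.
have Hx : \near x, (fun y => iter_derive vs f y - iter_derive vs g y) x =
                   iter_derive vs (fun y => f y - g y) x.
  have : nbhs x U by exact: open_nbhs_nbhs.
  by apply: filterS => y Uy /=; rewrite IH.
rewrite -(near_eq_derive v Hx).
have [_ /(_ v)/derivableP df] := sf vs x Ux.
have [_ /(_ v)/derivableP dg] := sg vs x Ux.
by have [_ ->] := is_derive_sub _ _ _ _ _ _ df dg.
Qed.

Lemma continuous_near_eq f g x : (\near x, f x = g x) ->
  {for x, continuous f} -> {for x, continuous g}.
Proof.
move=> fg cf; rewrite /prop_for /continuous_at -(nbhs_singleton fg).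
by apply: cvg_trans cf; exact: near_eq_cvg.
Qed.

Lemma smooth_sub {U f g} : open U -> smooth_on U f -> smooth_on U g ->
  smooth_on U (fun y => f y - g y).
Proof.
move=> oU sf sg vs x Ux.
have Hx : \near x, (fun y => iter_derive vs f y - iter_derive vs g y) x =
                   iter_derive vs (fun y => f y - g y) x.
  have : nbhs x U by exact: open_nbhs_nbhs.
  by apply: filterS => y Uy /=; rewrite (iter_deriveB oU).
have [cf df] := sf vs x Ux; have [cg dg] := sg vs x Ux; split.
- apply: (continuous_near_eq _ _ _ Hx).
  exact: (@cvgB _ _ _ _ _ (iter_derive vs f) (iter_derive vs g)).
- move=> v; have /derivableP dfv := df v; have /derivableP dgv := dg v.
  by have [] := is_derive_near_eq _ _ _ _ _ Hx (is_derive_sub _ _ _ _ _ _ dfv dgv).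
Qed.

Lemma line_slice v a (h s : R) :
  (fun r : R => r *: v + a) (h *: 1 + s) = h *: v + (s *: v + a).
Proof. by rewrite /= scalerDl -scalerA scale1r addrA. Qed.

Lemma line_is_derive {U f} v a (s : R) : smooth_on U f -> U (s *: v + a) ->
  is_derive s 1 (fun r : R => f (r *: v + a)) ('D_v f (s *: v + a)).
Proof.
move=> sf Us; split.
  by apply/(derivable_slice _ _ _ _ _ (fun h => line_slice v a h s)); exact: smooth_derivable sf _ _ Us.
exact: (derive_slice _ _ _ _ _ (fun h => line_slice v a h s)).
Qed.

Lemma line_MVT {U f} v a (h : R) : smooth_on U f -> 0 < h ->
  (forall s, 0 <= s <= h -> U (s *: v + a)) ->
  exists2 s, 0 <= s <= h & f (h *: v + a) - f a = h * 'D_v f (s *: v + a).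
Proof.
move=> sf h0 Uh.
pose F (r : R) := f (r *: v + a).
have dF s : 0 <= s <= h -> is_derive s 1 F ('D_v f (s *: v + a)).
  by move=> /Uh; exact: line_is_derive sf.
have [||s sh] := @MVT R F (fun s => 'D_v f (s *: v + a)) 0 h h0.
- by move=> s; rewrite in_itv/= => /andP[/ltW s0 /ltW sh]; apply: dF; rewrite s0.
- apply: continuous_in_subspaceT => s /set_mem/=; rewrite in_itv/= => /dF[ds _].
  by apply: differentiable_continuous; exact/derivable1_diffP.
rewrite /F scale0r add0r subr0 mulrC => ->; exists s => //.
by move: sh; rewrite in_itv/= => /andP[/ltW -> /ltW].
Qed.

(** The mean value theorem twice: along [v] for the increment y |-> f (h w + y) - f y, then along
    [w] for the derivative 'D_v f. The bound on h keeps the whole parallelogram in the ball of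
    radius d, on which [f] is smooth. *)
Lemma second_difference {U f} x v w (d h : R) : smooth_on U f -> 0 < h ->
  (forall y, `|x - y| < d -> U y) -> h * (`|v| + `|w|) < d ->
  exists2 p, `|x - p| < d &
    f (h *: v + (h *: w + x)) - f (h *: v + x) - f (h *: w + x) + f x =
    h ^+ 2 * 'D_w ('D_v f) p.
Proof.
move=> sf h0 Ud hd.
have near_x (s t : R) : 0 <= s <= h -> 0 <= t <= h -> `|x - (s *: v + (t *: w + x))| < d.
  move=> /andP[s0 sh] /andP[t0 th].
  rewrite addrA opprD addrCA subrr addr0 normrN (le_lt_trans _ hd)//.
  rewrite (le_trans (ler_normD _ _))// !normrZ !ger0_norm// mulrDr.
  by rewrite lerD// ler_wpM2r.
have h00 : 0 <= (0 : R) <= h by rewrite lexx ltW.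
have hh : 0 <= h <= h by rewrite lexx ltW.
pose g y := f (h *: w + y) - f y.
have [s sh Es] : exists2 s, 0 <= s <= h & g (h *: v + x) - g x =
    h * ('D_v f (h *: w + (s *: v + x)) - 'D_v f (s *: v + x)).
  pose G (r : R) := g (r *: v + x).
  pose G' (r : R) := 'D_v f (h *: w + (r *: v + x)) - 'D_v f (r *: v + x).
  have dG s : 0 <= s <= h -> is_derive s 1 G (G' s).
    move=> sh; apply: is_derive_sub.
      have E r : h *: w + (r *: v + x) = r *: v + (h *: w + x).
        by rewrite addrCA.
      rewrite E; under [X in is_derive _ _ X]funext do rewrite E.
      by apply: (line_is_derive _ _ _ sf); apply: Ud; exact: near_x.
    apply: (line_is_derive _ _ _ sf); apply: Ud.
    by have := near_x s 0 sh h00; rewrite scale0r add0r.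
  have [||s sh] := @MVT R G G' 0 h h0.
  - by move=> s; rewrite in_itv/= => /andP[/ltW s0 /ltW sh]; apply: dG; rewrite s0.
  - apply: continuous_in_subspaceT => s /set_mem/=; rewrite in_itv/= => /dG[ds _].
    by apply: differentiable_continuous; exact/derivable1_diffP.
  rewrite /G scale0r add0r subr0 mulrC => ->; exists s => //.
  by move: sh; rewrite in_itv/= => /andP[/ltW -> /ltW].
have [|t th Et] := line_MVT w (s *: v + x) h (smooth_derive v sf) h0.
  by move=> t th; apply: Ud; rewrite addrCA; exact: near_x.
exists (t *: w + (s *: v + x)); first by rewrite addrCA; exact: near_x.
rewrite expr2 -mulrA -Et -Es /g (addrCA (h *: w)); ring.
Qed.

Lemma open_norm_ball U x : open U -> U x ->
  exists2 d : R, 0 < d & forall y, `|x - y| < d -> U y.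
Proof.
move=> oU Ux; have /nbhs_ballP[d /= d0 H] : nbhs x U by exact: open_nbhs_nbhs.
by exists d => // y xy; apply: H; rewrite -ball_normE.
Qed.

Lemma continuous_norm_ball f x (e : R) : {for x, continuous f} -> 0 < e ->
  exists2 d : R, 0 < d & forall y, `|x - y| < d -> `|f x - f y| < e.
Proof.
move=> cf e0; move: cf => /cvgrPdist_lt/(_ _ e0)/nbhs_ballP[d /= d0 H].
by exists d => // y xy; apply: H; rewrite -ball_normE.
Qed.

(** The second difference is symmetric in [v] and [w], so [A] and [B] take a common value at two
    points p and q as close to x as desired; continuity at x concludes. *)
Lemma eq_of_second_differences {U f A B} x v w : open U -> U x ->
  (forall d h, 0 < h -> (forall y, `|x - y| < d -> U y) ->
    h * (`|v| + `|w|) < d -> exists2 p, `|x - p| < d &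
    f (h *: v + (h *: w + x)) - f (h *: v + x) - f (h *: w + x) + f x =
    h ^+ 2 * A p) ->
  (forall d h, 0 < h -> (forall y, `|x - y| < d -> U y) ->
    h * (`|w| + `|v|) < d -> exists2 p, `|x - p| < d &
    f (h *: w + (h *: v + x)) - f (h *: w + x) - f (h *: v + x) + f x =
    h ^+ 2 * B p) ->
  {for x, continuous A} -> {for x, continuous B} -> A x = B x.
Proof.
move=> oU Ux SA SB cA cB.
apply/eqP; rewrite -subr_eq0 -normr_le0; apply/ler_addgt0Pl => e e0.
rewrite addr0.
have e2 : 0 < e / 2 by rewrite divr_gt0.
have [d1 d10 H1] := continuous_norm_ball _ _ _ cA e2.
have [d2 d20 H2] := continuous_norm_ball _ _ _ cB e2.
have [d3 d30 H3] := open_norm_ball _ _ oU Ux.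
pose d := Num.min d1 (Num.min d2 d3).
have d0 : 0 < d by rewrite /d !lt_min d10 d20.
have Ud y : `|x - y| < d -> U y by rewrite /d !lt_min => /and3P[_ _]; exact: H3.
(* The summand 1 makes h (|v| + |w|) < d strict and keeps the denominator positive when v = w =
   0. *)
pose h := d / (`|v| + `|w| + 1).
have vw : 0 < `|v| + `|w| + 1 by rewrite ltr_wpDl// addr_ge0.
have h0 : 0 < h by rewrite divr_gt0.
have hd : h * (`|v| + `|w|) < d.
  by rewrite /h mulrAC ltr_pdivrMr// ltr_pM2l// ltrDl.
have [p xp Ep] := SA d h h0 Ud hd.
have [|q xq Eq] := SB d h h0 Ud; first by rewrite [`|w| + _]addrC.
have pq : A p = B q.
  have h20 : h ^+ 2 != 0 by rewrite sqrf_eq0 gt_eqF.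
  apply: (mulfI h20); rewrite -Ep -Eq (addrCA (h *: v)).
  by congr (_ + _); rewrite -!addrA; congr (_ + _); exact: addrC.
have xp1 : `|A x - A p| < e / 2.
  by apply: H1; rewrite (lt_le_trans xp)// ge_min lexx.
have xq2 : `|B x - B q| < e / 2.
  by apply: H2; rewrite (lt_le_trans xq)// /d !ge_min lexx orbT.
rewrite -pq in xq2.
rewrite (_ : _ - _ = (A x - A p) - (B x - A p)); last by rewrite opprB addrA subrK.
by rewrite (le_trans (ler_normB _ _))// [leRHS](splitr e) lerD// ltW.
Qed.

Lemma clairaut {U f} x v w : open U -> smooth_on U f -> U x ->
  'D_w ('D_v f) x = 'D_v ('D_w f) x.
Proof.
move=> oU sf Ux; apply: (@eq_of_second_differences U f ('D_w ('D_v f)) ('D_v ('D_w f)) x v w oU Ux).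
- by move=> d h; exact: second_difference.
- by move=> d h; exact: second_difference.
- exact: (smooth_continuous (smooth_derive w (smooth_derive v sf))).
- exact: (smooth_continuous (smooth_derive v (smooth_derive w sf))).
Qed.

End SmoothCalculus.

(** * Space and time slices of space-time functions *)

Section SpaceTimeSlices.
Context {R : realType}.
Implicit Types (f : R3 R * R -> R) (v x : R3 R) (t T : R).

Definition tdir : R3 R * R := (0, 1).

Lemma space_slice t v x (h : R) : (fun y : R3 R => (y, t)) (h *: v + x) = h *: (v, 0) + (x, t).
Proof. by congr pair; rewrite /= scaler0 add0r. Qed.

Lemma time_slice x (s h : R) : (fun r : R => (x, r)) (h *: 1 + s) = h *: tdir + (x, s).
Proof. by congr pair; rewrite /= scaler0 add0r. Qed.

Lemma derive_space_slice f t v x :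
  'D_v (fun y => f (y, t)) x = 'D_(v, 0) f (x, t).
Proof. exact: (derive_slice _ _ _ _ _ (space_slice t v x)). Qed.

Lemma derive1_time_slice f x s :
  derive1 (fun r => f (x, r)) s = 'D_tdir f (x, s).
Proof. by rewrite derive1E; exact: (derive_slice _ _ _ _ _ (time_slice x s)). Qed.

Lemma derivable_time_slice f x s : derivable f (x, s) tdir ->
  derivable (fun r => f (x, r)) s 1.
Proof. by move=> H; apply/(derivable_slice _ _ _ _ _ (time_slice x s)). Qed.

Lemma iter_derive_space_slice f t vs x :
  iter_derive vs (fun y => f (y, t)) x = iter_derive (map (fun v => (v, 0)) vs) f (x, t).
Proof.
elim: vs x => //= v vs IH x.
rewrite -derive_space_slice; congr ('D_v _ x); apply/funext => y; exact: IH.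
Qed.

Lemma smooth_space_slice T f t : smooth_on (slab T) f -> 0 < t < T ->
  smooth_on setT (fun y => f (y, t)).
Proof.
move=> sf tT vs x _.
have E : iter_derive vs (fun y => f (y, t)) =
    iter_derive (map (fun v => (v, 0)) vs) f \o (fun y => (y, t)).
  by apply/funext => y; exact: iter_derive_space_slice.
have [c d] := sf (map (fun v => (v, 0)) vs) (x, t) tT.
rewrite E; split.
  apply: continuous_comp => //.
  by apply: continuous_pair; [exact: cvg_id|exact: cvg_cst].
by move=> v; apply/(derivable_slice _ _ _ _ _ (space_slice t v x)).
Qed.

End SpaceTimeSlices.

(** * The curl of the momentum equation *)

Section Vorticity.
Context {R : realType}.
Implicit Types (f : R3 R -> R) (x : R3 R) (i j k l : 'I_3).

Lemma sum3 (F : 'I_3 -> R) : \sum_(i < 3) F i = F 0 + F 1 + F 2.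
Proof.
rewrite !big_ord_recl big_ord0 addr0 addrA.
by congr (F _ + F _ + F _); exact: val_inj.
Qed.

Lemma ord3D : ((0 + 1 = 1 :> 'I_3) * (0 + 2 = 2 :> 'I_3) * (1 + 1 = 2 :> 'I_3)) *
  ((1 + 2 = 0 :> 'I_3) * (2 + 1 = 0 :> 'I_3) * (2 + 2 = 1 :> 'I_3)).
Proof. by do !split; exact: val_inj. Qed.

Lemma crd_vec (F : 'I_3 -> R) i : crd (vec F) i = F i.
Proof. by case: (ord3P i) => ->. Qed.

Lemma smooth_partial {U f} i : smooth_on U f -> smooth_on U (partial i f).
Proof. exact: smooth_derive. Qed.

Lemma partial_is_derive {f} i x : smooth_on setT f ->
  is_derive x (unit_vec i) f (partial i f x).
Proof. by move=> sf; exact: (smooth_is_derive sf). Qed.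

Lemma partialC {f} i j : smooth_on setT f ->
  partial i (partial j f) = partial j (partial i f).
Proof. by move=> sf; apply/funext => x; exact: (@clairaut _ _ setT f x _ _ openT sf). Qed.

(** The curl of the momentum equation at one point: [v] is the velocity, g j k stands for d_j u_k, h
    l j k for d_l d_j u_k, h3 l j k for d_l d_l d_j u_k, and [p] for the mixed second derivative of
    the pressure, which cancels. The products of first derivatives combine to (omega . nabla) u -
    omega div u, and the last term is removed by the divergence condition. *)
Lemma curl_algebra (v : 'I_3 -> R) (g : 'I_3 -> 'I_3 -> R)
    (h h3 : 'I_3 -> 'I_3 -> 'I_3 -> R) (p : R) i :
  \sum_(l < 3) g l l = 0 ->
  (- p + \sum_(l < 3) h3 l (i + 1) (i + 2)
   - \sum_(l < 3) (g (i + 1) l * g l (i + 2) + v l * h l (i + 1) (i + 2)))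
  - (- p + \sum_(l < 3) h3 l (i + 2) (i + 1)
   - \sum_(l < 3) (g (i + 2) l * g l (i + 1) + v l * h l (i + 2) (i + 1))) =
  \sum_(l < 3) (g (l + 1) (l + 2) - g (l + 2) (l + 1)) * g l i
  - \sum_(l < 3) v l * (h l (i + 1) (i + 2) - h l (i + 2) (i + 1))
  + \sum_(l < 3) (h3 l (i + 1) (i + 2) - h3 l (i + 2) (i + 1)).
Proof.
rewrite !sum3 => /eqP; rewrite -addrA addr_eq0 opprD => /eqP D.
by case: (ord3P i) => ->; rewrite !ord3D D; ring.
Qed.

Section Curl.
(** A frozen time: [U] and [Q] are the velocity and the pressure, [A] is the time derivative of the
    velocity, which is differentiated in space through its expression in the momentum equation. *)
Variables (U A : 'I_3 -> R3 R -> R) (Q : R3 R -> R).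
Hypothesis sU : forall i, smooth_on setT (U i).
Hypothesis sQ : smooth_on setT Q.
Hypothesis divU : forall x, \sum_(i < 3) partial i (U i) x = 0.
Hypothesis momentum : forall i x,
  A i x + \sum_(l < 3) U l x * partial l (U i) x =
  - partial i Q x + \sum_(l < 3) partial l (partial l (U i)) x.

Definition curl_component i x :=
  partial (i + 1) (U (i + 2)) x - partial (i + 2) (U (i + 1)) x.

Lemma partial_curl_component l i x : partial l (curl_component i) x =
  partial l (partial (i + 1) (U (i + 2))) x - partial l (partial (i + 2) (U (i + 1))) x.
Proof.
exact: (is_derive_val (is_derive_sub _ _ _ _ _ _
  (partial_is_derive l x (smooth_partial (i + 1) (sU (i + 2))))
  (partial_is_derive l x (smooth_partial (i + 2) (sU (i + 1)))))).
Qed.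

Lemma partial2_curl_component l i x : partial l (partial l (curl_component i)) x =
  partial l (partial l (partial (i + 1) (U (i + 2)))) x
  - partial l (partial l (partial (i + 2) (U (i + 1)))) x.
Proof.
have -> : partial l (curl_component i) = fun y =>
    partial l (partial (i + 1) (U (i + 2))) y - partial l (partial (i + 2) (U (i + 1))) y.
  by apply/funext => y; rewrite partial_curl_component.
exact: (is_derive_val (is_derive_sub _ _ _ _ _ _
  (partial_is_derive l x (smooth_partial l (smooth_partial (i + 1) (sU (i + 2)))))
  (partial_is_derive l x (smooth_partial l (smooth_partial (i + 2) (sU (i + 1))))))).
Qed.

Let partial_A j k x : partial j (A k) x = - partial j (partial k Q) x
  + \sum_(l < 3) partial l (partial l (partial j (U k))) x
  - \sum_(l < 3) (partial j (U l) x * partial l (U k) x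
                  + U l x * partial l (partial j (U k)) x).
Proof.
rewrite (_ : A k = fun x => - partial k Q x
    + \sum_(l < 3) partial l (partial l (U k)) x
    - \sum_(l < 3) U l x * partial l (U k) x); last first.
  by apply/funext => y; rewrite -momentum addrK.
rewrite [LHS]/partial; apply: is_derive_val; apply: is_derive_sub; first apply: is_derive_add.
- by apply: is_derive_neg; exact: partial_is_derive (smooth_partial _ sQ).
- apply: is_derive_bigsum => l; rewrite (partialC l j (sU k)).
  rewrite (partialC l j (smooth_partial l (sU k))).
  exact: (partial_is_derive j x (smooth_partial l (smooth_partial l (sU k)))).
- apply: is_derive_bigsum => l; rewrite (partialC l j (sU k)).
  exact: (is_derive_mul _ _ _ _ _ _ (partial_is_derive j x (sU l))
    (partial_is_derive j x (smooth_partial l (sU k)))).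
Qed.

Lemma curl_momentum i x :
  partial (i + 1) (A (i + 2)) x - partial (i + 2) (A (i + 1)) x =
  \sum_(l < 3) curl_component l x * partial l (U i) x
  - \sum_(l < 3) U l x * partial l (curl_component i) x
  + \sum_(l < 3) partial l (partial l (curl_component i)) x.
Proof.
rewrite !partial_A (partialC (i + 1) (i + 2) sQ).
under [X in _ = _ - X + _]eq_bigr do rewrite partial_curl_component.
under [X in _ = _ - _ + X]eq_bigr do rewrite partial2_curl_component.
exact: (@curl_algebra (U ^~ x) (fun l k => partial l (U k) x)
  (fun l j k => partial l (partial j (U k)) x)
  (fun l j k => partial l (partial l (partial j (U k))) x) _ i (divU x)).
Qed.

End Curl.
End Vorticity.

Section VorticityEquation.
Context {R : realType}.
Variables (T : R) (u : R -> R3 R -> R3 R).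
Hypothesis reg : regular_on T u.

Definition velocity_at (t : R) (i : 'I_3) : R3 R -> R := component (u t) i.
Definition vorticity_st (i : 'I_3) : R3 R * R -> R :=
  uncurry4 (fun t => component (vorticity u t) i).
Local Notation vel i := (uncurry4 (fun t => component (u t) i)).

Lemma smooth_velocity_at t i : 0 < t < T -> smooth_on setT (velocity_at t i).
Proof.
by move=> tT; exact: (smooth_space_slice T (vel i) t (reg.1 i) tT).
Qed.

Lemma vorticity_stE i : vorticity_st i = fun z =>
  'D_(unit_vec (i + 1), 0) (vel (i + 2)) z - 'D_(unit_vec (i + 2), 0) (vel (i + 1)) z.
Proof.
apply/funext => -[x t]; rewrite /vorticity_st /uncurry4 /component /vorticity /curl /=.
by rewrite crd_vec /partial -!derive_space_slice.
Qed.

Lemma smooth_vorticity_st i : smooth_on (slab T) (vorticity_st i).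
Proof.
rewrite vorticity_stE; apply: smooth_sub; first exact: slab_open.
- exact: smooth_derive (reg.1 _).
- exact: smooth_derive (reg.1 _).
Qed.

Lemma component_vorticity t i :
  component (vorticity u t) i = curl_component (velocity_at t) i.
Proof.
by apply/funext => x; rewrite /component /vorticity /curl crd_vec.
Qed.

(** The time derivative commutes with the curl by the symmetry of mixed derivatives in space-time;
    this is why the vorticity is also handled as a function on the slab. *)
Lemma vorticity_equation t x i : 0 < t < T ->
  'D_tdir (vorticity_st i) (x, t) =
  \sum_(l < 3) component (vorticity u t) l x * partial l (component (u t) i) x
  - \sum_(l < 3) component (u t) l x * partial l (component (vorticity u t) i) x
  + \sum_(l < 3) partial l (partial l (component (vorticity u t) i)) x.
Proof.
move=> tT; have [sF [q [sq NS]]] := reg.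
pose A i (y : R3 R) : R := 'D_tdir (vel i) (y, t).
have H := @curl_momentum R (velocity_at t) A (q t)
  (fun i => smooth_velocity_at t i tT)
  (smooth_space_slice T (uncurry4 q) t sq tT).
under eq_bigr do rewrite component_vorticity.
rewrite (_ : component (vorticity u t) i = curl_component (velocity_at t) i); last first.
  exact: component_vorticity.
rewrite -H.
- rewrite vorticity_stE.
  have oS := @slab_open R T; have st : slab T (x, t) by [].
  have d j k : is_derive (x, t) tdir ('D_(unit_vec j, 0) (vel k))
      ('D_tdir ('D_(unit_vec j, 0) (vel k)) (x, t)).
    exact: (smooth_is_derive (smooth_derive _ (sF k)) _ _ st).
  rewrite (is_derive_val (is_derive_sub _ _ _ _ _ _ (d (i + 1) (i + 2)) (d (i + 2) (i + 1)))).
  rewrite (clairaut _ _ tdir oS (sF (i + 2)) st)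
    (clairaut _ _ tdir oS (sF (i + 1)) st).
  have e j k : partial j (A k) x = 'D_(unit_vec j, 0) ('D_tdir (vel k)) (x, t).
    exact: (derive_space_slice ('D_tdir (vel k)) t (unit_vec j) x).
  by rewrite !e.
- by move=> y; exact: (NS t y tT).1.
- move=> j y; have := (NS t y tT).2 j.
  have -> : dt (fun s => component (u s) j) t y = A j y.
    exact: (derive1_time_slice (vel j) y t).
  by rewrite /advect crd_vec.
Qed.

End VorticityEquation.

(** * The nonlinear term at a fixed time *)

Section EighthRoot.
Context {R : realType}.
Implicit Types a b y : R.

(* Every power of a cut-off in the estimates is an integral power of its eighth
   root. *)
Definition rt8 y : R := Num.sqrt (Num.sqrt (Num.sqrt y)).

Lemma rt8_ge0 y : 0 <= rt8 y. Proof. exact: sqrtr_ge0. Qed.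

Lemma rt8X8 y : 0 <= y -> rt8 y ^+ 8 = y.
Proof.
move=> y0; rewrite (_ : 8 = 2 * 2 * 2)%N// !exprM /rt8.
by rewrite !sqr_sqrtr// ?sqrtr_ge0.
Qed.

Lemma rt8X4 y : rt8 y ^+ 4 = Num.sqrt y.
Proof.
by rewrite (_ : 4 = 2 * 2)%N// !exprM /rt8 !sqr_sqrtr// ?sqrtr_ge0.
Qed.

Lemma rt8M a b : 0 <= a -> rt8 (a * b) = rt8 a * rt8 b.
Proof. by move=> a0; rewrite /rt8 sqrtrM// sqrtrM ?sqrtr_ge0// sqrtrM ?sqrtr_ge0. Qed.

Lemma rt8_0 : rt8 0 = 0.
Proof. by rewrite /rt8 !sqrtr0. Qed.

Lemma rt8_le1 y : y <= 1 -> rt8 y <= 1.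
Proof.
move=> y1; rewrite /rt8 -[X in _ <= X](@sqrtr1 R) ler_wsqrtr//.
by rewrite -[X in _ <= X](@sqrtr1 R) ler_wsqrtr// -[X in _ <= X](@sqrtr1 R) ler_wsqrtr.
Qed.

Lemma le_rt8X n y : (n <= 8)%N -> 0 <= y <= 1 -> y <= rt8 y ^+ n.
Proof.
move=> n8 /andP[y0 y1]; rewrite -[X in X <= _]rt8X8//.
by rewrite ler_wiXn2l// ?rt8_ge0// rt8_le1.
Qed.

Lemma powR_rt8 n y : 0 <= y -> y `^ (n%:R / 8) = rt8 y ^+ n.
Proof.
move=> y0; have -> : rt8 y = y `^ (1 / 8).
  rewrite /rt8 -!powR12_sqrt ?powR_ge0// -!powRrM; congr powR; lra.
by rewrite -powR_mulrn ?powR_ge0// -powRrM; congr powR; lra.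
Qed.

End EighthRoot.

Section PointwiseContinuity.
Context {R : realType} {T : topologicalType}.
Implicit Types (f g : T -> R) (x : T).

Lemma cont_add {f g x} : {for x, continuous f} -> {for x, continuous g} ->
  {for x, continuous (fun y => f y + g y)}.
Proof. exact: cvgD. Qed.

Lemma cont_sub {f g x} : {for x, continuous f} -> {for x, continuous g} ->
  {for x, continuous (fun y => f y - g y)}.
Proof. exact: cvgB. Qed.

Lemma cont_mul {f g x} : {for x, continuous f} -> {for x, continuous g} ->
  {for x, continuous (fun y => f y * g y)}.
Proof. exact: cvgM. Qed.

Lemma cont_cst (c : R) x : {for x, continuous (fun=> c : R)}.
Proof. exact: cvg_cst. Qed.

Lemma cont_exp {f x} n : {for x, continuous f} ->
  {for x, continuous (fun y => f y ^+ n)}.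
Proof.
move=> cf; elim: n => [|n IH]; first exact: cont_cst.
have -> : (fun y => f y ^+ n.+1) = (fun y => f y * f y ^+ n).
  by apply/funext => y; rewrite exprS.
exact: cont_mul.
Qed.

Lemma cont_comp {f} {h : R -> R} {x} : {for x, continuous f} -> continuous h ->
  {for x, continuous (fun y => h (f y))}.
Proof. by move=> cf ch; apply: continuous_comp; [|exact: ch]. Qed.

Lemma cont_sum n (F : 'I_n -> T -> R) x : (forall i, {for x, continuous (F i)}) ->
  {for x, continuous (fun y => \sum_(i < n) F i y)}.
Proof.
move=> cF; have : forall s : seq 'I_n, {for x, continuous (fun y => \sum_(i <- s) F i y)}.
  elim=> [|i s IH].
    have -> : (fun y => \sum_(i <- [::]) F i y) = fun=> 0.
      by apply/funext => y; rewrite big_nil.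
    exact: cont_cst.
  have -> : (fun y => \sum_(j <- i :: s) F j y) = fun y => F i y + \sum_(j <- s) F j y.
    by apply/funext => y; rewrite big_cons.
  exact: cont_add.
exact.
Qed.

End PointwiseContinuity.

Lemma rt8_continuous {R : realType} : continuous (rt8 : R -> R).
Proof.
by move=> y; have c := @sqrt_continuous R; exact: (cont_comp (cont_comp (c y) c) c).
Qed.

Section ContinuouslyDifferentiable.
Context {R : realType}.
Implicit Types (f g : R3 R -> R).

(** Integration by parts takes a single derivative of a product. This class is stable under products
    by one use of the Leibniz rule, which [smooth_on] would require to be iterated. *)
Definition C1 f := [/\ continuous f, forall k x, derivable f x (unit_vec k) &
  forall k, continuous (partial k f)].

Lemma C1_is_derive {f} k x : C1 f -> is_derive x (unit_vec k) f (partial k f x).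
Proof. by case=> _ df _; exact/derivableP/df. Qed.

Lemma C1_smooth {f} : smooth_on setT f -> C1 f.
Proof.
move=> sf; split.
- by move=> x; exact: (smooth_continuous sf).
- by move=> k x; exact: (smooth_derivable sf).
- by move=> k x; exact: (smooth_continuous (smooth_partial k sf)).
Qed.

Lemma C1_of_partials f (df : 'I_3 -> R3 R -> R) : continuous f ->
  (forall k x, is_derive x (unit_vec k) f (df k x)) ->
  (forall k, continuous (df k)) -> C1 f.
Proof.
move=> cf Df cdf; split; first by []; first by move=> k x; have [] := Df k x.
move=> k.
by rewrite (_ : partial k f = df k)//; apply/funext => x; have [] := Df k x.
Qed.

Lemma C1_add {f g} : C1 f -> C1 g -> C1 (fun x => f x + g x).
Proof.
move=> Cf Cg; have [cf _ cdf] := Cf; have [cg _ cdg] := Cg.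
apply: (C1_of_partials _ (fun k x => partial k f x + partial k g x)).
- by move=> x; exact: (cont_add (cf x) (cg x)).
- by move=> k x; exact: (is_derive_add _ _ _ _ _ _ (C1_is_derive k x Cf) (C1_is_derive k x Cg)).
- by move=> k x; exact: (cont_add (cdf k x) (cdg k x)).
Qed.

Lemma C1_mul {f g} : C1 f -> C1 g -> C1 (fun x => f x * g x).
Proof.
move=> Cf Cg; have [cf _ cdf] := Cf; have [cg _ cdg] := Cg.
apply: (C1_of_partials _ (fun k x => partial k f x * g x + f x * partial k g x)).
- by move=> x; exact: (cont_mul (cf x) (cg x)).
- by move=> k x; exact: (is_derive_mul _ _ _ _ _ _ (C1_is_derive k x Cf) (C1_is_derive k x Cg)).
- move=> k x.
  exact: (cont_add (cont_mul (cdf k x) (cg x)) (cont_mul (cf x) (cdg k x))).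
Qed.

Lemma C1_cst (c : R) : C1 (fun=> c).
Proof.
apply: (C1_of_partials _ (fun k x => 0)).
- by move=> x; exact: cont_cst.
- by move=> k x; exact: cont_cst.
Qed.

Lemma C1_sub {f g} : C1 f -> C1 g -> C1 (fun x => f x - g x).
Proof.
move=> Cf Cg; have := C1_add Cf (C1_mul (C1_cst (-1)) Cg).
by under [X in C1 X]funext do rewrite mulN1r.
Qed.

Lemma C1_sqr {f} : C1 f -> C1 (fun x => f x ^+ 2).
Proof. by move=> Cf; exact: C1_mul. Qed.

Lemma C1_sum n (F : 'I_n -> R3 R -> R) : (forall i, C1 (F i)) ->
  C1 (fun x => \sum_(i < n) F i x).
Proof.
move=> CF; have : forall s : seq 'I_n, C1 (fun x => \sum_(i <- s) F i x).
  elim=> [|i s IH].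
    by under [X in C1 X]funext do rewrite big_nil; exact: C1_cst.
  by under [X in C1 X]funext do rewrite big_cons; exact: C1_add.
exact.
Qed.

Lemma sum3_cauchy_schwarz (a b : 'I_3 -> R) :
  (\sum_(i < 3) a i * b i) ^+ 2 <= (\sum_(i < 3) a i ^+ 2) * (\sum_(i < 3) b i ^+ 2).
Proof.
rewrite !sum3 -subr_ge0.
rewrite (_ : _ - _ = (a 0 * b 1 - a 1 * b 0) ^+ 2 + (a 0 * b 2 - a 2 * b 0) ^+ 2
  + (a 1 * b 2 - a 2 * b 1) ^+ 2); last by ring.
by rewrite !addr_ge0// sqr_ge0.
Qed.

End ContinuouslyDifferentiable.

(** Squaring twice gives X^4 <= (a b c)^2 <= (X Z)^3, and X^3 is divided out. This is the absorption
    in the Sobolev inequality; it is legitimate because [X] is a real number, being the integral of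
    a bounded function with bounded support. *)
Lemma le_cube_of_sqrt_product {R : rcfType} {X Z a b c : R} : 0 <= X -> 0 <= Z ->
  0 <= a -> 0 <= b -> 0 <= c ->
  a ^+ 2 <= X * Z -> b ^+ 2 <= X * Z -> c ^+ 2 <= X * Z ->
  X <= Num.sqrt (a * (b * c)) -> X <= Z ^+ 3.
Proof.
move=> X0 Z0 a0 b0 c0 Ha Hb Hc XD.
have X2 : X ^+ 2 <= a * (b * c).
  rewrite -[leRHS]sqr_sqrtr; last by rewrite !mulr_ge0.
  by rewrite ler_sqr ?nnegrE ?sqrtr_ge0.
have [->|Xn0] := eqVneq X 0; first by rewrite exprn_ge0.
have Xp : 0 < X by rewrite lt0r Xn0.
have XX : X ^+ 3 * X <= X ^+ 3 * Z ^+ 3.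
  have -> : X ^+ 3 * X = (X ^+ 2) ^+ 2 by ring.
  have -> : X ^+ 3 * Z ^+ 3 = (X * Z) * ((X * Z) * (X * Z)) by ring.
  apply: (@le_trans _ _ ((a * (b * c)) ^+ 2)).
    by rewrite ler_sqr ?nnegrE ?exprn_ge0// !mulr_ge0.
  rewrite !exprMn; apply: ler_pM; rewrite ?sqr_ge0//.
    by rewrite mulr_ge0// sqr_ge0.
  by apply: ler_pM; rewrite ?sqr_ge0.
by rewrite ler_pM2l ?exprn_gt0// in XX.
Qed.

(** The chain gives J^4 <= M^2 a Z^3. The weights cancel in a Z^3 = (lam^-3 a) (lam Z)^3, a product
    of four factors each at most their sum [S], so Young's inequality holds with constant 1. *)
Lemma le_young4 {R : rcfType} {J I M a X Z lam : R} :
  0 <= J -> 0 <= I -> 0 <= M -> 0 <= a -> 0 <= Z -> 0 < lam ->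
  J ^+ 2 <= M * I -> I ^+ 2 <= a * X -> X <= Z ^+ 3 ->
  J <= Num.sqrt M * (lam^-1 ^+ 3 * a + lam * Z).
Proof.
move=> J0 I0 M00 a0 Z0 l0 J2 I2 XZ.
set S := lam^-1 ^+ 3 * a + lam * Z.
have s1 : 0 <= lam^-1 ^+ 3 * a by rewrite mulr_ge0// exprn_ge0// invr_ge0 ltW.
have s2 : 0 <= lam * Z by rewrite mulr_ge0// ltW.
have S0 : 0 <= S by exact: addr_ge0.
have aZ : a * Z ^+ 3 <= S ^+ 4.
  have -> : a * Z ^+ 3 = (lam^-1 ^+ 3 * a) * (lam * Z) ^+ 3.
    by rewrite exprVn; field; rewrite gt_eqF.
  rewrite [leRHS]exprS; apply: ler_pM => //; first exact: exprn_ge0.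
    by rewrite lerDl.
  by rewrite lerXn2r ?nnegrE// lerDr.
have J4 : J ^+ 4 <= (Num.sqrt M * S) ^+ 4.
  have -> : J ^+ 4 = (J ^+ 2) ^+ 2 by ring.
  have -> : (Num.sqrt M * S) ^+ 4 = (Num.sqrt M ^+ 2) ^+ 2 * S ^+ 4 by ring.
  rewrite sqr_sqrtr//; apply: (@le_trans _ _ ((M * I) ^+ 2)).
    by rewrite ler_sqr ?nnegrE ?exprn_ge0// mulr_ge0.
  rewrite exprMn ler_wpM2l ?sqr_ge0//.
  apply: (le_trans I2); apply: le_trans aZ.
  by rewrite ler_wpM2l.
by rewrite (ler_pXn2r (n := 4)) ?nnegrE ?mulr_ge0 ?sqrtr_ge0 in J4.
Qed.

Section NonlinearTerm.
Context {R : realType}.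
Local Notation mu := (@lebesgue_measure R).
Implicit Types (x : R3 R).

Definition vnorm (W : 'I_3 -> R3 R -> R) x : R := Num.sqrt (\sum_(j < 3) W j x ^+ 2).

Definition gnorm2 (W : 'I_3 -> R3 R -> R) x : R :=
  \sum_(i < 3) \sum_(j < 3) partial i (W j) x ^+ 2.

Lemma vnorm_ge0 W x : 0 <= vnorm W x. Proof. exact: sqrtr_ge0. Qed.

Lemma vnormX2 W x : vnorm W x ^+ 2 = \sum_(j < 3) W j x ^+ 2.
Proof. by rewrite sqr_sqrtr// sumr_ge0// => j _; exact: sqr_ge0. Qed.

Lemma gnorm2_ge0 W x : 0 <= gnorm2 W x.
Proof. by apply: sumr_ge0 => i _; apply: sumr_ge0 => j _; exact: sqr_ge0. Qed.

Lemma vnorm_continuous W : (forall j, continuous (W j)) -> continuous (vnorm W).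
Proof.
move=> cW x; apply: (cont_comp _ (@sqrt_continuous R)).
by apply: cont_sum => j; apply: cont_exp; exact: cW.
Qed.

Lemma gnorm2_continuous W : (forall j, C1 (W j)) -> continuous (gnorm2 W).
Proof.
move=> CW x; apply: cont_sum => i; apply: cont_sum => j; apply: cont_exp.
by have [_ _] := CW j; exact.
Qed.

Lemma dot_partial_le W i x : `|\sum_(j < 3) W j x * partial i (W j) x| <=
  vnorm W x * Num.sqrt (gnorm2 W x).
Proof.
rewrite -sqrtr_sqr /vnorm -sqrtrM; last first.
  by rewrite sumr_ge0// => j _; exact: sqr_ge0.
rewrite ler_wsqrtr//; apply: (le_trans (sum3_cauchy_schwarz _ _)).
rewrite ler_wpM2l//; first by rewrite sumr_ge0// => j _; exact: sqr_ge0.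
rewrite /gnorm2 [leRHS](bigD1 i)//= lerDl.
by apply: sumr_ge0 => k _; apply: sumr_ge0 => j _; exact: sqr_ge0.
Qed.

Variables (W : 'I_3 -> R3 R -> R) (psi : R3 R -> R) (e L K : R).
Hypothesis CW : forall j, C1 (W j).
Hypothesis Cpsi : C1 psi.
Hypothesis psi01 : forall x, 0 <= psi x <= 1.
Hypothesis psiL : forall x, L < `|x| -> psi x = 0.
Hypothesis e01 : 0 <= e <= 1.
Hypothesis K0 : 0 <= K.
Hypothesis dpsi : forall k x, `|partial k psi x| <= K * rt8 (psi x) ^+ 7.

Local Notation m := (vnorm W).
Local Notation G x := (Num.sqrt (gnorm2 W x)).
Let p x : R := rt8 (psi x * e).
Let a : R := \int[leb3]_x (m x ^+ 2 * p x ^+ 4).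
Let d : R := \int[leb3]_x (gnorm2 W x * p x ^+ 8).

Let e0 : 0 <= e. Proof. by case/andP: e01. Qed.
Let psi0 x : 0 <= psi x. Proof. by case/andP: (psi01 x). Qed.
Let pe0 x : 0 <= psi x * e. Proof. exact: mulr_ge0. Qed.
Let p0 x : 0 <= p x. Proof. exact: rt8_ge0. Qed.
Let p1 x : p x <= 1.
Proof.
rewrite rt8_le1// mulr_ile1//; first by case/andP: (psi01 x).
by case/andP: e01.
Qed.
Let pE x : p x = rt8 (psi x) * rt8 e. Proof. exact: rt8M. Qed.
Let p8 x : p x ^+ 8 = psi x * e. Proof. exact: rt8X8. Qed.

Let pL x : L < `|x| -> p x = 0.
Proof. by move=> xL; rewrite /p psiL// mul0r rt8_0. Qed.

Let cm : continuous m.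
Proof. by apply: vnorm_continuous => j; case: (CW j). Qed.

Let cp : continuous p.
Proof.
have [c _ _] := Cpsi.
by move=> x; exact: (cont_comp (cont_mul (c x) (cont_cst e x)) rt8_continuous).
Qed.

Let cG : continuous (fun x => G x).
Proof.
by move=> x; exact: (cont_comp (gnorm2_continuous W CW x) (@sqrt_continuous R)).
Qed.

Let g x : R := (\sum_(j < 3) W j x ^+ 2) ^+ 2 * (psi x ^+ 2 * e ^+ 2).

Let gE x : g x = m x ^+ 4 * p x ^+ 16.
Proof.
rewrite /g -vnormX2 -exprMn -p8 (_ : 4 = 2 * 2)%N// (_ : 16 = 8 * 2)%N//.
by rewrite !exprM.
Qed.

Let Cg : C1 g.
Proof.
apply: C1_mul; first by apply: C1_sqr; apply: C1_sum => j; exact: C1_sqr.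
by apply: C1_mul; [exact: C1_sqr|exact: C1_cst].
Qed.

Let gL x : L < `|x| -> g x = 0.
Proof. by move=> xL; rewrite gE pL// expr0n mulr0. Qed.

Let dg k x : partial k g x = 4 * m x ^+ 2 * (\sum_(j < 3) W j x * partial k (W j) x) *
    p x ^+ 16 + 2 * m x ^+ 4 * p x ^+ 8 * (e * partial k psi x).
Proof.
have dW j : is_derive x (unit_vec k) (W j) (partial k (W j) x) by exact: C1_is_derive.
have dp : is_derive x (unit_vec k) psi (partial k psi x) by exact: C1_is_derive.
have D := is_derive_mul _ _ _ _ _ _
  (is_derive_square _ _ _ _ (is_derive_bigsum _ _ _ _ _ (fun j => is_derive_square _ _ _ _ (dW j))))
  (is_derive_mul _ _ _ _ _ _ (is_derive_square _ _ _ _ dp) (is_derive_const (e ^+ 2) x (unit_vec k))).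
rewrite (is_derive_val D : partial k g x = _).
have -> : \sum_(i < 3) 2 * W i x * partial k (W i) x =
    2 * \sum_(j < 3) W j x * partial k (W j) x.
  by rewrite mulr_sumr; apply: eq_bigr => j _; rewrite mulrA.
rewrite -vnormX2 (_ : 16 = 8 * 2)%N// exprM p8; ring.
Qed.

(** With f = m p^4 and g = f^4 one has formally |d_k g| = 4 f^3 |d_k f|; [Y] bounds 4 |d_k f| and
    keeps a meaning where f is not differentiable. *)
Let Y x : R := 4 * (G x * p x ^+ 4) + 2 * K * (m x * p x ^+ 2).

Let Y0 x : 0 <= Y x.
Proof.
by rewrite /Y addr_ge0// !mulr_ge0// ?exprn_ge0// ?sqrtr_ge0// vnorm_ge0.
Qed.

Let dg_le k x : `|partial k g x| <= m x ^+ 3 * p x ^+ 12 * Y x.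
Proof.
have m0 := vnorm_ge0 W x; have q0 := p0 x.
(* The power 7 is lowered to 6: then m^4 p^8 p^6 = (m^3 p^12) (m p^2), and the square of m p^2 is
   the integrand of [a]. *)
have dp : `|e * partial k psi x| <= K * p x ^+ 6.
  rewrite normrM ger0_norm//; apply: (le_trans (ler_wpM2l e0 (dpsi k x))).
  rewrite mulrCA ler_wpM2l// (@le_trans _ _ (p x ^+ 7))//; last first.
    by rewrite [leLHS]exprS ler_piMl ?exprn_ge0.
  by rewrite pE exprMn mulrC ler_wpM2l ?exprn_ge0 ?rt8_ge0// le_rt8X.
rewrite dg (le_trans (ler_normD _ _))//.
have -> : m x ^+ 3 * p x ^+ 12 * Y x = 4 * m x ^+ 2 * (m x * G x) * p x ^+ 16 +
    2 * m x ^+ 4 * p x ^+ 8 * (K * p x ^+ 6) by rewrite /Y; ring.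
apply: lerD.
- rewrite normrM (ger0_norm (exprn_ge0 _ q0)) ler_wpM2r ?exprn_ge0// normrM.
  rewrite (ger0_norm (_ : 0 <= 4 * m x ^+ 2)) ?mulr_ge0 ?exprn_ge0//.
  by rewrite ler_wpM2l ?mulr_ge0 ?exprn_ge0// dot_partial_le.
- rewrite normrM (ger0_norm (_ : 0 <= 2 * m x ^+ 4 * p x ^+ 8));
    last by rewrite !mulr_ge0 ?exprn_ge0.
  by rewrite ler_wpM2l ?mulr_ge0 ?exprn_ge0.
Qed.

Let bsp (f : R3 R -> R) n : continuous f -> bounded_support (box3 L) (fun x => f x * p x ^+ n.+1).
Proof.
move=> cf; apply: continuous_bs3.
- by move=> x; exact: (cont_mul (cf x) (cont_exp n.+1 (cp x))).
- by move=> x xL; rewrite pL// expr0n mulr0.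
Qed.

Let bm k n : bounded_support (box3 L) (fun x => m x ^+ k * p x ^+ n.+1).
Proof. by apply: (bsp (fun x => m x ^+ k)) => x; exact: (cont_exp k (cm x)). Qed.

Let bmp2 : bounded_support (box3 L) (fun x => m x * p x ^+ 2).
Proof. exact: (bsp m 1 cm). Qed.

Let bGp : bounded_support (box3 L) (fun x => G x * p x ^+ 4).
Proof. exact: (bsp (fun x => G x) 3 cG). Qed.

Let bY : bounded_support (box3 L) Y.
Proof. by apply: bsD; apply: bsZ; [exact: bGp|exact: bmp2]. Qed.

Let X : R := \int[leb3]_x (m x ^+ 6 * p x ^+ 24).
(** From (b + c)^2 <= 2 b^2 + 2 c^2, where b = 4 G p^4 and c = 2 K m p^2 are the two terms of
    [Y]. *)
Let Z : R := 32 * d + 8 * K ^+ 2 * a.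

Let fL := finite_measurable_box3 L.

Let X0 : 0 <= X.
Proof. by apply: int_ge0 => x; rewrite mulr_ge0// exprn_ge0// vnorm_ge0. Qed.

Let a0 : 0 <= a.
Proof. by apply: int_ge0 => x; rewrite mulr_ge0// exprn_ge0// vnorm_ge0. Qed.

Let d0 : 0 <= d.
Proof. by apply: int_ge0 => x; rewrite mulr_ge0 ?gnorm2_ge0// exprn_ge0. Qed.

Let Z0 : 0 <= Z.
Proof. by rewrite addr_ge0// !mulr_ge0// exprn_ge0. Qed.

Let bd : bounded_support (box3 L) (fun x => gnorm2 W x * p x ^+ 8).
Proof. exact: (bsp (gnorm2 W) 7 (gnorm2_continuous W CW)). Qed.

Let int_Y2 : \int[leb3]_x (Y x ^+ 2) <= Z.
Proof.
have ba := bm 2 3.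
rewrite /Z /a /d -!(bs_intZ _ fL)// -(bs_intD fL); [|exact: bsZ..].
apply: (bs_int_le fL) => [||x]; first exact: bsM.
  by apply: bsD; exact: bsZ.
have -> : 32 * (gnorm2 W x * p x ^+ 8) = 2 * (4 * (G x * p x ^+ 4)) ^+ 2.
  have E : G x ^+ 2 = gnorm2 W x by rewrite sqr_sqrtr ?gnorm2_ge0.
  by rewrite -[in LHS]E; ring.
have -> : 8 * K ^+ 2 * (m x ^+ 2 * p x ^+ 4) = 2 * (2 * K * (m x * p x ^+ 2)) ^+ 2.
  by ring.
rewrite /Y; move: (4 * _) (2 * K * _) => b c.
rewrite -subr_ge0 (_ : _ - _ = (b - c) ^+ 2) ?sqr_ge0//; ring.
Qed.

Let int_dg k : (\int[leb3]_x `|partial k g x|) ^+ 2 <= X * Z.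
Proof.
have bmp := bm 3 11.
have i0 : 0 <= \int[leb3]_x `|partial k g x| by exact: int_ge0.
have i1 : \int[leb3]_x `|partial k g x| <= \int[leb3]_x (m x ^+ 3 * p x ^+ 12 * Y x).
  apply: (bs_int_le fL); [|exact: bsM|exact: dg_le].
  by apply: bs_norm; case: Cg => _ dgk cgk; exact: bs_partial.
apply: (le_trans (_ : _ <= (\int[leb3]_x (m x ^+ 3 * p x ^+ 12 * Y x)) ^+ 2)).
  by rewrite ler_sqr ?nnegrE// (le_trans i0).
apply: (le_trans (bs_cauchy_schwarz fL bmp bY)).
have -> : \int[leb3]_x ((m x ^+ 3 * p x ^+ 12) ^+ 2) = X.
  by apply: eq_Rintegral => x _; rewrite exprMn -!exprM.
by rewrite ler_wpM2l.
Qed.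

Let X_le : X <= Z ^+ 3.
Proof.
have [_ dgk cgk] := Cg.
pose D k : R := \int[leb3]_x `|partial k g x|.
have D_ge0 k : 0 <= D k by exact: int_ge0.
have D_le k : D k ^+ 2 <= X * Z by exact: int_dg.
have XD : X <= Num.sqrt (D 0 * (D 1 * D 2)).
  apply: (gagliardo g L dgk cgk gL (fun x => m x ^+ 6 * p x ^+ 24) (bm 6 23)) => x.
    by rewrite gE mulr_ge0// exprn_ge0// vnorm_ge0.
  rewrite gE exprMn -!exprM (_ : 4 * 3 = 6 * 2)%N// (_ : 16 * 3 = 24 * 2)%N//.
  by rewrite !exprM -exprMn sqrtr_sqr ler_norm.
exact: le_cube_of_sqrt_product X0 Z0 (D_ge0 _) (D_ge0 _) (D_ge0 _) (D_le _) (D_le _) (D_le _) XD.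
Qed.

(* With f = m p^2 and X the integral of (m p^4)^6, the left-hand side is at most
   sqrt M0 * |f|_2^(1/2) * X^(1/4), and the Sobolev inequality applied to
   g = (m p^4)^4, which is smooth even where the cut-off vanishes, gives X <= Z^3;
   then Young's inequality with weight lam. *)
Lemma nonlinear_bound (q : R3 R -> R) (M0 lam : R) : bounded_support (box3 L) q ->
  (forall x, 0 <= q x) -> \int[leb3]_x (q x ^+ 2) <= M0 -> 0 < lam ->
  \int[leb3]_x (m x ^+ 2 * p x ^+ 7 * q x) <=
  Num.sqrt M0 * (lam^-1 ^+ 3 * a + lam * Z).
Proof.
move=> bq q0 qM l0.
have M00 : 0 <= M0 by apply: le_trans qM; apply: int_ge0 => x; exact: sqr_ge0.
set J := \int[leb3]_x _.
have J0 : 0 <= J.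
  by apply: int_ge0 => x; rewrite !mulr_ge0 ?exprn_ge0// vnorm_ge0.
pose I : R := \int[leb3]_x (m x ^+ 4 * p x ^+ 14).
have I0 : 0 <= I by apply: int_ge0 => x; rewrite mulr_ge0// exprn_ge0// vnorm_ge0.
have J2 : J ^+ 2 <= M0 * I.
  apply: (le_trans (bs_cauchy_schwarz fL (bm 2 6) bq)).
  have -> : \int[leb3]_x ((m x ^+ 2 * p x ^+ 7) ^+ 2) = I.
    by apply: eq_Rintegral => x _; rewrite exprMn -!exprM.
  by rewrite mulrC ler_wpM2r.
have I2 : I ^+ 2 <= a * X.
  have := bs_cauchy_schwarz fL bmp2 (bm 3 11).
  have -> : \int[leb3]_x ((m x * p x ^+ 2) * (m x ^+ 3 * p x ^+ 12)) = I.
    by apply: eq_Rintegral => x _; ring.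
  have -> : \int[leb3]_x ((m x ^+ 3 * p x ^+ 12) ^+ 2) = X.
    by apply: eq_Rintegral => x _; rewrite exprMn -!exprM.
  have -> // : \int[leb3]_x ((m x * p x ^+ 2) ^+ 2) = a.
  by apply: eq_Rintegral => x _; rewrite exprMn -!exprM.
exact: le_young4 J0 I0 M00 a0 Z0 l0 J2 I2 X_le.
Qed.

End NonlinearTerm.

(** * The localized enstrophy identity at a fixed time *)

Section EnergyIdentity.
Context {R : realType}.
Implicit Types (x : R3 R) (i j l : 'I_3).

Definition stretching (U W : 'I_3 -> R3 R -> R) x : R :=
  \sum_(j < 3) (\sum_(l < 3) W l x * partial l (U j) x) * W j x.

Definition transport (U : 'I_3 -> R3 R -> R) (f : R3 R -> R) x : R :=
  \sum_(i < 3) U i x * partial i f x.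

(* The divergence of the flux (d_i W . W) Psi - |W|^2 d_i Psi / 2 - U_i |W|^2 Psi / 2,
   expanded with the vorticity equation. *)
Lemma flux_algebra (w v dv dq hq T : 'I_3 -> R) (q : R) (g h s : 'I_3 -> 'I_3 -> R) :
  \sum_(i < 3) dv i = 0 ->
  (forall j, T j = \sum_(l < 3) w l * s l j - \sum_(l < 3) v l * g l j
    + \sum_(l < 3) h l j) ->
  (\sum_(j < 3) T j * w j) * q + (\sum_(i < 3) \sum_(j < 3) g i j ^+ 2) * q
  - 1 / 2 * (\sum_(j < 3) w j ^+ 2) * (\sum_(i < 3) hq i + \sum_(i < 3) v i * dq i) =
  (\sum_(j < 3) (\sum_(l < 3) w l * s l j) * w j) * q +
  \sum_(i < 3) ((\sum_(j < 3) (h i j * w j + g i j * g i j)) * q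
     + (\sum_(j < 3) g i j * w j) * dq i
     - (1 / 2 * (\sum_(j < 3) 2 * w j * g i j) * dq i
        + 1 / 2 * (\sum_(j < 3) w j ^+ 2) * hq i)
     - (1 / 2 * (dv i * (\sum_(j < 3) w j ^+ 2) + v i * \sum_(j < 3) 2 * w j * g i j) * q
        + 1 / 2 * (v i * \sum_(j < 3) w j ^+ 2) * dq i)).
Proof.
move=> D E; rewrite !sum3 !E !sum3 in D *.
have -> : dv 0 = - dv 1 - dv 2.
  by move/eqP: D; rewrite -addrA addr_eq0 opprD => /eqP.
by field.
Qed.

Variables (U W T : 'I_3 -> R3 R -> R) (psi : R3 R -> R) (L : R).
Hypothesis sU : forall i, smooth_on setT (U i).
Hypothesis sW : forall i, smooth_on setT (W i).
Hypothesis spsi : smooth_on setT psi.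
Hypothesis psiL : forall x, L < `|x| -> psi x = 0.
Hypothesis divU : forall x, \sum_(i < 3) partial i (U i) x = 0.
Hypothesis equation : forall j x, T j x =
  \sum_(l < 3) W l x * partial l (U j) x - \sum_(l < 3) U l x * partial l (W j) x
  + \sum_(l < 3) partial l (partial l (W j)) x.

Let w2 x := \sum_(j < 3) W j x ^+ 2.

Let flux i x : R := (\sum_(j < 3) partial i (W j) x * W j x) * psi x
  - 1 / 2 * w2 x * partial i psi x - 1 / 2 * (U i x * w2 x) * psi x.

Let Cw2 : C1 w2.
Proof. by apply: C1_sum => j; apply: C1_sqr; exact: C1_smooth. Qed.

Let C1_flux i : C1 (flux i).
Proof.
have CU := C1_smooth (sU i); have Cp := C1_smooth spsi.
apply: C1_sub; first apply: C1_sub.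
- apply: C1_mul => //; apply: C1_sum => j; apply: C1_mul; last exact: C1_smooth.
  by apply: C1_smooth; exact: smooth_partial.
- apply: C1_mul; first by apply: C1_mul => //; exact: C1_cst.
  by apply: C1_smooth; exact: smooth_partial.
- by apply: C1_mul => //; apply: C1_mul; [exact: C1_cst|exact: C1_mul].
Qed.

Let partial_flux i x : partial i (flux i) x =
  (\sum_(j < 3) (partial i (partial i (W j)) x * W j x + partial i (W j) x * partial i (W j) x)) * psi x
     + (\sum_(j < 3) partial i (W j) x * W j x) * partial i psi x
     - (1 / 2 * (\sum_(j < 3) 2 * W j x * partial i (W j) x) * partial i psi x
        + 1 / 2 * w2 x * partial i (partial i psi) x)
     - (1 / 2 * (partial i (U i) x * w2 x + U i x * \sum_(j < 3) 2 * W j x * partial i (W j) x) * psi x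
        + 1 / 2 * (U i x * w2 x) * partial i psi x).
Proof.
have dW j := partial_is_derive i x (sW j).
have ddW j := partial_is_derive i x (smooth_partial i (sW j)).
have dpsi := partial_is_derive i x spsi.
have ddpsi := partial_is_derive i x (smooth_partial i spsi).
have dU := partial_is_derive i x (sU i).
have dw2 := is_derive_bigsum _ _ _ _ _ (fun j => is_derive_square _ _ _ _ (dW j)).
exact: (is_derive_val (is_derive_sub _ _ _ _ _ _ (is_derive_sub _ _ _ _ _ _
  (is_derive_mul _ _ _ _ _ _ (is_derive_bigsum _ _ _ _ _ (fun j => is_derive_mul _ _ _ _ _ _ (ddW j) (dW j))) dpsi)
  (is_derive_mul _ _ _ _ _ _ (is_derive_scale _ _ _ (1 / 2) _ dw2) ddpsi))
  (is_derive_mul _ _ _ _ _ _ (is_derive_scale _ _ _ (1 / 2) _ (is_derive_mul _ _ _ _ _ _ dU dw2)) dpsi))).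
Qed.

Let flux_support i x : L < `|x| -> flux i x = 0.
Proof.
move=> xL; rewrite /flux psiL// (partial_support psi L)//; first by ring.
Qed.

Lemma bs_stretching : bounded_support (box3 L) (fun x => stretching U W x * psi x).
Proof.
apply: continuous_bs3 => [x|x xL]; last by rewrite psiL// mulr0.
apply: (cont_mul _ (smooth_continuous spsi x I)).
apply: cont_sum => j; apply: (cont_mul _ (smooth_continuous (sW j) x I)).
apply: cont_sum => l; apply: (cont_mul (smooth_continuous (sW l) x I)).
exact: (smooth_continuous (smooth_partial l (sU j)) x I).
Qed.

(** The integrands differ by the divergence of a compactly supported flux. Here [T] is the time
    derivative of the vorticity; the temporal cut-off is constant at a fixed time and enters later
    as a factor. *)
Lemma int_stretching : \int[leb3]_x (stretching U W x * psi x) =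
  \int[leb3]_x ((\sum_(j < 3) T j x * W j x) * psi x + gnorm2 W x * psi x
     - 1 / 2 * w2 x * (laplacian psi x + transport U psi x)).
Proof.
have fL := finite_measurable_box3 L.
have bf i : bounded_support (box3 L) (partial i (flux i)).
  by have [_ df cf] := C1_flux i; apply: bs_partial => //; exact: flux_support.
under [RHS]eq_Rintegral => x _.
  rewrite /gnorm2 /laplacian /transport /w2.
  rewrite (@flux_algebra (W ^~ x) (U ^~ x) (fun i => partial i (U i) x)
    (fun i => partial i psi x) (fun i => partial i (partial i psi) x) (T ^~ x) (psi x)
    (fun i j => partial i (W j) x) (fun i j => partial i (partial i (W j)) x)
    (fun l j => partial l (U j) x) (divU x) (fun j => equation j x)).
  under [X in _ + X]eq_bigr do rewrite -partial_flux.
  over.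
rewrite (bs_intD fL bs_stretching); last exact: bs_sum.
rewrite (bs_int_sum _ _ fL bf) big1 ?addr0// => i _.
have [_ df cf] := C1_flux i.
exact: (int_partial (flux i) L df cf (flux_support i)).
Qed.

End EnergyIdentity.

(** * Cut-offs of a cover *)

Section EuclideanGeometry.
Context {R : realType}.
Implicit Types (x y z a w : R3 R) (s r : R).

Lemma crdD x y i : crd (x + y) i = crd x i + crd y i.
Proof. by case: (ord3P i) => ->. Qed.

Lemma crdN x i : crd (- x) i = - crd x i.
Proof. by case: (ord3P i) => ->. Qed.

Lemma crdZ s x i : crd (s *: x) i = s * crd x i.
Proof. by case: (ord3P i) => ->. Qed.

Lemma dotE x y : dot x y = crd x 0 * crd y 0 + crd x 1 * crd y 1 + crd x 2 * crd y 2.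
Proof. by rewrite /dot sum3. Qed.

Lemma crd_unit_vec i j : crd (unit_vec i) j = (i == j)%:R :> R.
Proof. by rewrite crd_vec. Qed.

Definition vecE := (dotE, crdD, crdN, crdZ, crd_unit_vec).

Lemma dot_ge0 x : 0 <= dot x x.
Proof. by rewrite dotE !addr_ge0// -expr2 sqr_ge0. Qed.

Lemma dot_eq0 x : dot x x = 0 -> x = 0.
Proof.
rewrite dotE -!expr2 => H.
have h i : crd x i = 0.
  have := sqr_ge0 (crd x 0); have := sqr_ge0 (crd x 1); have := sqr_ge0 (crd x 2).
  by case: (ord3P i) => -> H2 H1 H0; apply/eqP; rewrite -sqrf_eq0 eq_le sqr_ge0 andbT; lra.
by case: x H h => -[x0 x1] x2 _ h; have := h 0; have := h 1; have := h 2; rewrite /crd/= => -> -> ->.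
Qed.

Lemma enorm_sq x : enorm x ^+ 2 = dot x x.
Proof. by rewrite sqr_sqrtr// dot_ge0. Qed.

Lemma enorm_ge0 x : 0 <= enorm x.
Proof. exact: sqrtr_ge0. Qed.

Lemma enorm_lt x r : 0 < r -> (enorm x < r) = (dot x x < r ^+ 2).
Proof. by move=> r0; rewrite -enorm_sq ltr_sqr ?nnegrE ?enorm_ge0// ltW. Qed.

Lemma enormZ s x : enorm (s *: x) = `|s| * enorm x.
Proof.
rewrite /enorm (_ : dot _ _ = s ^+ 2 * dot x x); last by rewrite !vecE; ring.
by rewrite sqrtrM ?sqr_ge0// sqrtr_sqr.
Qed.

Lemma crd_continuous i : continuous (crd^~ i : R3 R -> R).
Proof.
move=> x; case: (ord3P i) => ->; rewrite /crd/=.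
- exact: (continuous_comp (@cvg_fst _ _ _ _ _) (@cvg_fst _ _ _ _ _)).
- exact: (continuous_comp (@cvg_fst _ _ _ _ _) (@cvg_snd _ _ _ _ _)).
- exact: cvg_snd.
Qed.

Lemma dot_continuous {T : topologicalType} (f g : T -> R3 R) (t : T) :
  {for t, continuous f} -> {for t, continuous g} ->
  {for t, continuous (fun b => dot (f b) (g b))}.
Proof.
move=> cf cg; apply: cont_sum => i; apply: cont_mul.
- exact: (continuous_comp cf (@crd_continuous i (f t))).
- exact: (continuous_comp cg (@crd_continuous i (g t))).
Qed.

Lemma enorm_continuous : continuous (enorm : R3 R -> R).
Proof.
move=> x; have c : {for x, continuous (fun y : R3 R => dot y y)}.
  by apply: dot_continuous; exact: cvg_id.
exact: (cont_comp c (@sqrt_continuous R)).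
Qed.

End EuclideanGeometry.

(** * Complements of zero sets of quadratic functions *)

Section DenseQuadrics.
Context {R : realType}.
Implicit Types (x w a : R3 R).

(** Near 0 the nonzero term of lowest degree dominates, whence the cases on [A] and [B]. *)
Lemma near_quadratic_neq0 (A B C : R) : C != 0 ->
  \forall t \near 0^', A + B * t + C * t ^+ 2 != 0.
Proof.
move=> C0.
have neq0 (f : R -> R) : continuous f -> f 0 != 0 -> \forall t \near 0^', f t != 0.
  move=> cf f0; apply: nbhs_dnbhs; apply: (cf 0 [set y | y != 0]).
  by apply: open_nbhs_nbhs; split => //; exact: open_neq.
have t0 : \forall t \near (0 : R)^', t != 0 by exact: nbhs_dnbhs_neq.
have cX (t : R) : {for t, continuous (fun y : R => y)} by exact: cvg_id.
have [A0|A0] := eqVneq A 0; last first.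
  apply: (neq0 (fun t => A + B * t + C * t ^+ 2)) => [t|].
    exact: (cont_add (cont_add (cont_cst A t) (cont_mul (cont_cst B t) (cX t)))
      (cont_mul (cont_cst C t) (cont_exp 2 (cX t)))).
  by rewrite mulr0 expr0n mulr0 !addr0.
have [B0|B0] := eqVneq B 0.
  near=> t; rewrite A0 B0 mul0r !add0r mulf_neq0// sqrf_eq0.
  by near: t.
have BC : \forall t \near 0^', B + C * t != 0.
  apply: (neq0 (fun t => B + C * t)) => [t|]; last by rewrite mulr0 addr0.
  exact: (cont_add (cont_cst B t) (cont_mul (cont_cst C t) (cX t))).
near=> t; rewrite A0 add0r (_ : _ + _ = t * (B + C * t)); last by ring.
by rewrite mulf_neq0//; near: t.
Unshelve. all: by end_near. Qed.

(** The coefficient [C] of t^2 is common to all lines parallel to [w]: it is the value at [w] of the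
    homogeneous quadratic part of [q]. *)
Definition quadratic_along (q : R3 R -> R) w (C : R) :=
  forall x, exists B, forall t : R, q (t *: w + x) = q x + B * t + C * t ^+ 2.

Lemma dense_quadratic_neq0 (q : R3 R -> R) w C : C != 0 ->
  quadratic_along q w C -> dense [set z | q z != 0].
Proof.
move=> C0 qw O [x Ox] oO; have [B qB] := qw x.
have Oline : \forall t \near (0 : R)^', O (t *: w + x).
  apply: nbhs_dnbhs.
  have : {for 0, continuous (fun t : R => t *: w + x)}.
    by apply: cvgD; [exact: scalel_continuous|exact: cvg_cst].
  by apply; apply: open_nbhs_nbhs; split; rewrite ?scale0r ?add0r.
have : \forall t \near (0 : R)^', O (t *: w + x) /\ q (t *: w + x) != 0.
  near=> t; split; first by near: t.
  by rewrite qB; near: t; exact: near_quadratic_neq0.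
move/(@filter_ex _ _ _) => [t [Ot qt]].
by exists (t *: w + x).
Unshelve. all: by end_near. Qed.

Lemma dense_quadratics_neq0 (I : eqType) (s : seq I) (q : I -> R3 R -> R) :
  (forall i, continuous (q i)) ->
  (forall i, i \in s -> exists w C, C != 0 /\ quadratic_along (q i) w C) ->
  open [set z | forall i, i \in s -> q i z != 0] /\
  dense [set z | forall i, i \in s -> q i z != 0].
Proof.
move=> cq; elim: s => [|i s IH] H.
  rewrite (_ : [set z | _] = setT); last by apply/seteqP; split => // z _ i.
  by split; [exact: openT|move=> O O0 _; rewrite setIT].
have [|o d] := IH; first by move=> j js; apply: H; rewrite inE js orbT.
rewrite (_ : [set z | _] = [set z | q i z != 0] `&`
    [set z | forall i, i \in s -> q i z != 0]); last first.
  apply/seteqP; split => z /=.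
    by move=> h; split => [|j js]; apply: h; rewrite inE ?eqxx// js orbT.
  by move=> [h1 h2] j; rewrite inE => /predU1P[->//|]; exact: h2.
have oi : open [set z | q i z != 0].
  by apply: (open_comp (f := q i) (D := [set y | y != 0])) => [z _|]; [exact: cq|exact: open_neq].
split; first exact: openI.
apply: denseI => //.
have [|w [C [C0 qw]]] := H i; first by rewrite inE eqxx.
exact: dense_quadratic_neq0 C0 qw.
Qed.

(* Used for spheres (al = 0) and for cones with axis a (ga = 0). *)
Lemma quadric_nondegenerate (al be ga : R) a : al ^+ 2 * dot a a != 0 \/ be != 0 ->
  exists w C, C != 0 /\
    quadratic_along (fun z => al * dot z a ^+ 2 - be * dot z z + ga) w C.
Proof.
move=> H.
have quad w : quadratic_along (fun z => al * dot z a ^+ 2 - be * dot z z + ga) w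
    (al * dot w a ^+ 2 - be * dot w w).
  move=> x; exists (2 * al * dot x a * dot w a - 2 * be * dot x w) => t.
  by rewrite !vecE; ring.
pose Q w := al * dot w a ^+ 2 - be * dot w w.
have [q0|q0] := eqVneq (Q (unit_vec 0)) 0; last by exists (unit_vec 0), (Q (unit_vec 0)).
have [q1|q1] := eqVneq (Q (unit_vec 1)) 0; last by exists (unit_vec 1), (Q (unit_vec 1)).
have [q2|q2] := eqVneq (Q (unit_vec 2)) 0; last by exists (unit_vec 2), (Q (unit_vec 2)).
have [qa|qa] := eqVneq (Q a) 0; last by exists a, (Q a).
exfalso; move: q0 q1 q2 qa; rewrite /Q !vecE /= !(mul0r, mul1r, mulr0, mulr1, addr0, add0r).
move=> q0 q1 q2 qa.
(* The three unit vectors give the trace of [Q]. Together with Q a = 0 it forces be = 0 and al |a|^2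
   = 0, against both alternatives of [H]. *)
have D : dot a a * al = 3 * be by rewrite dotE; lra.
have E : dot a a * (2 * be) = 0.
  have -> : dot a a * (2 * be) = dot a a * (dot a a * al - be) by rewrite D; ring.
  by rewrite dotE; lra.
have b0 : be = 0.
  move/eqP: E; rewrite mulf_eq0 => /orP[/eqP aa|]; last by rewrite mulf_eq0 pnatr_eq0 => /eqP.
  by move: D; rewrite aa mul0r => D; lra.
case: H => [|]; last by rewrite b0 eqxx.
by rewrite expr2 -mulrA [al * dot a a]mulrC D b0 !mulr0 eqxx.
Qed.

End DenseQuadrics.

(** * Comparison of the sum of the cut-offs with the macro-scale cut-off *)

Section Cover.
Context {R : realType}.
Variables (C0 R0 r : R) (K1 K2 n : nat) (c : 'I_n -> R3 R).
Variable (psi : R3 R -> R -> R3 R -> R).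
Hypothesis cover : is_cover K1 K2 R0 r c.
Hypothesis macro : spatial_cutoff C0 0 R0 (psi 0 R0).
Hypothesis cutoffs : forall i, cover_cutoff C0 R0 (psi 0 R0) (c i) r (psi (c i) r).
Implicit Types (x y : R3 R) (i : 'I_n) (s : R).

Local Notation psi0 := (psi 0 R0).
Local Notation Psi i := (psi (c i) r).

Let r0 : 0 < r. Proof. by case: cover => /andP[]. Qed.
Let rR : r <= R0. Proof. by case: cover => /andP[]. Qed.
Let R00 : 0 < R0. Proof. exact: lt_le_trans r0 rR. Qed.

Lemma test_function_support (U : set (R3 R)) f x :
  test_function U f -> f x != 0 -> U x.
Proof.
move=> [_ [K [_ KU K0]]] fx; apply: KU; apply: contrapT => /K0 f0.
by rewrite f0 eqxx in fx.
Qed.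

Lemma cutoff_ge0 i x : 0 <= Psi i x.
Proof. by have [_ _ /(_ x)/andP[]] := cutoffs i. Qed.

Lemma cutoff_le i x : Psi i x <= psi0 x.
Proof. by have [_ _ /(_ x)/andP[]] := cutoffs i. Qed.

Lemma macro_bound x : 0 <= psi0 x <= 1.
Proof. by case: macro => _ _ [+ _ _]; exact. Qed.

Lemma macro_support x : psi0 x != 0 -> enorm x < 2 * R0.
Proof.
by case: macro => tf _ _ /(test_function_support _ _ _ tf); rewrite /eball/= subr0.
Qed.

Lemma cutoff_support i x : Psi i x != 0 -> psi0 x != 0.
Proof.
apply: contra_neq => p0; apply/eqP; rewrite eq_le cutoff_ge0 andbT -p0.
exact: cutoff_le.
Qed.

Lemma cutoff_test i : exists U, test_function U (Psi i).
Proof.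
have [H1 H2 _] := cutoffs i; have [/H1[tf _ _]|/H2[tf _ _ _ _]] := pselect (eball (c i) r `<=` eball 0 R0).
  by exists (eball (c i) (2 * r)).
by exists (eball 0 (2 * R0)).
Qed.

Lemma cutoff_smooth i : smooth_on setT (Psi i).
Proof. by have [U []] := cutoff_test i. Qed.

Lemma interior_center i : eball (c i) r `<=` eball 0 R0 -> enorm (c i) < R0.
Proof.
move=> /(_ (c i)); rewrite /eball/= subr0; apply.
by rewrite subrr -(scale0r (c i)) enormZ normr0 mul0r.
Qed.

Lemma cutoff_inside i x : enorm x < R0 -> Psi i x != 0 -> enorm (x - c i) < 2 * r.
Proof.
move=> xR px; have [H1 H2 _] := cutoffs i.
have [/H1[tf _ _]|/H2[_ _ _ _ [b1 _]]] := pselect (eball (c i) r `<=` eball 0 R0).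
  exact: (test_function_support _ _ _ tf px).
apply: contrapT => xc; move: px; rewrite b1 ?eqxx//.
by split => //; rewrite /eball/= subr0.
Qed.

Lemma line_continuous x y : continuous (fun s => enorm (s *: x - y)).
Proof.
move=> s; have l : {for s, continuous (fun s => s *: x - y)}.
  by apply: cvgB; [exact: scalel_continuous|exact: cvg_cst].
exact: (continuous_comp l (@enorm_continuous R _)).
Qed.

Lemma near_left_open (f : R -> R) s (A : set R) : {for s, continuous f} ->
  open A -> A (f s) -> \forall t \near s^'-, A (f t).
Proof.
move=> cf oA Af; have H := cvg_at_left_filter cf.
have /H : nbhs (f s) A by exact: open_nbhs_nbhs.
exact.
Qed.

Section Projection.
Variable x : R3 R.
Hypothesis xR : R0 <= enorm x.
Let s0 := R0 / enorm x.

Let x0 : 0 < enorm x. Proof. exact: lt_le_trans R00 xR. Qed.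
Let s00 : 0 < s0. Proof. exact: divr_gt0. Qed.
Let s01 : s0 <= 1. Proof. by rewrite ler_pdivrMr// mul1r. Qed.

Let near_inside : \forall s \near s0^'-, enorm (s *: x) < R0.
Proof.
have : \forall s \near s0^'-, 0 < s.
  exact: nbhs_left_gt.
have : \forall s \near s0^'-, s < s0 by exact: nbhs_left_lt.
apply: filterS2 => s ss sp; rewrite enormZ gtr0_norm//.
by rewrite -ltr_pdivlMr.
Qed.

(** Multiplicity is known only in the open ball, so x is moved radially to just below the sphere.
    For an interior member the center has norm less than R0, and projecting x to the sphere does not
    increase the distance to it. For a boundary member and |x| > R0, condition (b) puts x in the
    cone over B(c_i, 2r), whose point on the sphere along the ray of x is s0 x. On the sphere itself
    (b) is silent, and continuity of the cut-off takes over. *)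
Lemma projection_near i : Psi i x != 0 -> enorm x < 2 * R0 ->
  \forall s \near s0^'-, enorm (s *: x - c i) < 2 * r.
Proof.
move=> px x2.
have close : enorm (s0 *: x - c i) < 2 * r ->
    \forall s \near s0^'-, enorm (s *: x - c i) < 2 * r.
  move=> h; apply: (near_left_open _ _ [set v | v < 2 * r]
    (@line_continuous x (c i) s0)) => //; exact: open_lt.
have [H1 H2 _] := cutoffs i.
have [I|I] := pselect (eball (c i) r `<=` eball 0 R0).
  apply: close; have [tf _ _] := H1 I; have := test_function_support _ _ _ tf px.
  rewrite /eball/=; apply: le_lt_trans; rewrite ler_wsqrtr//.
  have := interior_center i I; rewrite enorm_lt// => cR.
  have xx : s0 ^+ 2 * dot x x = R0 ^+ 2.
    by rewrite /s0 -enorm_sq exprMn exprVn mulfVK// sqrf_eq0 gt_eqF.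
  have dxc : dot x (c i) <= s0 * dot x x.
    have E : s0 * dot x x = enorm x * R0.
      by rewrite -enorm_sq /s0 expr2 mulrA divfK ?gt_eqF// mulrC.
    have := sum3_cauchy_schwarz (crd x) (crd (c i)).
    rewrite -/(dot x (c i)) => CS.
    rewrite E; apply: (le_trans (ler_norm _)).
    have xR0 : 0 <= enorm x * R0 by rewrite mulr_ge0 ?enorm_ge0// ltW.
    rewrite -ler_sqr ?nnegrE// real_normK ?num_real//.
    apply: (le_trans CS); rewrite exprMn enorm_sq.
    have E1 y : \sum_(i0 < 3) crd y i0 ^+ 2 = dot y y.
      by apply: eq_bigr => k _; rewrite expr2.
    by rewrite !E1 ler_wpM2l ?dot_ge0// ltW.
  rewrite -subr_ge0.
  (* Both factors are nonnegative: s0 <= 1, and x . c_i <= |x| R0 = s0 |x|^2 by Cauchy-Schwarz. *)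
  have -> : dot (x - c i) (x - c i) - dot (s0 *: x - c i) (s0 *: x - c i) =
      (1 - s0) * (2 * (s0 * dot x x - dot x (c i)) + (1 - s0) * dot x x).
    by rewrite !vecE; ring.
  rewrite mulr_ge0 ?subr_ge0// addr_ge0 ?mulr_ge0 ?subr_ge0// ?dot_ge0//.
have [_ _ _ _ [b1 b2]] := H2 I.
have [xE|xn] := eqVneq (enorm x) R0.
  have s1 : s0 = 1 by rewrite /s0 xE divff// gt_eqF.
  have : \forall s \near s0^'-, Psi i (s *: x) != 0.
    have cs : {for s0, continuous (fun s => Psi i (s *: x))}.
      apply: (continuous_comp (@scalel_continuous _ _ x s0)).
      exact: (smooth_continuous (cutoff_smooth i)).
    apply: (near_left_open _ _ [set v | v != 0] cs); first exact: open_neq.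
    by rewrite /= s1 scale1r.
  move: near_inside; apply: filterS2 => s sR ps.
  exact: cutoff_inside.
apply: close; apply: contrapT => h; move: px; rewrite b2 ?eqxx//.
  by rewrite /shell/= x2 lt_neqAle eq_sym xn xR.
move=> [s [y [sp [yR yc] xE]]]; apply: h.
suff -> : s0 *: x = y by [].
move: yR; rewrite /esphere/= subr0 => yR.
have -> : s0 = s^-1.
  by rewrite /s0 xE enormZ yR gtr0_norm// invfM mulrCA divff ?mulr1 ?gt_eqF.
by rewrite xE scalerA mulVf ?scale1r// gt_eqF.
Qed.

(* Moving x radially into the ball keeps it in the doubled balls of all the
   members whose cut-off does not vanish at x. *)
Lemma projected_point : enorm x < 2 * R0 -> exists y, enorm y < R0 /\
  forall i, Psi i x != 0 -> enorm (y - c i) < 2 * r.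
Proof.
move=> x2.
have H i : \forall s \near s0^'-, Psi i x != 0 -> enorm (s *: x - c i) < 2 * r.
  have [p0|px] := eqVneq (Psi i x) 0; first by apply: filterE => s /eqP[].
  by move: (projection_near i px x2); apply: filterS => s.
have /(@filter_ex _ _ _)[s [sR Hs]] : \forall s \near s0^'-, enorm (s *: x) < R0 /\
    forall i, Psi i x != 0 -> enorm (s *: x - c i) < 2 * r.
  apply: filterI; first exact: near_inside.
  exact: (@filter_forall R 'I_n _ _ _ H).
by exists (s *: x).
Qed.

(** The points s x with s slightly below s0 lie in the open ball, hence in members of the cover. As
    these are finitely many, the limit point lies in a closed ball, which is why the inequality is
    not strict. *)
Lemma projection_covered : exists i, enorm (s0 *: x - c i) <= r.
Proof.
apply: contrapT => /forallNP H.
have H' i : \forall s \near s0^'-, r < enorm (s *: x - c i).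
  have h : r < enorm (s0 *: x - c i) by rewrite ltNge; apply/negP.
  apply: (near_left_open _ _ [set v | r < v] (@line_continuous x (c i) s0) _ h).
  exact: open_gt.
have /(@filter_ex _ _ _)[s [sR Hs]] : \forall s \near s0^'-, enorm (s *: x) < R0 /\
    forall i, r < enorm (s *: x - c i).
  apply: filterI; first exact: near_inside.
  exact: (@filter_forall R 'I_n _ _ _ H').
have [_ /(_ (s *: x)) cov _ _] := cover.
have [|i _] := cov; first by rewrite /eball/= subr0.
by rewrite /eball/= ltNge ltW.
Qed.

End Projection.

Lemma cover_multiplicity x : (#|[pred i | Psi i x != 0%R]| <= K2)%N.
Proof.
have [p0|p0] := eqVneq (psi0 x) 0.
  rewrite eq_card0// => i; rewrite inE; apply/negbTE; rewrite negbK; apply/eqP.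
  by apply/eqP; apply: contraT => /cutoff_support; rewrite p0 eqxx.
have [y [yR Hy]] : exists y, enorm y < R0 /\
    forall i, Psi i x != 0 -> enorm (y - c i) < 2 * r.
  have [xR|xR] := ltP (enorm x) R0.
    by exists x; split => // i; exact: cutoff_inside.
  by apply: projected_point => //; exact: macro_support.
have [_ _ _ /(_ y) H] := cover.
apply: leq_trans (H _); last by rewrite /eball/= subr0.
by apply: subset_leq_card; apply/fintype.subsetP => i; rewrite !inE; exact: Hy.
Qed.

Let total x : R := \sum_(i < n) Psi i x.

Let le_total i x : Psi i x <= total x.
Proof.
rewrite /total (bigD1 i)//= lerDl; apply: sumr_ge0 => j _; exact: cutoff_ge0.
Qed.

(** The cone over the intersection of the spheres S(0, R0) and S(c_i, r): for |y| = R0 the condition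
    |y - c_i| = r reads 2 y . c_i = R0^2 + |c_i|^2 - r^2, and squaring makes it homogeneous. The
    summand 0 fits the shape of [quadric_nondegenerate]. *)
Let sphere_quadric i x := (2 * R0) ^+ 2 * dot x (c i) ^+ 2 -
  (R0 ^+ 2 + dot (c i) (c i) - r ^+ 2) ^+ 2 * dot x x + 0.

(** Inside the ball some member equals 1. Outside, the projection of x to the sphere lies in a
    closed ball of the cover and, off the quadrics, in the open one, unless that ball is centered at
    0; then (a) identifies the member with psi_0 at x. *)
Let generic x : enorm x != R0 -> (forall i, c i != 0 -> sphere_quadric i x != 0) ->
  psi0 x <= total x.
Proof.
move=> xn gen.
have [p0|p0] := eqVneq (psi0 x) 0.
  by rewrite p0; apply: sumr_ge0 => i _; exact: cutoff_ge0.
have x2 := macro_support x p0.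
have /andP[_ p1] := macro_bound x.
have [xR|Rx] := ltP (enorm x) R0.
  have [_ /(_ x) cov _ _] := cover.
  have [|i _ xi] := cov; first by rewrite /eball/= subr0.
  apply: (le_trans p1); suff <- : Psi i x = 1 by exact: le_total.
  have [H1 H2 _] := cutoffs i.
  have [/H1[_ p _]|/H2[_ p _ _ _]] := pselect (eball (c i) r `<=` eball 0 R0); apply: p => //.
  by split => //; rewrite /eball/= subr0.
have [i] := projection_covered x Rx; set s0 := R0 / enorm x => yi.
have x0 : 0 < enorm x by exact: lt_le_trans R00 Rx.
have s00 : 0 < s0 by exact: divr_gt0.
have yR : enorm (s0 *: x) = R0.
  by rewrite enormZ gtr0_norm// /s0 divfK// gt_eqF.
move: yi; rewrite le_eqVlt => /predU1P[yE|yi]; last first.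
  apply: (le_trans _ (le_total i x)).
  have [_ H2 _] := cutoffs i.
  have nI : ~ eball (c i) r `<=` eball 0 R0.
    by move=> /(_ (s0 *: x) yi); rewrite /eball/= subr0 yR ltxx.
  have [_ _ _ -> //] := H2 nI; first by rewrite /shell/= x2 lt_neqAle eq_sym xn Rx.
  exists s0^-1, (s0 *: x); split; first by rewrite invr_gt0.
    by split => //; rewrite /esphere/= subr0.
  by rewrite scalerA mulVf ?scale1r// gt_eqF.
have ci0 : c i = 0.
  apply/eqP/negPn/negP => /gen; apply/negP; rewrite negbK.
  have y2 : dot (s0 *: x) (s0 *: x) = R0 ^+ 2 by rewrite -enorm_sq yR.
  have yc : 2 * dot (s0 *: x) (c i) = R0 ^+ 2 + dot (c i) (c i) - r ^+ 2.
    have := enorm_sq (s0 *: x - c i); rewrite yE => ->.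
    rewrite -y2 !vecE; ring.
  rewrite /sphere_quadric -yc.
  have xx : dot (s0 *: x) (s0 *: x) = s0 ^+ 2 * dot x x by rewrite !vecE; ring.
  rewrite exprMn -y2 xx (_ : dot (s0 *: x) (c i) = s0 * dot x (c i)); last by rewrite !vecE; ring.
  by apply/eqP; ring.
(* For a center at 0 the quadric may vanish identically, but then r = R0 and the member is psi_0
   itself, cut-offs being indexed by center and scale. *)
have rE : r = R0 by rewrite -yE ci0 subr0 yR.
by apply: (le_trans _ (le_total i x)); rewrite ci0 rE.
Qed.

Lemma total_smooth_continuous : continuous total.
Proof.
by move=> x; apply: cont_sum => i; exact: (smooth_continuous (cutoff_smooth i) x I).
Qed.

(* The members need only cover the open ball, so their traces may miss points of
   the sphere. The rays through missed points lie on finitely many cones, whose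
   complement is dense, and both sides are continuous. *)
Lemma cover_lower x : psi0 x <= total x.
Proof.
rewrite leNgt; apply/negP => lt.
(* [None] stands for the sphere of radius R0, excluded because (a) concerns only the open shell; it
   is written in the common shape of the quadrics. *)
pose q (o : option 'I_n) : R3 R -> R := if o is Some i then sphere_quadric i
  else fun x => 0 * dot x 0 ^+ 2 - (-1) * dot x x + - R0 ^+ 2.
pose s := None :: [seq Some i | i <- enum 'I_n & c i != 0].
have cq o : continuous (q o).
  have cd (a : R3 R) y : {for y, continuous (fun z => dot z a)}.
    by apply: dot_continuous; [exact: cvg_id|exact: cvg_cst].
  have cn y : {for y, continuous (fun z : R3 R => dot z z)}.
    by apply: dot_continuous; exact: cvg_id.
  by case: o => [i|] y; exact: (cont_add (cont_sub (cont_mul (cont_cst _ y) (cont_exp 2 (cd _ y)))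
    (cont_mul (cont_cst _ y) (cn y))) (cont_cst _ y)).
have [|_ /(_ [set z | total z < psi0 z])] := dense_quadratics_neq0 _ s q cq.
  move=> o; rewrite inE => /predU1P[->|/mapP[i]].
    by apply: quadric_nondegenerate; right; rewrite oppr_eq0 oner_eq0.
  rewrite mem_filter => /andP[ci _] ->; apply: quadric_nondegenerate; left.
  rewrite mulf_neq0//; first by rewrite !sqrf_eq0 mulf_neq0// gt_eqF.
  by apply: contra_neq ci => /dot_eq0.
case=> [||z [/= zlt zs]]; first by exists x.
  rewrite (_ : [set z | _] = (fun z => psi0 z - total z) @^-1` [set y | 0 < y]); last first.
    by apply/seteqP; split => z /=; rewrite subr_gt0.
  apply: open_comp; last exact: open_gt.
  move=> z _; have [[smooth _] _ _] := macro.
  exact: (cont_sub (smooth_continuous smooth z I) (@total_smooth_continuous z)).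
move: zlt; apply/negP; rewrite -leNgt; apply: generic => [|i ci].
  have := zs None; rewrite inE eqxx => /(_ isT); apply: contra_neq => zR /=.
  by rewrite mul0r sub0r mulN1r opprK -enorm_sq zR subrr.
apply: (zs (Some i)); rewrite inE /=; apply/mapP; exists i => //.
by rewrite mem_filter ci mem_enum.
Qed.

Lemma sum_cutoff_le (f : 'I_n -> R) (K x0 : R) x : 0 <= x0 ->
  (forall i, Psi i x = 0 -> f i = 0) -> (forall i, f i <= x0) ->
  \sum_(i < n) f i <= K2%:R * x0.
Proof.
move=> x00 f0 fx.
rewrite (bigID [pred i | Psi i x != 0])/= [X in _ + X]big1 ?addr0; last first.
  by move=> i; rewrite negbK => /eqP; exact: f0.
apply: (le_trans (ler_sum _ (fun i _ => fx i))).
rewrite sumr_const mulr_natl ler_wpMn2l//.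
apply: leq_trans (cover_multiplicity x).
by rewrite leq_eqVlt; apply/orP; left; apply/eqP; apply: eq_card => i.
Qed.

End Cover.

(** * The enstrophy balance *)

Section SmoothSums.
Context {R : realType} {V : normedModType R}.
Implicit Types (f g : V -> R) (U : set V).

Lemma iter_derive0 vs : iter_derive vs (fun _ : V => 0 : R) = fun=> 0.
Proof. by elim: vs => //= v vs ->; apply/funext => x; exact: derive_cst. Qed.

Lemma smooth0 U : smooth_on U (fun _ : V => 0 : R).
Proof.
move=> vs x _; rewrite iter_derive0; split; first exact: cont_cst.
by move=> v; exact: derivable_cst.
Qed.

Lemma smooth_add {U f g} : open U -> smooth_on U f -> smooth_on U g ->
  smooth_on U (fun y => f y + g y).
Proof.
move=> oU sf sg; have := smooth_sub oU sf (smooth_sub oU (smooth0 U) sg).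
by congr smooth_on; apply/funext => y; rewrite sub0r opprK.
Qed.

Lemma smooth_sum {U} n (F : 'I_n -> V -> R) : open U ->
  (forall i, smooth_on U (F i)) -> smooth_on U (fun y => \sum_(i < n) F i y).
Proof.
move=> oU sF; have : forall s : seq 'I_n, smooth_on U (fun y => \sum_(i <- s) F i y).
  elim=> [|i s IH].
    rewrite (_ : (fun y => _) = fun=> 0); first exact: smooth0.
    by apply/funext => y; rewrite big_nil.
  rewrite (_ : (fun y => _) = fun y => F i y + \sum_(j <- s) F j y).
    exact: smooth_add.
  by apply/funext => y; rewrite big_cons.
exact.
Qed.

End SmoothSums.

Lemma le_of_eq {R : numDomainType} (a b : R) : a = b -> a <= b.
Proof. by move=> ->. Qed.

(** * The error estimate at a frozen time *)

Section FixedTime.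
Context {R : realType}.
Implicit Types (x : R3 R) (i j l : 'I_3).

Lemma norm_le_enorm x : `|x| <= enorm x.
Proof.
have H i : `|crd x i| <= enorm x.
  rewrite -sqrtr_sqr ler_wsqrtr// /dot (bigD1 i)//= expr2 lerDl.
  by apply: sumr_ge0 => j _; rewrite -expr2 sqr_ge0.
have h0 := H 0; have h1 := H 1; have h2 := H 2.
by rewrite !prod_normE/= !ge_max h0 h1 h2.
Qed.

Lemma measurable_eball (rho : R) :
  @measurable _ (measurableTypeR R * measurableTypeR R * measurableTypeR R)%type
    (eball (0 : R3 R) rho).
Proof.
have o : open (eball (0 : R3 R) rho).
  rewrite (_ : eball _ _ = enorm @^-1` [set y | y < rho]); last first.
    by apply/seteqP; split => x; rewrite /eball/= subr0.
  by apply: open_comp; [move=> x _; exact: enorm_continuous|exact: open_lt].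
apply: (countable_basis_measurable _ _ (fun=> 0 : R) countable_basis_R3 _ _ _ _).1.
- by move=> x Ux; exact: open_nbhs_nbhs.
- by move=> x V /= /nbhs_singleton.
- by move=> x V W; exact: filterI.
- by move=> x V _ V0; apply: filterE => y /=; exact: nbhs_singleton V0.
Qed.

Lemma vnorm_component (w : R3 R -> R3 R) x : vnorm (component w) x = enorm (w x).
Proof.
by rewrite /vnorm /enorm /dot; congr Num.sqrt; apply: eq_bigr => j _; rewrite expr2.
Qed.

Section RestrictToBall.
Variables (w : R3 R -> R3 R) (rho M : R).
Hypothesis cw : forall i, continuous (component w i).
Hypothesis wM : (\int[leb3]_(x in eball 0%R rho) (enorm (w x) ^+ 2)%:E <= M%:E)%E.

(** The velocity has no compact support and M0 controls it only on this ball; truncating |u| there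
    gives an admissible factor for the nonlinear estimate. *)
Let q := (fun x => enorm (w x)) \_ (eball 0 rho).

Lemma bs_restrict_ball : bounded_support (box3 rho) q.
Proof.
have cn : continuous (fun x => enorm (w x)).
  have -> : (fun x => enorm (w x)) = vnorm (component w).
    by apply/funext => x; rewrite vnorm_component.
  exact: vnorm_continuous.
split.
- apply/(measurable_restrictT _ (measurable_eball rho)).
  by apply: (@measurable_funS _ _ _ _ setT) => //; exact: continuous_borel3.
- have /compact_bounded[B [_ HB]] : compact ((fun x => enorm (w x)) @` (box3 rho)).
    apply: continuous_compact; last exact: box3_compact.
    exact: continuous_subspaceT.
  exists (`|B| + 1) => x; rewrite /q patchE; case: ifPn => [/set_mem xr|_]; last first.
    by rewrite normr0 addr_ge0.
  apply: HB; first by rewrite (le_lt_trans (ler_norm B))// ltrDl.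
  exists x => //; apply: contrapT => /notin_box3.
  rewrite ltNge; apply/negP; rewrite negbK (le_trans (norm_le_enorm x))// ltW//.
  by move: xr; rewrite /eball/= subr0.
- move=> x /notin_box3 xr; rewrite /q patchE; case: ifPn => // /set_mem.
  rewrite /eball/= subr0 => xr'; exfalso; move: (lt_trans xr' xr).
  by rewrite ltNge norm_le_enorm.
Qed.

Lemma restrict_ball_ge0 x : 0 <= q x.
Proof. by rewrite /q patchE; case: ifPn => // _; exact: enorm_ge0. Qed.

Lemma int_restrict_ball : \int[leb3]_x (q x ^+ 2) <= M.
Proof.
have bq := bs_restrict_ball; rewrite -lee_fin.
rewrite -EFin_Rintegral//; last exact: bs_integrable (finite_measurable_box3 rho) (bsM bq bq).
apply: le_trans wM; rewrite [leRHS]integral_mkcond le_eqVlt; apply/orP; left; apply/eqP.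
apply: eq_integral => x _; rewrite /q !patchE.
by case: ifPn => // _; rewrite expr0n.
Qed.

End RestrictToBall.

Section Estimate.
(** A frozen time s: [w] is the vorticity, [T] its time derivative, [e] and [e'] are the values at s
    of eta and of its derivative, and [k] will be the multiplicity K2. *)
Variables (u w : R3 R -> R3 R) (T : 'I_3 -> R3 R -> R) (psi0 Psi : R3 R -> R).
Variables (e e' R0 r k C0 M0 lam : R).
Local Notation U := (component u).
Local Notation W := (component w).
Hypothesis R00 : 0 < R0.
Hypothesis r0 : 0 < r.
Hypothesis k0 : 0 <= k.
Hypothesis C00 : 0 < C0.
Hypothesis lam0 : 0 < lam.
Hypothesis sU : forall i, smooth_on setT (U i).
Hypothesis sW : forall i, smooth_on setT (W i).
Hypothesis spsi0 : smooth_on setT psi0.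
Hypothesis sPsi : smooth_on setT Psi.
Hypothesis psi01 : forall x, 0 <= psi0 x <= 1.
Hypothesis psi0_support : forall x, psi0 x != 0 -> enorm x < 2 * R0.
Hypothesis dpsi0 : forall l x, `|partial l psi0 x| <= C0 / R0 * rt8 (psi0 x) ^+ 7.
Hypothesis Psi_le : forall x, 0 <= Psi x <= k * psi0 x.
Hypothesis transport_le : forall x,
  `|transport U Psi x| <= vnorm U x * (k * (C0 / r * rt8 (psi0 x) ^+ 7)).
Hypothesis laplacian_le : forall x,
  `|laplacian Psi x| <= k * (C0 / r ^+ 2 * rt8 (psi0 x) ^+ 6).
Hypothesis e01 : 0 <= e <= 1.
Hypothesis e'_le : `|e'| <= C0 / r ^+ 2 * rt8 e ^+ 7.
Hypothesis divU : forall x, \sum_(i < 3) partial i (U i) x = 0.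
Hypothesis equation : forall j x, T j x =
  \sum_(l < 3) W l x * partial l (U j) x - \sum_(l < 3) U l x * partial l (W j) x
  + \sum_(l < 3) partial l (partial l (W j)) x.
Hypothesis cT : forall j, continuous (T j).
Hypothesis u_ball : (\int[leb3]_(x in eball 0%R (2 * R0)) (enorm (u x) ^+ 2)%:E <= M0%:E)%E.

Let L := 2 * R0.
Let fL := finite_measurable_box3 L.
Let p x := rt8 (psi0 x * e).
Let m := vnorm W.
Let q := (fun x => enorm (u x)) \_ (eball 0 (2 * R0)).
Let a := \int[leb3]_x (m x ^+ 2 * p x ^+ 4).
Let d := \int[leb3]_x (gnorm2 W x * p x ^+ 8).

Let psi0_ge0 x : 0 <= psi0 x. Proof. by case/andP: (psi01 x). Qed.
Let e_ge0 : 0 <= e. Proof. by case/andP: e01. Qed.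

Let psi0L x : L < `|x| -> psi0 x = 0.
Proof.
move=> xL; apply/eqP; apply: contraLR xL => /psi0_support x2.
by rewrite -leNgt (le_trans (norm_le_enorm x))// ltW.
Qed.

Let PsiL x : L < `|x| -> Psi x = 0.
Proof.
by move=> /psi0L p0; apply/eqP; rewrite eq_le; have := Psi_le x; rewrite p0 mulr0 andbC.
Qed.

Let CPsi := C1_smooth sPsi.
Let CW j := C1_smooth (sW j).
Let cU i : continuous (U i). Proof. by case: (C1_smooth (sU i)). Qed.

Let w2E x : \sum_(j < 3) W j x ^+ 2 = m x ^+ 2.
Proof. by rewrite vnormX2. Qed.

Let err x := 1 / 2 * m x ^+ 2 * (Psi x * e' + e * (laplacian Psi x + transport U Psi x)).

(** Only the transport term keeps the full power p^7. The terms with eta' and with the Laplacian are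
    lowered to p^4, the weight of [macro_E], and contribute one half each to the first
    coefficient. *)
Let err_le x : `|err x| <= k * C0 / r ^+ 2 * (m x ^+ 2 * p x ^+ 4)
  + k * C0 / (2 * r) * (m x ^+ 2 * p x ^+ 7 * q x).
Proof.
have pE : p x = rt8 (psi0 x) * rt8 e by exact: rt8M.
have A0 := rt8_ge0 (psi0 x); have E0 := rt8_ge0 e.
have [/andP[_ p1] /andP[_ e1]] := (psi01 x, e01).
have A1 := rt8_le1 (psi0 x) p1; have E1 := rt8_le1 e e1.
have CR : 0 <= C0 / r ^+ 2 by rewrite divr_ge0 ?exprn_ge0// ltW.
have CR1 : 0 <= C0 / r by rewrite divr_ge0// ltW.
have m2 : 0 <= m x ^+ 2 by exact: sqr_ge0.
have h1 : `|Psi x * e'| <= k * (C0 / r ^+ 2) * p x ^+ 4.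
  have /andP[P0 P1] := Psi_le x.
  rewrite normrM ger0_norm// pE exprMn.
  apply: (@le_trans _ _ ((k * rt8 (psi0 x) ^+ 4) * (C0 / r ^+ 2 * rt8 e ^+ 4))); last first.
    by apply: le_of_eq; ring.
  apply: ler_pM => //.
    by apply: (le_trans P1); rewrite ler_wpM2l// le_rt8X.
  apply: (le_trans e'_le); rewrite ler_wpM2l//.
  by rewrite ler_wiXn2l.
have h2 : `|e * laplacian Psi x| <= k * (C0 / r ^+ 2) * p x ^+ 4.
  rewrite normrM ger0_norm// pE exprMn.
  apply: (@le_trans _ _ (rt8 e ^+ 4 * (k * (C0 / r ^+ 2 * rt8 (psi0 x) ^+ 4)))); last first.
    by apply: le_of_eq; ring.
  apply: ler_pM => //; first exact: le_rt8X.
  by apply: (le_trans (laplacian_le x)); rewrite 2?ler_wpM2l// ler_wiXn2l.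
have h3 : `|e * transport U Psi x| <= k * (C0 / r) * (p x ^+ 7 * vnorm U x).
  rewrite normrM ger0_norm// pE exprMn.
  apply: (@le_trans _ _ (rt8 e ^+ 7 * (vnorm U x * (k * (C0 / r * rt8 (psi0 x) ^+ 7))))); last first.
    by apply: le_of_eq; ring.
  by apply: ler_pM => //; exact: le_rt8X.
(* The truncation of |u| is invisible because p vanishes off the ball of radius 2 R0. *)
have hq : p x ^+ 7 * vnorm U x = p x ^+ 7 * q x.
  have [p00|p00] := eqVneq (psi0 x) 0.
    by rewrite /p p00 mul0r rt8_0 expr0n !mul0r.
  rewrite vnorm_component /q patchE mem_set// /eball/= subr0.
  exact: psi0_support.
have hm : 0 <= 1 / 2 * m x ^+ 2 by rewrite mulr_ge0// divr_ge0.
rewrite /err normrM (ger0_norm hm).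
apply: (@le_trans _ _ (1 / 2 * m x ^+ 2 * (k * (C0 / r ^+ 2) * p x ^+ 4 +
   (k * (C0 / r ^+ 2) * p x ^+ 4 + k * (C0 / r) * (p x ^+ 7 * q x))))).
  apply: (ler_wpM2l hm); apply: (le_trans (ler_normD _ _)).
  apply: lerD; first exact: h1.
  rewrite [e * _]mulrDr; apply: (le_trans (ler_normD _ _)).
  by apply: lerD; [exact: h2|rewrite -hq].
by apply: le_of_eq; field; rewrite gt_eqF.
Qed.

Let bsPsi (f : R3 R -> R) : continuous f -> bounded_support (box3 L) (fun x => f x * Psi x).
Proof.
move=> cf; apply: continuous_bs3 => [x|x /PsiL ->]; last by rewrite mulr0.
by case: CPsi => cP _ _; exact: (cont_mul (cf x) (cP x)).
Qed.

Let cm2 (f : R3 R -> R) : continuous f -> continuous (fun x => 1 / 2 * m x ^+ 2 * f x).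
Proof.
move=> cf x; have cm : continuous m by apply: vnorm_continuous => j; case: (CW j).
exact: (cont_mul (cont_mul (cont_cst _ x) (cont_exp 2 (cm x))) (cf x)).
Qed.

Let ctransport : continuous (transport U Psi).
Proof.
move=> x; apply: cont_sum => i; case: CPsi => _ _ cP.
exact: (cont_mul (cU i x) (cP i x)).
Qed.

Let claplacian : continuous (laplacian Psi).
Proof.
move=> x; apply: cont_sum => i.
exact: (smooth_continuous (smooth_partial i (smooth_partial i sPsi)) x I).
Qed.

Let berr : bounded_support (box3 L) err.
Proof.
have c1 : continuous (fun x => Psi x * e' + e * (laplacian Psi x + transport U Psi x)).
  move=> x; case: CPsi => cP _ _.
  exact: (cont_add (cont_mul (cP x) (cont_cst e' x)) (cont_mul (cont_cst e x)
    (cont_add (claplacian x) (ctransport x)))).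
apply: continuous_bs3 => [|x xL]; first exact: cm2.
rewrite /err PsiL// mul0r add0r.
have := laplacian_le x; have := transport_le x; rewrite psi0L// rt8_0 !expr0n/= !mulr0.
by rewrite !normr_le0 => /eqP-> /eqP->; rewrite addr0 !mulr0.
Qed.

(** The time derivative of 1/2 |omega|^2 Psi eta. *)
Definition energy_rate x : R :=
  (\sum_(j < 3) T j x * W j x) * (Psi x * e) + 1 / 2 * m x ^+ 2 * (Psi x * e').

Let brate : bounded_support (box3 L) energy_rate.
Proof.
have b1 : bounded_support (box3 L) (fun x => (\sum_(j < 3) T j x * W j x) * Psi x).
  apply: bsPsi => x; apply: cont_sum => j; case: (CW j) => cWj _ _.
  exact: (cont_mul (cT j x) (cWj x)).
have b2 : bounded_support (box3 L) (fun x => (1 / 2 * m x ^+ 2 * 1) * Psi x).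
  by apply: bsPsi; apply: cm2 => x; exact: cont_cst.
have := bsD (bsZ e b1) (bsZ e' b2); congr bounded_support.
by apply/funext => x; rewrite /energy_rate; ring.
Qed.

Let bgrad : bounded_support (box3 L) (fun x => gnorm2 W x * (Psi x * e)).
Proof.
have := bsZ e (bsPsi _ (gnorm2_continuous _ CW)); congr bounded_support.
by apply/funext => x; ring.
Qed.

Lemma slice_estimate :
  `|\int[leb3]_x (stretching U W x * (Psi x * e)) - \int[leb3]_x energy_rate x
    - \int[leb3]_x (gnorm2 W x * (Psi x * e))| <=
  k * C0 / r ^+ 2 * a + k * C0 / (2 * r) *
    (Num.sqrt M0 * (lam^-1 ^+ 3 * a + lam * (32 * d + 8 * (C0 / R0) ^+ 2 * a))).
Proof.
have bst := bs_stretching U W Psi L sU sW sPsi PsiL.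
have E : \int[leb3]_x (stretching U W x * (Psi x * e)) =
    \int[leb3]_x (energy_rate x + gnorm2 W x * (Psi x * e) - err x).
  rewrite (_ : \int[leb3]_x _ = e * \int[leb3]_x (stretching U W x * Psi x)); last first.
    rewrite -(bs_intZ e fL bst); apply: eq_Rintegral => x _; ring.
  rewrite (int_stretching U W T Psi L sU sW sPsi PsiL divU equation).
  rewrite -(bs_intZ _ fL).
    apply: eq_Rintegral => x _; rewrite /energy_rate /err w2E; ring.
  pose P1 x := e' * (1 / 2 * m x ^+ 2 * 1 * Psi x).
  pose g1 x := (\sum_(j < 3) T j x * W j x) * Psi x.
  have b1 : bounded_support (box3 L) g1.
    apply: bsPsi => x; apply: cont_sum => j; case: (CW j) => cWj _ _.
    exact: (cont_mul (cT j x) (cWj x)).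
  have b2 : bounded_support (box3 L) (fun x => 1 / 2 * m x ^+ 2 * (laplacian Psi x + transport U Psi x)).
    apply: continuous_bs3 => [|x xL].
      by apply: cm2 => x; exact: (cont_add (claplacian x) (ctransport x)).
    have := laplacian_le x; have := transport_le x; rewrite psi0L// rt8_0 !expr0n/= !mulr0.
    by rewrite !normr_le0 => /eqP-> /eqP->; rewrite addr0 !mulr0.
  have := bsB (bsD b1 (bsPsi _ (gnorm2_continuous _ CW))) b2; congr bounded_support.
  by apply/funext => x; rewrite w2E.
rewrite E (bs_intB fL (bsD brate bgrad) berr) (bs_intD fL brate bgrad).
rewrite (_ : _ - _ = - \int[leb3]_x err x); last by ring.
rewrite normrN; apply: (le_trans (bs_int_norm fL berr)).
have cp : continuous p.
  move=> x; case: (C1_smooth spsi0) => c _ _.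
  exact: (cont_comp (cont_mul (c x) (cont_cst e x)) rt8_continuous).
have cm : continuous m by apply: vnorm_continuous => j; case: (CW j).
have bmp (h : nat) : bounded_support (box3 L) (fun x => m x ^+ 2 * p x ^+ h.+1).
  apply: continuous_bs3 => [x|x xL].
    exact: (cont_mul (cont_exp 2 (cm x)) (cont_exp h.+1 (cp x))).
  by rewrite /p psi0L// mul0r rt8_0 expr0n mulr0.
have bq : bounded_support (box3 L) q by exact: bs_restrict_ball.
have bJ : bounded_support (box3 L) (fun x => m x ^+ 2 * p x ^+ 7 * q x) := bsM (bmp 6) bq.
apply: (@le_trans _ _ (k * C0 / r ^+ 2 * a +
    k * C0 / (2 * r) * \int[leb3]_x (m x ^+ 2 * p x ^+ 7 * q x))).
  rewrite /a -(bs_intZ _ fL (bmp 3)) -(bs_intZ _ fL bJ).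
  rewrite -(bs_intD fL (bsZ _ (bmp 3)) (bsZ _ bJ)).
  apply: (bs_int_le fL (bs_norm berr)); last exact: err_le.
  exact: (bsD (bsZ _ (bmp 3)) (bsZ _ bJ)).
rewrite lerD2l ler_wpM2l//.
  by rewrite divr_ge0 ?mulr_ge0// ltW// mulr_gt0.
apply: (nonlinear_bound W psi0 e L (C0 / R0) CW (C1_smooth spsi0) psi01 psi0L e01 _ dpsi0) => //.
- by rewrite divr_ge0 ?ltW.
- exact: restrict_ball_ge0.
- exact: int_restrict_ball.
Qed.

End Estimate.
End FixedTime.

(** * Integration of the balance in time *)

Section TimeIntegration.
Context {R : realType}.
Local Notation mu := (@lebesgue_measure R).
Implicit Types (x : R3 R) (z : R3 R * R) (s : R) (i j l : 'I_3).

Variables (T t R0 r k C0 M0 lam : R) (u : R -> R3 R -> R3 R) (eta : R -> R).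
Variables (psi0 : R3 R -> R).
Hypothesis reg : regular_on T u.
Hypothesis tT : 2 * T / 3 < t < T.
Hypothesis R00 : 0 < R0.
Hypothesis r0 : 0 < r.
Hypothesis rT : r ^+ 2 <= T.
Hypothesis k0 : 0 <= k.
Hypothesis C00 : 0 < C0.
Hypothesis lam0 : 0 < lam.
Hypothesis eta_cutoff : temporal_cutoff C0 T eta.
Hypothesis spsi0 : smooth_on setT psi0.
Hypothesis psi01 : forall x, 0 <= psi0 x <= 1.
Hypothesis psi0_support : forall x, psi0 x != 0 -> enorm x < 2 * R0.
Hypothesis dpsi0 : forall l x, `|partial l psi0 x| <= C0 / R0 * rt8 (psi0 x) ^+ 7.
Hypothesis u_ball : forall s, 0 < s < T ->
  (\int[leb3]_(x in eball 0%R (2 * R0)) (enorm (u s x) ^+ 2)%:E <= M0%:E)%E.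

Let T0 : 0 < T. Proof. by apply: lt_le_trans rT; rewrite exprn_gt0. Qed.
Let t0 : 0 < t. Proof. by case/andP: tT => + _; apply: lt_trans; rewrite divr_gt0// mulr_gt0. Qed.
Let L := 2 * R0.
Let a0 : 0 < T / 3. Proof. by rewrite divr_gt0. Qed.
Let tlt : t < T. Proof. by case/andP: tT. Qed.

Local Notation U s := (component (u s)).
Local Notation W s := (component (vorticity u s)).

Lemma cutoff_outside x : L < `|x| -> psi0 x = 0.
Proof.
move=> xL; apply/eqP; apply: contraLR xL => /psi0_support x2.
by rewrite -leNgt (le_trans (norm_le_enorm x))// ltW.
Qed.

Lemma eta_bound s : 0 < s < T -> 0 <= eta s <= 1.
Proof. by case: eta_cutoff => _ + _ _ _; exact. Qed.

Lemma eta_early s : 0 < s < T / 3 -> eta s = 0.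
Proof. by case: eta_cutoff => _ _ + _ _; exact. Qed.

(** Since r^2 <= T, the time derivative of eta costs no more than the Laplacian of a spatial cut-off
    at scale r. *)
Lemma derive_eta_bound s : 0 < s < T ->
  `|derive1 eta s| <= C0 / r ^+ 2 * rt8 (eta s) ^+ 7.
Proof.
move=> sT; have [_ _ _ _ /(_ s sT)] := eta_cutoff.
have /andP[e0 _] := eta_bound s sT.
rewrite (_ : rho1 = 7%:R / 8)// powR_rt8// => /le_trans; apply.
rewrite ler_wpM2r ?exprn_ge0 ?rt8_ge0// ler_pM2l//.
by rewrite lef_pV2 ?posrE// exprn_gt0.
Qed.

Lemma derive_eta_early s : 0 < s < T / 3 -> derive1 eta s = 0.
Proof.
move=> /andP[s0 s3]; have sT : 0 < s < T by rewrite s0 (lt_le_trans s3)//; lra.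
have := derive_eta_bound s sT; rewrite eta_early ?s0//.
by rewrite rt8_0 expr0n mulr0 normr_le0 => /eqP.
Qed.

Lemma smooth_velocity s i : 0 < s < T -> smooth_on setT (U s i).
Proof. exact: (smooth_velocity_at T u reg s i). Qed.

Lemma smooth_vorticity s i : 0 < s < T -> smooth_on setT (W s i).
Proof.
exact: (smooth_space_slice T (vorticity_st u i) s (smooth_vorticity_st T u reg i)).
Qed.

Section SlabContinuity.
Variable z : R3 R * R.
Hypothesis zT : slab T z.

Lemma cont_space (f : R3 R -> R) : continuous f ->
  {for z, continuous (fun y : R3 R * R => f y.1)}.
Proof. by move=> cf; apply: (continuous_comp (@cvg_fst _ _ _ _ _)); exact: cf. Qed.

Lemma cont_eta : {for z, continuous (fun y : R3 R * R => eta y.2)}.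
Proof.
case: eta_cutoff => se _ _ _ _.
by apply: (continuous_comp (@cvg_snd _ _ _ _ _)); exact: (smooth_continuous se).
Qed.

Lemma cont_derive_eta : {for z, continuous (fun y : R3 R * R => derive1 eta y.2)}.
Proof.
case: eta_cutoff => se _ _ _ _.
have -> : (fun y : R3 R * R => derive1 eta y.2) = (fun y => ('D_1 eta) y.2).
  by apply/funext => y; rewrite derive1E.
apply: (@continuous_comp _ _ _ snd ('D_1 eta)); first exact: cvg_snd.
exact: (smooth_continuous (smooth_derive (1 : R) se) z.2 zT).
Qed.

Lemma cont_vort i : {for z, continuous (fun y : R3 R * R => W y.2 i y.1)}.
Proof. exact: (smooth_continuous (smooth_vorticity_st T u reg i)). Qed.

Lemma cont_partial_slice l (f : R3 R * R -> R) : smooth_on (slab T) f ->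
  {for z, continuous (fun y : R3 R * R => partial l (fun x => f (x, y.2)) y.1)}.
Proof.
move=> sf; have -> : (fun y : R3 R * R => partial l (fun x => f (x, y.2)) y.1) =
    'D_(unit_vec l, 0) f.
  by apply/funext => -[x s]; exact: (derive_space_slice f s (unit_vec l) x).
exact: (smooth_continuous (smooth_derive _ sf)).
Qed.

Lemma cont_partial_vel l i :
  {for z, continuous (fun y : R3 R * R => partial l (U y.2 i) y.1)}.
Proof. exact: (cont_partial_slice l _ (reg.1 i)). Qed.

Lemma cont_partial_vort l i :
  {for z, continuous (fun y : R3 R * R => partial l (W y.2 i) y.1)}.
Proof. exact: (cont_partial_slice l _ (smooth_vorticity_st T u reg i)). Qed.

Lemma cont_gnorm2 : {for z, continuous (fun y : R3 R * R => gnorm2 (W y.2) y.1)}.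
Proof.
apply: cont_sum => i; apply: cont_sum => j; apply: cont_exp; exact: cont_partial_vort.
Qed.

Lemma cont_vnorm : {for z, continuous (fun y : R3 R * R => vnorm (W y.2) y.1)}.
Proof.
have c : {for z, continuous (fun y : R3 R * R => \sum_(j < 3) W y.2 j y.1 ^+ 2)}.
  by apply: cont_sum => j; apply: cont_exp; exact: cont_vort.
exact: (cont_comp c (@sqrt_continuous R)).
Qed.

Lemma cont_stretching :
  {for z, continuous (fun y : R3 R * R => stretching (U y.2) (W y.2) y.1)}.
Proof.
apply: cont_sum => j; apply: (cont_mul _ (cont_vort j)); apply: cont_sum => l.
exact: (cont_mul (cont_vort l) (cont_partial_vel l j)).
Qed.

End SlabContinuity.

Let dvort j z := 'D_tdir (vorticity_st u j) z.

Section Integrable.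
Variables (f : R3 R * R -> R).
Hypothesis cf : forall z, slab T z -> {for z, continuous f}.
Hypothesis f_early : forall x s, 0 < s < T / 3 -> f (x, s) = 0.
Hypothesis f_far : forall x s, 0 < s < T -> L < `|x| -> f (x, s) = 0.

Lemma slab_integrable : mu.-integrable `]0, t[%classic
  (EFin \o (fun s => \int[leb3]_x f (x, s))).
Proof. exact: (spacetime_integrable T t (T / 3) L f a0 tlt cf f_early f_far). Qed.

End Integrable.

Section WithCutoff.
Variable Psi : R3 R -> R.
Hypothesis sPsi : smooth_on setT Psi.
Hypothesis PsiL : forall x, L < `|x| -> Psi x = 0.

Let cPsi z : {for z, continuous (fun y : R3 R * R => Psi y.1)}.
Proof. by apply: cont_space => x; exact: (smooth_continuous sPsi). Qed.

Lemma stretching_integrable : mu.-integrable `]0, t[%classic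
  (EFin \o (fun s => \int[leb3]_x (stretching (U s) (W s) x * (Psi x * eta s)))).
Proof.
apply: (slab_integrable (fun z => stretching (U z.2) (W z.2) z.1 * (Psi z.1 * eta z.2))).
- move=> z zT.
  exact: (cont_mul (cont_stretching z zT) (cont_mul (cPsi z) (cont_eta z zT))).
- by move=> x s /eta_early /= ->; rewrite !mulr0.
- by move=> x s _ /PsiL /= ->; rewrite mul0r mulr0.
Qed.

Lemma gradient_integrable : mu.-integrable `]0, t[%classic
  (EFin \o (fun s => \int[leb3]_x (gnorm2 (W s) x * (Psi x * eta s)))).
Proof.
apply: (slab_integrable (fun z => gnorm2 (W z.2) z.1 * (Psi z.1 * eta z.2))).
- move=> z zT.
  exact: (cont_mul (cont_gnorm2 z zT) (cont_mul (cPsi z) (cont_eta z zT))).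
- by move=> x s /eta_early /= ->; rewrite !mulr0.
- by move=> x s _ /PsiL /= ->; rewrite mul0r mulr0.
Qed.

Let rate z : R := (\sum_(j < 3) dvort j z * W z.2 j z.1) * (Psi z.1 * eta z.2)
  + 1 / 2 * vnorm (W z.2) z.1 ^+ 2 * (Psi z.1 * derive1 eta z.2).

Let crate z : slab T z -> {for z, continuous rate}.
Proof.
move=> zT.
have c1 : {for z, continuous (fun y : R3 R * R => \sum_(j < 3) dvort j y * W y.2 j y.1)}.
  apply: cont_sum => j; apply: (cont_mul _ (cont_vort z zT j)).
  exact: (smooth_continuous (smooth_derive tdir (smooth_vorticity_st T u reg j))).
exact: (cont_add (cont_mul c1 (cont_mul (cPsi z) (cont_eta z zT)))
  (cont_mul (cont_mul (cont_cst _ z) (cont_exp 2 (cont_vnorm z zT)))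
    (cont_mul (cPsi z) (cont_derive_eta z zT)))).
Qed.

Let rate_early x s : 0 < s < T / 3 -> rate (x, s) = 0.
Proof. by move=> sT; rewrite /rate /= eta_early// derive_eta_early// !mulr0 addr0. Qed.

Let rate_far x s : 0 < s < T -> L < `|x| -> rate (x, s) = 0.
Proof. by move=> _ /PsiL px; rewrite /rate /= px !mul0r !mulr0 addr0. Qed.

Lemma rate_integrable : mu.-integrable `]0, t[%classic
  (EFin \o (fun s => \int[leb3]_x energy_rate (vorticity u s) (fun j x => dvort j (x, s))
     Psi (eta s) (derive1 eta s) x)).
Proof. exact: (slab_integrable rate crate rate_early rate_far). Qed.

Let energy x s : R := 1 / 2 * (\sum_(j < 3) W s j x ^+ 2) * (Psi x * eta s).

Let energy_derive x s : 0 < s < T -> is_derive s 1 (energy x) (rate (x, s)).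
Proof.
move=> sT; have [se _ _ _ _] := eta_cutoff.
have de : is_derive s 1 eta (derive1 eta s) by rewrite derive1E; exact: (smooth_is_derive se).
have dW j : is_derive s 1 (fun s => W s j x) (dvort j (x, s)).
  have sv := smooth_vorticity_st T u reg j.
  split; first exact: (derivable_time_slice (vorticity_st u j) x s (smooth_derivable sv tdir (x, s) sT)).
  by rewrite -derive1E; exact: (derive1_time_slice (vorticity_st u j) x s).
have D := is_derive_mul _ _ _ _ _ _
  (is_derive_scale _ _ _ (1 / 2) _ (is_derive_bigsum _ _ _ _ _ (fun j => is_derive_square _ _ _ _ (dW j))))
  (is_derive_scale _ _ _ (Psi x) _ de).
apply: (is_derive_eq D); rewrite /rate /= vnormX2; congr (_ + _).
have -> : \sum_(i < 3) 2 * W s i x * dvort i (x, s) = 2 * \sum_(j < 3) dvort j (x, s) * W s j x.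
  by rewrite mulr_sumr; apply: eq_bigr => j _; ring.
by field.
Qed.

Lemma int_rate : \int[mu]_(s in `]0, t[) \int[leb3]_x
    energy_rate (vorticity u s) (fun j x => dvort j (x, s)) Psi (eta s) (derive1 eta s) x =
  \int[leb3]_x (1 / 2 * enorm (vorticity u t x) ^+ 2 * Psi x).
Proof.
rewrite (spacetime_fubini T t (T / 3) L rate a0 tlt crate rate_early rate_far).
apply: eq_Rintegral => x _.
have at1 : T / 4 < t by have T0' := T0; case/andP: tT => h _; lra.
have q0 : 0 < T / 4 by rewrite divr_gt0.
have q34 : T / 4 < T / 3 by have T0' := T0; lra.
have in_slab s : T / 4 <= s <= t -> 0 < s < T.
  by move=> /andP[h1 h2]; rewrite (lt_le_trans q0)// (le_lt_trans h2).
have cder s : T / 4 <= s <= t -> derivable (energy x) s 1 /\ {for s, continuous (derive1 (energy x))}.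
  move=> /in_slab sT; split; first by have [] := energy_derive x s sT.
  have cr : {for s, continuous (fun s => rate (x, s))}.
    apply: (continuous_comp (g := rate)); last exact: (crate (x, s) sT).
    by apply: continuous_pair; [exact: cvg_cst|exact: cvg_id].
  have near_eq : \forall s' \near s, rate (x, s') = derive1 (energy x) s'.
    have : nbhs s [set s' | 0 < s' < T].
      rewrite (_ : [set _ | _] = `]0, T[%classic); last first.
        by apply/seteqP; split => y /=; rewrite in_itv.
      by apply: open_nbhs_nbhs; split; [exact: interval_open|rewrite /= in_itv].
    by apply: filterS => s' sT'; rewrite derive1E; have [_ ->] := energy_derive x s' sT'.
  exact: (continuous_near_eq _ _ _ near_eq cr).
have E : \int[mu]_(s in `]0, t[) rate (x, s) = \int[mu]_(s in `[T / 4, t]) derive1 (energy x) s.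
  rewrite -Rintegral_itv_bndo_bndc; last first.
    apply: (@integrableS _ _ _ mu `[T / 4, t]%classic); [exact: measurable_itv..| |].
      by move=> s /=; rewrite !in_itv/= => /andP[-> /ltW].
    apply: continuous_compact_integrable; first exact: segment_compact.
    apply: continuous_in_subspaceT => s /set_mem/=; rewrite in_itv/= => /cder[_].
    exact.
  rewrite [LHS]Rintegral_mkcond [RHS]Rintegral_mkcond.
  apply: eq_Rintegral => s _; rewrite !patchE !mem_setE !in_itv/=.
  have [sq|qs] := ltP s (T / 4).
    rewrite andFb; case: ifPn => // /andP[s0 st]; apply: rate_early.
    by rewrite s0 (lt_trans sq).
  rewrite (lt_le_trans q0 qs) /=; case: ifPn => // st.
  have sT : 0 < s < T by rewrite (lt_le_trans q0 qs) (lt_trans st).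
  by rewrite derive1E; have [_ ->] := energy_derive x s sT.
rewrite E (Rintegral_FTC _ _ _ at1 cder) /energy.
have -> : eta (T / 4) = 0 by rewrite eta_early// q0 q34.
have -> : eta t = 1 by case: eta_cutoff => _ _ _ + _; apply.
by rewrite !mulr0 subr0 mulr1 -vnormX2 vnorm_component.
Qed.

Hypothesis Psi_le : forall x, 0 <= Psi x <= k * psi0 x.
Hypothesis transport_le : forall (v : 'I_3 -> R3 R -> R) x,
  `|transport v Psi x| <= vnorm v x * (k * (C0 / r * rt8 (psi0 x) ^+ 7)).
Hypothesis laplacian_le : forall x,
  `|laplacian Psi x| <= k * (C0 / r ^+ 2 * rt8 (psi0 x) ^+ 6).

(** The powers 4 and 8 of the eighth root give phi_0^(1/2) and phi_0: up to normalization these are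
    the time integrands of [macro_E] and of the dissipation in [macro_P]. *)
Definition energy_slice s : R :=
  \int[leb3]_x (vnorm (W s) x ^+ 2 * rt8 (psi0 x * eta s) ^+ 4).
Definition gradient_slice s : R :=
  \int[leb3]_x (gnorm2 (W s) x * rt8 (psi0 x * eta s) ^+ 8).

Let cphi z : slab T z -> {for z, continuous (fun y : R3 R * R => rt8 (psi0 y.1 * eta y.2))}.
Proof.
move=> zT; have c0 : {for z, continuous (fun y : R3 R * R => psi0 y.1)}.
  by apply: cont_space => x; exact: (smooth_continuous spsi0).
exact: (cont_comp (cont_mul c0 (cont_eta z zT)) rt8_continuous).
Qed.

Lemma energy_slice_integrable : mu.-integrable `]0, t[%classic (EFin \o energy_slice).
Proof.
apply: (slab_integrable (fun z => vnorm (W z.2) z.1 ^+ 2 * rt8 (psi0 z.1 * eta z.2) ^+ 4)).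
- move=> z zT.
  exact: (cont_mul (cont_exp 2 (cont_vnorm z zT)) (cont_exp 4 (cphi z zT))).
- by move=> x s /eta_early /= ->; rewrite mulr0 rt8_0 expr0n mulr0.
- by move=> x s _ /cutoff_outside /= ->; rewrite mul0r rt8_0 expr0n mulr0.
Qed.

Lemma gradient_slice_integrable : mu.-integrable `]0, t[%classic (EFin \o gradient_slice).
Proof.
apply: (slab_integrable (fun z => gnorm2 (W z.2) z.1 * rt8 (psi0 z.1 * eta z.2) ^+ 8)).
- by move=> z zT; exact: (cont_mul (cont_gnorm2 z zT) (cont_exp 8 (cphi z zT))).
- by move=> x s /eta_early /= ->; rewrite mulr0 rt8_0 expr0n mulr0.
- by move=> x s _ /cutoff_outside /= ->; rewrite mul0r rt8_0 expr0n mulr0.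
Qed.

Let kap1 := k * C0 / r ^+ 2.
Let kap2 := k * C0 / (2 * r) * Num.sqrt M0.
Let alpha := kap1 + kap2 * (lam^-1 ^+ 3 + lam * (8 * (C0 / R0) ^+ 2)).
Let beta := kap2 * lam * 32.

Let rate_slice s := \int[leb3]_x energy_rate (vorticity u s) (fun j x => dvort j (x, s))
     Psi (eta s) (derive1 eta s) x.
Let stretch_slice s := \int[leb3]_x (stretching (U s) (W s) x * (Psi x * eta s)).
Let grad_slice s := \int[leb3]_x (gnorm2 (W s) x * (Psi x * eta s)).

Let slice_le s : 0 < s < T ->
  `|stretch_slice s - rate_slice s - grad_slice s| <=
  alpha * energy_slice s + beta * gradient_slice s.
Proof.
move=> sT.
have H := @slice_estimate R (u s) (vorticity u s) (fun j x => dvort j (x, s)) psi0 Psi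
  (eta s) (derive1 eta s) R0 r k C0 M0 lam R00 r0 k0 C00 lam0
  (fun i => smooth_velocity s i sT) (fun i => smooth_vorticity s i sT)
  spsi0 sPsi psi01 psi0_support dpsi0 Psi_le (transport_le (U s)) laplacian_le
  (eta_bound s sT) (derive_eta_bound s sT).
apply: (le_trans (H _ _ _ _)).
- by move=> x; have [_ [q [_ NS]]] := reg; exact: (NS s x sT).1.
- by move=> j x; exact: (vorticity_equation T u reg).
- move=> j x.
  apply: (@continuous_comp _ _ _ (fun y : R3 R => (y, s)) (dvort j)).
    by apply: continuous_pair; [exact: cvg_id|exact: cvg_cst].
  exact: (smooth_continuous (smooth_derive tdir (smooth_vorticity_st T u reg j)) (x, s) sT).
- exact: u_ball.
- by apply: le_of_eq; rewrite /alpha /beta /kap1 /kap2 /energy_slice /gradient_slice; ring.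
Qed.

Lemma balance_estimate :
  `|\int[mu]_(s in `]0, t[) \int[leb3]_x (stretching (U s) (W s) x * (Psi x * eta s))
    - \int[leb3]_x (1 / 2 * enorm (vorticity u t x) ^+ 2 * Psi x)
    - \int[mu]_(s in `]0, t[) \int[leb3]_x (gnorm2 (W s) x * (Psi x * eta s))| <=
  (k * C0 / r ^+ 2 + k * C0 / (2 * r) * Num.sqrt M0 *
     (lam^-1 ^+ 3 + lam * (8 * (C0 / R0) ^+ 2))) * \int[mu]_(s in `]0, t[) energy_slice s
  + k * C0 / (2 * r) * Num.sqrt M0 * lam * 32 * \int[mu]_(s in `]0, t[) gradient_slice s.
Proof.
have mD : measurable (`]0, t[%classic : set (measurableTypeR R)) by exact: measurable_itv.
have iv : mu.-integrable `]0, t[%classic (EFin \o stretch_slice) := stretching_integrable.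
have ir : mu.-integrable `]0, t[%classic (EFin \o rate_slice) := rate_integrable.
have ig : mu.-integrable `]0, t[%classic (EFin \o grad_slice) := gradient_integrable.
have ie := energy_slice_integrable; have id := gradient_slice_integrable.
rewrite -int_rate -/alpha -/beta.
have ivr : mu.-integrable `]0, t[%classic (EFin \o (fun s => stretch_slice s - rate_slice s)).
  exact: (integrableB mD iv ir).
have ivrg : mu.-integrable `]0, t[%classic
    (EFin \o (fun s => stretch_slice s - rate_slice s - grad_slice s)).
  exact: (integrableB mD ivr ig).
have iae : mu.-integrable `]0, t[%classic (EFin \o (fun s => alpha * energy_slice s)).
  exact: (integrableZl mD alpha ie).
have ibd : mu.-integrable `]0, t[%classic (EFin \o (fun s => beta * gradient_slice s)).
  exact: (integrableZl mD beta id).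
have iab : mu.-integrable `]0, t[%classic
    (EFin \o (fun s => alpha * energy_slice s + beta * gradient_slice s)).
  exact: (integrableD mD iae ibd).
rewrite -(RintegralZl alpha mD ie) -(RintegralZl beta mD id) -(RintegralD mD iae ibd).
rewrite -(RintegralB mD iv ir) -(RintegralB mD ivr ig).
apply: (le_trans (le_normr_Rintegral mD ivrg)).
apply: le_Rintegral => //; first exact: (integrable_norm ivrg).
move=> s; rewrite /= in_itv/= => /andP[s0 st].
by apply: slice_le; rewrite s0 (lt_trans st).
Qed.

End WithCutoff.
End TimeIntegration.

(** * The ensemble average *)

Section ScaleArithmetic.
Context {R : realType}.

(* The constants 19 and 8 collect the terms of the error: 2 + 1 + 16 from the
   linear, the interpolated and the dissipative parts, 8 from the cut-off in
   the Sobolev inequality. *)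
Lemma error_absorbed (k C0 C M0 R0 r sg A Ia Id m : R) :
  0 <= k -> 0 < C0 -> 1 < C -> 2 * k * C0 * (19 + 8 * C0 ^+ 2) <= C ->
  0 < R0 -> 0 < r -> r <= R0 -> 0 <= sg -> 0 < A ->
  Num.sqrt M0 <= m -> Num.sqrt R0 <= m ->
  C * m * Num.sqrt sg <= r -> Ia = 2 * sg ^+ 2 * A -> 0 <= Id <= A ->
  (k * C0 / r ^+ 2 + k * C0 / (2 * r) * Num.sqrt M0 *
     ((r / (C * m))^-1 ^+ 3 + r / (C * m) * (8 * (C0 / R0) ^+ 2))) * Ia
  + k * C0 / (2 * r) * Num.sqrt M0 * (r / (C * m)) * 32 * Id <= A / 2.
Proof.
move=> k0 C00 C1 CK R00 r0 rR sg0 A0 mM mR Cr -> /andP[Id0 IdA].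
have C0' : 0 < C by apply: lt_trans C1.
have C00' := ltW C00; have R00' := ltW R00; have r0' := ltW r0; have C0'' := ltW C0'.
have A0' := ltW A0.
have m0 : 0 < m by apply: lt_le_trans mR; rewrite sqrtr_gt0.
have m0' := ltW m0.
have Cm0 : 0 < C * m by exact: mulr_gt0.
have [lam lE] : exists lam, lam = r / (C * m) by exists (r / (C * m)).
rewrite -lE; have l0 : 0 < lam by rewrite lE divr_gt0.
have l0' := ltW l0.
have rE : r = lam * (C * m) by rewrite lE divfK// gt_eqF.
(* The lower bound on r in terms of lam. It yields sg^2 <= lam^4, which pays for the factor lam^-3
   of the interpolated part. *)
have sl : Num.sqrt sg <= lam by rewrite lE ler_pdivlMr// mulrC.
have sl2 : sg <= lam ^+ 2.
  by rewrite -[leLHS](sqr_sqrtr sg0) ler_sqr ?nnegrE ?sqrtr_ge0.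
have sl4 : sg ^+ 2 <= lam ^+ 4.
  by rewrite (_ : lam ^+ 4 = (lam ^+ 2) ^+ 2) ?ler_sqr ?nnegrE ?sqr_ge0//; ring.
have Mm : Num.sqrt M0 / (C * m) <= C^-1.
  by rewrite invfM mulrA mulrAC -[leRHS]mul1r ler_pM2r ?invr_gt0// ler_pdivrMr// mul1r.
have R0m : R0 <= m ^+ 2.
  by rewrite -[leLHS](sqr_sqrtr R00') ler_sqr ?nnegrE ?sqrtr_ge0.
(* Here R0^(1/2) in the maximum enters: squaring gives C^2 m^2 sg <= r^2, and m^2 >= R0 >= r lets
   one factor r cancel. *)
have rsg : C ^+ 2 * sg <= r.
  rewrite -(ler_pM2r r0).
  apply: (@le_trans _ _ (C ^+ 2 * m ^+ 2 * sg)).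
    rewrite mulrAC ler_wpM2r// ler_wpM2l ?sqr_ge0//; exact: le_trans rR R0m.
  rewrite -expr2 -exprMn -[X in _ * X](sqr_sqrtr sg0) -exprMn.
  by rewrite ler_sqr ?nnegrE ?mulr_ge0 ?sqrtr_ge0.
have C4 : C ^- 4 <= C^-1.
  by rewrite lef_pV2 ?posrE ?exprn_gt0// -[leLHS]expr1 ler_weXn2l// ltW.
have Ci1 : C^-1 <= 1 by rewrite invf_le1// ltW.
have srr : sg ^+ 2 / r ^+ 2 <= C ^- 4.
  rewrite ler_pdivrMr ?exprn_gt0// ler_pdivlMl ?exprn_gt0//.
  rewrite (_ : C ^+ 4 * sg ^+ 2 = (C ^+ 2 * sg) ^+ 2); last by ring.
  by rewrite ler_sqr ?nnegrE ?mulr_ge0 ?sqr_ge0.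
have srR : sg ^+ 2 / R0 ^+ 2 <= C ^- 4.
  apply: le_trans srr; rewrite ler_wpM2l ?sqr_ge0//.
  by rewrite lef_pV2 ?posrE ?exprn_gt0// ler_sqr ?nnegrE.
have M00 : 0 <= Num.sqrt M0 by exact: sqrtr_ge0.
have kC0 : 0 <= k * C0 by rewrite mulr_ge0.
have t1 : k * C0 / r ^+ 2 * (2 * sg ^+ 2 * A) <= k * C0 * A * C^-1 * 2.
  rewrite (_ : _ * _ = k * C0 * A * 2 * (sg ^+ 2 / r ^+ 2)); last by ring.
  rewrite [leRHS]mulrAC ler_wpM2l ?(le_trans srr)//.
  by rewrite !mulr_ge0.
have Mlr : Num.sqrt M0 / r * lam <= C^-1.
  rewrite (_ : _ * _ = Num.sqrt M0 / (C * m))//.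
  by rewrite lE; field; rewrite !gt_eqF.
have Mlr0 : 0 <= Num.sqrt M0 / r * lam := mulr_ge0 (divr_ge0 M00 r0') l0'.
have l3 : lam^-1 ^+ 3 * sg ^+ 2 <= lam.
  apply: (@le_trans _ _ (lam^-1 ^+ 3 * lam ^+ 4)).
    by rewrite ler_wpM2l// exprn_ge0// invr_ge0.
  by apply: le_of_eq; rewrite exprVn; field; rewrite gt_eqF.
have t2 : k * C0 / (2 * r) * Num.sqrt M0 * lam^-1 ^+ 3 * (2 * sg ^+ 2 * A) <=
    k * C0 * A * C^-1.
  rewrite (_ : _ * _ = k * C0 * A * (Num.sqrt M0 / r * (lam^-1 ^+ 3 * sg ^+ 2)));
    last by field; rewrite !gt_eqF.
  rewrite ler_wpM2l ?mulr_ge0//; apply: le_trans Mlr.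
  by rewrite ler_wpM2l// divr_ge0.
have t3 : k * C0 / (2 * r) * Num.sqrt M0 * (lam * (8 * (C0 / R0) ^+ 2)) *
    (2 * sg ^+ 2 * A) <= k * C0 * A * C^-1 * (8 * C0 ^+ 2).
  rewrite (_ : _ * _ = k * C0 * A * (8 * C0 ^+ 2) *
      (Num.sqrt M0 / r * lam * (sg ^+ 2 / R0 ^+ 2)));
    last by field; rewrite !gt_eqF.
  rewrite [leRHS]mulrAC ler_wpM2l ?mulr_ge0 ?exprn_ge0//.
  rewrite -[leRHS]mulr1; apply: ler_pM => //.
    by rewrite divr_ge0 ?sqr_ge0.
  by rewrite (le_trans srR)// (le_trans C4).
have t4 : k * C0 / (2 * r) * Num.sqrt M0 * lam * 32 * Id <= k * C0 * A * C^-1 * 16.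
  apply: (@le_trans _ _ (k * C0 * 16 * ((Num.sqrt M0 / r * lam) * Id))).
    by apply: le_of_eq; field; rewrite gt_eqF.
  apply: (@le_trans _ _ (k * C0 * 16 * (C^-1 * A))); last by apply: le_of_eq; ring.
  by rewrite ler_wpM2l ?mulr_ge0// ler_pM.
apply: (@le_trans _ _ (k * C0 * A * C^-1 * (19 + 8 * C0 ^+ 2))).
  apply: le_trans (le_trans (lerD (lerD (lerD t1 t2) t3) t4) _).
    by apply: le_of_eq; ring.
  by apply: le_of_eq; ring.
apply: (@le_trans _ _ ((2 * k * C0 * (19 + 8 * C0 ^+ 2)) * (A / 2 / C))).
  by apply: le_of_eq; field; rewrite gt_eqF.
by rewrite mulrA ler_pdivrMr// mulrC ler_wpM2l// divr_ge0.
Qed.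

(** The error bound leaves A / 2 <= V <= (k + 1) A. Replacing N r^3 by R0^3 is free in the upper
    bound and costs a factor K1 in the lower one, whence the conditions k + 1 <= C and 2 K1 <= C. *)
Lemma ensemble_bounds (K1 k N t r R0 C0 C M0 Ia Id Ae Af Gf V P E : R) :
  0 < K1 -> 0 <= k -> 0 < t -> 0 < r -> r <= R0 -> 0 < C0 -> 1 < C ->
  2 * k * C0 * (19 + 8 * C0 ^+ 2) <= C -> 2 * K1 <= C -> k + 1 <= C ->
  (R0 / r) ^+ 3 <= N -> N <= K1 * (R0 / r) ^+ 3 ->
  0 <= Ia -> 0 <= Id -> 0 <= Ae ->
  Ae <= Af -> Af <= k * Ae -> Id <= Gf -> Gf <= k * Id ->
  P = (R0 ^+ 3 * t)^-1 * (Id + Ae) -> E = (R0 ^+ 3 * t)^-1 * (Ia / 2) ->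
  (forall lam, 0 < lam -> `|V - Af - Gf| <=
    (k * C0 / r ^+ 2 + k * C0 / (2 * r) * Num.sqrt M0 *
       (lam^-1 ^+ 3 + lam * (8 * (C0 / R0) ^+ 2))) * Ia
    + k * C0 / (2 * r) * Num.sqrt M0 * lam * 32 * Id) ->
  0 < P ->
  C * Num.max (Num.sqrt M0) (Num.sqrt R0) * Num.sqrt (Num.sqrt (E / P)) <= r ->
  C^-1 * P <= (N * r ^+ 3 * t)^-1 * V <= C * P.
Proof.
move=> K10 k0 t0 r0 rR C00 C1 CK CK1 CK2 n1 n2 Ia0 Id0 Ae0 F1 F2 G1 G2 PE EE bal P0 Cr.
have R00 : 0 < R0 by exact: lt_le_trans r0 rR.
have C0' : 0 < C by apply: lt_trans C1.
set A := Id + Ae in PE *.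
have R30 : 0 < R0 ^+ 3 by rewrite exprn_gt0.
have Rt : 0 < R0 ^+ 3 * t by rewrite mulr_gt0.
have A0 : 0 < A by move: P0; rewrite PE pmulr_rgt0// invr_gt0.
have A0' := ltW A0.
set sg := Num.sqrt (E / P) in Cr.
have sg0 : 0 <= sg by exact: sqrtr_ge0.
have IaE : Ia = 2 * sg ^+ 2 * A.
  have E0 : 0 <= E by rewrite EE mulr_ge0 ?divr_ge0// invr_ge0 ltW.
  rewrite /sg sqr_sqrtr; last by rewrite divr_ge0// ltW.
  by rewrite EE PE; field; rewrite !gt_eqF.
set m := Num.max _ _ in Cr.
have mM : Num.sqrt M0 <= m by rewrite le_max lexx.
have mR : Num.sqrt R0 <= m by rewrite le_max lexx orbT.
have m0 : 0 < m by apply: lt_le_trans mR; rewrite sqrtr_gt0.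
have lam0 : 0 < r / (C * m) by rewrite divr_gt0// mulr_gt0.
have IdA : 0 <= Id <= A by rewrite Id0 lerDl.
have VA : `|V - Af - Gf| <= A / 2.
  apply: (le_trans (bal _ lam0)).
  exact: (error_absorbed k C0 C M0 R0 r sg A Ia Id m).
have [V1 V2] : A / 2 <= V /\ V <= (k + 1) * A.
  move: VA; rewrite ler_norml => /andP[VA1 VA2].
  have AE : A = Id + Ae by [].
  have kA : (k + 1) * A = k * Id + k * Ae + A by rewrite AE; ring.
  by split; lra.
have r30 : 0 < r ^+ 3 by rewrite exprn_gt0.
have nr1 : R0 ^+ 3 <= N * r ^+ 3 by rewrite -ler_pdivrMr// -expr_div_n.
have nr2 : N * r ^+ 3 <= K1 * R0 ^+ 3 by rewrite -ler_pdivlMr// -mulrA -expr_div_n.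
have nr0 : 0 < N * r ^+ 3 by apply: lt_le_trans nr1.
have inv_le (a b : R) : 0 < a -> a <= b -> b^-1 <= a^-1.
  by move=> a0 ab; rewrite lef_pV2 ?posrE// (lt_le_trans a0).
have kap1 : (N * r ^+ 3 * t)^-1 <= (R0 ^+ 3 * t)^-1.
  by apply: inv_le => //; rewrite ler_pM2r.
have kap2 : (K1 * R0 ^+ 3 * t)^-1 <= (N * r ^+ 3 * t)^-1.
  by apply: inv_le; [exact: mulr_gt0|rewrite ler_pM2r].
have kap0 : 0 <= (N * r ^+ 3 * t)^-1 by rewrite invr_ge0 mulr_ge0// ltW.
have kap20 : 0 <= (K1 * R0 ^+ 3 * t)^-1 by rewrite invr_ge0 !mulr_ge0// ltW.
have A2 : 0 <= A / 2 by rewrite divr_ge0.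
apply/andP; split.
- apply: (@le_trans _ _ ((K1 * R0 ^+ 3 * t)^-1 * (A / 2))); last exact: ler_pM.
  apply: (@le_trans _ _ ((2 * K1)^-1 * P)); last first.
    by apply: le_of_eq; rewrite PE; field; rewrite !gt_eqF.
  by rewrite ler_wpM2r ?(ltW P0)//; apply: inv_le => //; exact: mulr_gt0.
- apply: (@le_trans _ _ ((R0 ^+ 3 * t)^-1 * ((k + 1) * A))).
    by apply: ler_pM => //; exact: le_trans V1.
  apply: (@le_trans _ _ ((k + 1) * P)); first by apply: le_of_eq; rewrite PE; ring.
  by rewrite ler_wpM2r// ltW.
Qed.

End ScaleArithmetic.

Lemma Rintegral_sum {d} {T : measurableType d} {R : realType}
    {mu : {measure set T -> \bar R}} {D : set T} n (F : 'I_n -> T -> R) :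
  measurable D -> (forall i, mu.-integrable D (EFin \o F i)) ->
  \int[mu]_(x in D) (\sum_(i < n) F i x) = \sum_(i < n) \int[mu]_(x in D) F i x.
Proof.
move=> mD iF; have : forall s : seq 'I_n,
    mu.-integrable D (EFin \o (fun x => \sum_(i <- s) F i x)) /\
    \int[mu]_(x in D) (\sum_(i <- s) F i x) = \sum_(i <- s) \int[mu]_(x in D) F i x.
  elim=> [|i s [IH1 IH2]].
    have -> : (fun x => \sum_(i <- [::]) F i x) = fun=> 0.
      by apply/funext => x; rewrite big_nil.
    split; first exact: integrable0.
    by rewrite big_nil Rintegral_cst// mul0r.
  have -> : (fun x => \sum_(j <- i :: s) F j x) = fun x => F i x + \sum_(j <- s) F j x.
    by apply/funext => x; rewrite big_cons.
  split; first exact: (integrableD mD (iF i) IH1).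
  by rewrite big_cons -IH2 RintegralD.
by move=> /(_ (index_enum 'I_n))[].
Qed.

(** * The sum of the cut-offs of a cover and its enstrophy balance *)

Section Ensemble.
Context {R : realType}.
Local Notation mu := (@lebesgue_measure R).
Variables (C0 R0 r T t : R) (K1 K2 n : nat) (c : 'I_n -> R3 R).
Variables (psi : R3 R -> R -> R3 R -> R) (u : R -> R3 R -> R3 R) (eta : R -> R).
Hypothesis C00 : 0 < C0.
Hypothesis cover : is_cover K1 K2 R0 r c.
Hypothesis macro : spatial_cutoff C0 0 R0 (psi 0 R0).
Hypothesis cutoffs : forall i, cover_cutoff C0 R0 (psi 0 R0) (c i) r (psi (c i) r).
Hypothesis reg : regular_on T u.
Hypothesis tT : 2 * T / 3 < t < T.
Hypothesis RT : R0 ^+ 2 <= T.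
Hypothesis eta_cutoff : temporal_cutoff C0 T eta.
Implicit Types (x : R3 R) (i : 'I_n) (s : R).

Local Notation psi0 := (psi 0 R0).
Local Notation Psi i := (psi (c i) r).
Local Notation W s := (component (vorticity u s)).
Local Notation U s := (component (u s)).

Let r0 : 0 < r. Proof. by case: cover => /andP[]. Qed.
Let rR : r <= R0. Proof. by case: cover => /andP[]. Qed.
Let R00 : 0 < R0. Proof. exact: lt_le_trans r0 rR. Qed.
Let rT : r ^+ 2 <= T.
Proof. by apply: le_trans RT; rewrite ler_sqr ?nnegrE//; exact: ltW. Qed.

Definition total_cutoff x : R := \sum_(i < n) Psi i x.

Let psi0_smooth : smooth_on setT psi0. Proof. by case: macro => -[]. Qed.
Let Psi_smooth i : smooth_on setT (Psi i).
Proof. exact: (cutoff_smooth C0 R0 r n c psi cutoffs). Qed.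

Let psi0_ge0 x : 0 <= psi0 x.
Proof. by case/andP: (macro_bound C0 R0 psi macro x). Qed.

Let Psi_ge0 i x : 0 <= Psi i x.
Proof. exact: (cutoff_ge0 C0 R0 r n c psi cutoffs). Qed.

Lemma total_smooth : smooth_on setT total_cutoff.
Proof. exact: (smooth_sum n _ openT Psi_smooth). Qed.

Lemma member_bounds i : cutoff_bounds C0 r (Psi i).
Proof.
have [H1 H2 _] := cutoffs i.
by have [/H1[]|/H2[]] := pselect (eball (c i) r `<=` eball 0 R0).
Qed.

Lemma powR_rho2 (y : R) : 0 <= y -> y `^ rho2 = rt8 y ^+ 7.
Proof. by move=> y0; rewrite -powR_rt8. Qed.

Lemma powR_2rho2 (y : R) : 0 <= y -> y `^ (2 * rho2 - 1) = rt8 y ^+ 6.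
Proof. by move=> y0; rewrite -powR_rt8//; congr powR; rewrite /rho2; field. Qed.

Lemma le_rt8_mono (k : nat) (a b : R) : 0 <= a -> a <= b -> rt8 a ^+ k <= rt8 b ^+ k.
Proof. by move=> a0 ab; rewrite lerXn2r ?nnegrE ?rt8_ge0// /rt8 !ler_wsqrtr. Qed.

Lemma partial_le_grad (f : R3 R -> R) l x : `|partial l f x| <= enorm (grad f x).
Proof.
rewrite -sqrtr_sqr ler_wsqrtr// /dot (bigD1 l)//= /grad crd_vec expr2 lerDl.
by apply: sumr_ge0 => j _; rewrite -expr2 sqr_ge0.
Qed.

Lemma dmacro l x : `|partial l psi0 x| <= C0 / R0 * rt8 (psi0 x) ^+ 7.
Proof.
apply: (le_trans (partial_le_grad _ _ _)).
by case: macro => _ _ [_ /(_ x) + _]; rewrite powR_rho2.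
Qed.

Lemma total_le x : 0 <= total_cutoff x <= K2%:R * psi0 x.
Proof.
rewrite /total_cutoff sumr_ge0//=.
apply: (sum_cutoff_le C0 R0 r K1 K2 n c psi cover macro cutoffs _ 0 _ x) => // i.
exact: (cutoff_le C0 R0 r n c psi cutoffs).
Qed.

(** The cut-off bound makes the gradient of a member vanish wherever the member does, so at most K2
    terms contribute at each point, and monotonicity of the power replaces Psi_i by psi_0. *)
Lemma total_transport (v : 'I_3 -> R3 R -> R) x : `|transport v total_cutoff x| <=
  vnorm v x * (K2%:R * (C0 / r * rt8 (psi0 x) ^+ 7)).
Proof.
have E : transport v total_cutoff x = \sum_(i < n) transport v (Psi i) x.
  rewrite /transport exchange_big /=; apply: eq_bigr => l _; rewrite -mulr_sumr.
  congr (_ * _); apply: is_derive_val; apply: is_derive_bigsum => i.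
  exact: (partial_is_derive l x (Psi_smooth i)).
rewrite E; apply: (le_trans (ler_norm_sum _ _ _)).
have G i : `|transport v (Psi i) x| <= vnorm v x * enorm (grad (Psi i) x).
  rewrite -sqrtr_sqr /vnorm /enorm -sqrtrM; last first.
    by rewrite sumr_ge0// => j _; exact: sqr_ge0.
  rewrite ler_wsqrtr//; apply: (le_trans (sum3_cauchy_schwarz _ _)).
  by rewrite ler_wpM2l ?sumr_ge0// => [j _|]; [exact: sqr_ge0|rewrite /dot; apply: ler_sum => j _; rewrite /grad crd_vec expr2].
apply: (le_trans (ler_sum _ (fun i _ => G i))); rewrite -mulr_sumr.
rewrite ler_wpM2l ?vnorm_ge0//.
have B i : enorm (grad (Psi i) x) <= C0 / r * rt8 (Psi i x) ^+ 7.
  by have [_ /(_ x) + _] := member_bounds i; rewrite powR_rho2.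
have Cr0 : 0 <= C0 / r by rewrite divr_ge0// ltW.
apply: (sum_cutoff_le C0 R0 r K1 K2 n c psi cover macro cutoffs _ 0 _ x).
- by rewrite mulr_ge0// exprn_ge0// rt8_ge0.
- move=> i p0; apply/eqP; rewrite eq_le enorm_ge0 andbT.
  by apply: (le_trans (B i)); rewrite p0 rt8_0 expr0n mulr0.
- move=> i; apply: (le_trans (B i)); rewrite ler_wpM2l//; apply: le_rt8_mono => //.
  exact: (cutoff_le C0 R0 r n c psi cutoffs).
Qed.

Lemma total_laplacian x : `|laplacian total_cutoff x| <=
  K2%:R * (C0 / r ^+ 2 * rt8 (psi0 x) ^+ 6).
Proof.
have E1 l : partial l total_cutoff = fun y => \sum_(i < n) partial l (Psi i) y.
  apply/funext => y; apply: is_derive_val; apply: is_derive_bigsum => i.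
  exact: (partial_is_derive l y (Psi_smooth i)).
have E : laplacian total_cutoff x = \sum_(i < n) laplacian (Psi i) x.
  rewrite /laplacian exchange_big /=; apply: eq_bigr => l _; rewrite E1.
  apply: is_derive_val; apply: is_derive_bigsum => i.
  exact: (partial_is_derive l x (smooth_partial l (Psi_smooth i))).
rewrite E; apply: (le_trans (ler_norm_sum _ _ _)).
have B i : `|laplacian (Psi i) x| <= C0 / r ^+ 2 * rt8 (Psi i x) ^+ 6.
  by have [_ _ /(_ x)] := member_bounds i; rewrite powR_2rho2.
have Cr0 : 0 <= C0 / r ^+ 2 by rewrite divr_ge0 ?exprn_ge0// ltW.
apply: (sum_cutoff_le C0 R0 r K1 K2 n c psi cover macro cutoffs _ 0 _ x).
- by rewrite mulr_ge0// exprn_ge0// rt8_ge0.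
- move=> i p0; apply/eqP; rewrite -normr_le0 normr_id.
  by apply: (le_trans (B i)); rewrite p0 rt8_0 expr0n mulr0.
- move=> i; apply: (le_trans (B i)); rewrite ler_wpM2l//; apply: le_rt8_mono => //.
  exact: (cutoff_le C0 R0 r n c psi cutoffs).
Qed.

Let outside x : 2 * R0 < `|x| -> psi0 x = 0.
Proof. exact: (cutoff_outside R0 psi0 (macro_support C0 R0 psi macro)). Qed.

Let Psi_outside i x : 2 * R0 < `|x| -> Psi i x = 0.
Proof.
move=> /outside p0; apply/eqP; rewrite eq_le Psi_ge0 andbT -p0.
exact: (cutoff_le C0 R0 r n c psi cutoffs).
Qed.

Let total_outside x : 2 * R0 < `|x| -> total_cutoff x = 0.
Proof. by move=> xL; rewrite /total_cutoff big1// => i _; exact: Psi_outside. Qed.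

Lemma dot_stretching s x (q : R) :
  dot (advect (vorticity u s x) (u s) x) (q *: vorticity u s x) =
  stretching (U s) (W s) x * q.
Proof.
rewrite /dot /stretching mulr_suml; apply: eq_bigr => j _.
by rewrite crdZ /advect crd_vec mulrCA mulrC -mulrA.
Qed.

Lemma vst_stretching i : vst u eta (Psi i) r t = t^-1 * ((r ^+ 3)^-1 *
  \int[mu]_(s in `]0, t[) \int[leb3]_x (stretching (U s) (W s) x * (Psi i x * eta s))).
Proof.
have mD : measurable (`]0, t[%classic : set (measurableTypeR R)) by exact: measurable_itv.
have st := stretching_integrable T t R0 r C0 u eta reg tT r0 rT eta_cutoff
  (Psi i) (Psi_smooth i) (Psi_outside i).
rewrite /vst -(RintegralZl _ mD st).
congr (_ * _); apply: eq_Rintegral => s _; congr (_ * _).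
by apply: eq_Rintegral => x _; exact: dot_stretching.
Qed.

Let in_slab s : `]0, t[%classic s -> 0 < s < T.
Proof.
by rewrite /= in_itv/= => /andP[-> st]; case/andP: tT => _; exact: lt_trans.
Qed.

Let t_slab : 0 < t < T.
Proof.
have T0 : 0 < T by apply: lt_le_trans rT; rewrite exprn_gt0.
by case/andP: tT => tT1 ->; rewrite andbT (lt_trans _ tT1)// divr_gt0// mulr_gt0.
Qed.

Let bs_stretch (Q : R3 R -> R) s : smooth_on setT Q ->
  (forall x, 2 * R0 < `|x| -> Q x = 0) -> 0 < s < T ->
  bounded_support (box3 (2 * R0)) (fun x => stretching (U s) (W s) x * (Q x * eta s)).
Proof.
move=> sQ QL sT.
have := bsZ (eta s) (bs_stretching (U s) (W s) Q (2 * R0)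
  (fun j => smooth_velocity T u reg s j sT) (fun j => smooth_vorticity T u reg s j sT) sQ QL).
by congr bounded_support; apply/funext => x; ring.
Qed.

Let int_stretch_total : \int[mu]_(s in `]0, t[)
    \int[leb3]_x (stretching (U s) (W s) x * (total_cutoff x * eta s)) =
  \sum_(i < n) \int[mu]_(s in `]0, t[)
    \int[leb3]_x (stretching (U s) (W s) x * (Psi i x * eta s)).
Proof.
have mD : measurable (`]0, t[%classic : set (measurableTypeR R)) by exact: measurable_itv.
rewrite -(Rintegral_sum _ _ mD (fun i => stretching_integrable T t R0 r C0 u eta reg tT
  r0 rT eta_cutoff (Psi i) (Psi_smooth i) (Psi_outside i))).
apply: eq_Rintegral => s /set_mem /in_slab sT.
rewrite -(bs_int_sum _ _ (finite_measurable_box3 (2 * R0))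
  (fun i => bs_stretch (Psi i) s (Psi_smooth i) (Psi_outside i) sT)).
by apply: eq_Rintegral => x _; rewrite /total_cutoff [_ * eta s]mulr_suml mulr_sumr.
Qed.

Lemma mean_vst_total : mean_vst u eta psi r c t = (n%:R * r ^+ 3 * t)^-1 *
  \int[mu]_(s in `]0, t[)
    \int[leb3]_x (stretching (U s) (W s) x * (total_cutoff x * eta s)).
Proof.
rewrite /mean_vst int_stretch_total; under eq_bigr do rewrite vst_stretching.
by rewrite -2!mulr_sumr !invfM; ring.
Qed.

Let half_sqr_ge0 (y : R) : 0 <= 1 / 2 * y ^+ 2.
Proof. exact: mulr_ge0 (divr_ge0 ler01 (ler0n _ 2)) (sqr_ge0 y). Qed.

Let final_energy (Q : R3 R -> R) : R :=
  \int[leb3]_x (1 / 2 * enorm (vorticity u t x) ^+ 2 * Q x).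

Let gradient_energy (Q : R3 R -> R) : R := \int[mu]_(s in `]0, t[)
  \int[leb3]_x (gnorm2 (W s) x * (Q x * eta s)).

Let Ia : R := \int[mu]_(s in `]0, t[) energy_slice u eta psi0 s.
Let Id : R := \int[mu]_(s in `]0, t[) gradient_slice u eta psi0 s.

Let eta_ge0 s : 0 < s < T -> 0 <= eta s.
Proof. by move=> sT; case/andP: (eta_bound T C0 eta eta_cutoff s sT). Qed.

Let IdE : Id = gradient_energy psi0.
Proof.
apply: eq_Rintegral => s /set_mem /in_slab sT.
apply: eq_Rintegral => x _; rewrite rt8X8// mulr_ge0//; exact: eta_ge0.
Qed.

Let gradint (Q : R3 R -> R) (sQ : smooth_on setT Q) QL :=
  gradient_integrable T t R0 r C0 u eta reg tT r0 rT eta_cutoff Q sQ QL.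

Lemma macro_PE : macro_P u eta psi0 R0 t = (R0 ^+ 3 * t)^-1 * (Id + final_energy psi0).
Proof.
have mD : measurable (`]0, t[%classic : set (measurableTypeR R)) by exact: measurable_itv.
rewrite IdE /macro_P (RintegralZl _ mD (gradint psi0 psi0_smooth outside)).
rewrite -[X in _ * (_ * X) + _]/(gradient_energy psi0).
rewrite -[X in _ + _ * (_ * X)]/(final_energy psi0) (invfM _ t); ring.
Qed.

Lemma macro_EE : macro_E u eta psi0 R0 t = (R0 ^+ 3 * t)^-1 * (Ia / 2).
Proof.
have ie := energy_slice_integrable T t R0 r C0 u eta psi0 reg tT r0 rT eta_cutoff
  psi0_smooth (macro_support C0 R0 psi macro).
have mD : measurable (`]0, t[%classic : set (measurableTypeR R)) by exact: measurable_itv.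
rewrite /macro_E (_ : \int[mu]_(s in _) _ = \int[mu]_(s in `]0, t[)
    ((R0 ^+ 3)^-1 / 2 * energy_slice u eta psi0 s)).
  by rewrite (RintegralZl _ mD ie) -[X in _ * (_ * X)]/Ia (invfM _ t); ring.
apply: eq_Rintegral => s /set_mem /in_slab sT; rewrite -mulrA; congr (_ * _).
have bsl : bounded_support (box3 (2 * R0))
    (fun x => vnorm (W s) x ^+ 2 * rt8 (psi0 x * eta s) ^+ 4).
  apply: continuous_bs3 => [x|x xL]; last by rewrite outside// mul0r rt8_0 expr0n mulr0.
  have cm : continuous (vnorm (W s)).
    apply: vnorm_continuous => j y.
    exact: (smooth_continuous (smooth_vorticity T u reg s j sT) y I).
  apply: (cont_mul (cont_exp 2 (cm x))); apply: cont_exp.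
  exact: (cont_comp (cont_mul (smooth_continuous psi0_smooth x I) (cont_cst _ x)) rt8_continuous).
rewrite /energy_slice -(bs_intZ _ (finite_measurable_box3 (2 * R0)) bsl).
by apply: eq_Rintegral => x _; rewrite rt8X4 vnorm_component mulrA -[1 / 2]mul1r mul1r div1r.
Qed.

Let bs_final (Q : R3 R -> R) : smooth_on setT Q -> (forall x, 2 * R0 < `|x| -> Q x = 0) ->
  bounded_support (box3 (2 * R0)) (fun x => 1 / 2 * enorm (vorticity u t x) ^+ 2 * Q x).
Proof.
move=> sQ QL; apply: continuous_bs3 => [x|x /QL ->]; last exact: mulr0.
have cm : continuous (fun x => enorm (vorticity u t x)).
  have -> : (fun x => enorm (vorticity u t x)) = vnorm (W t).
    by apply/funext => y; rewrite vnorm_component.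
  apply: vnorm_continuous => j y.
  exact: (smooth_continuous (smooth_vorticity T u reg t j t_slab) y I).
exact: (cont_mul (cont_mul (cont_cst _ x) (cont_exp 2 (cm x))) (smooth_continuous sQ x I)).
Qed.

Let le_final (P Q : R3 R -> R) (k : R) : smooth_on setT P -> smooth_on setT Q ->
  (forall x, 2 * R0 < `|x| -> P x = 0) -> (forall x, 2 * R0 < `|x| -> Q x = 0) ->
  (forall x, P x <= k * Q x) -> final_energy P <= k * final_energy Q.
Proof.
move=> sP sQ PL QL PQ; have fL := finite_measurable_box3 (2 * R0).
rewrite /final_energy -(bs_intZ k fL (bs_final Q sQ QL)).
apply: (bs_int_le fL (bs_final P sP PL) (bsZ k (bs_final Q sQ QL))) => x.
by rewrite [leRHS]mulrCA; apply: ler_wpM2l; [exact: half_sqr_ge0|exact: PQ].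
Qed.

Let bs_grad (Q : R3 R -> R) s : smooth_on setT Q ->
  (forall x, 2 * R0 < `|x| -> Q x = 0) -> 0 < s < T ->
  bounded_support (box3 (2 * R0)) (fun x => gnorm2 (W s) x * (Q x * eta s)).
Proof.
move=> sQ QL sT; apply: continuous_bs3 => [x|x xL]; last by rewrite QL// mul0r mulr0.
have cg := gnorm2_continuous (W s) (fun j => C1_smooth (smooth_vorticity T u reg s j sT)).
exact: (cont_mul (cg x) (cont_mul (smooth_continuous sQ x I) (cont_cst _ x))).
Qed.

Let le_gradient (P Q : R3 R -> R) (k : R) : smooth_on setT P -> smooth_on setT Q ->
  (forall x, 2 * R0 < `|x| -> P x = 0) -> (forall x, 2 * R0 < `|x| -> Q x = 0) ->
  (forall x, P x <= k * Q x) -> gradient_energy P <= k * gradient_energy Q.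
Proof.
move=> sP sQ PL QL PQ; have fL := finite_measurable_box3 (2 * R0).
have mD : measurable (`]0, t[%classic : set (measurableTypeR R)) by exact: measurable_itv.
rewrite /gradient_energy -(RintegralZl k mD (gradint Q sQ QL)).
apply: (le_Rintegral mD (gradint P sP PL) (integrableZl mD k (gradint Q sQ QL))).
move=> s /in_slab sT; rewrite -(bs_intZ k fL (bs_grad Q s sQ QL sT)).
apply: (bs_int_le fL (bs_grad P s sP PL sT) (bsZ k (bs_grad Q s sQ QL sT))) => x.
rewrite [leRHS]mulrCA; apply: ler_wpM2l; first exact: gnorm2_ge0.
by rewrite mulrA; apply: ler_wpM2r; [exact: eta_ge0|exact: PQ].
Qed.

Let final_ge0 (Q : R3 R -> R) : (forall x, 0 <= Q x) -> 0 <= final_energy Q.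
Proof. by move=> Q0; apply: int_ge0 => x; exact: mulr_ge0 (half_sqr_ge0 _) (Q0 x). Qed.

Let Id_ge0 : 0 <= Id.
Proof.
apply: Rintegral_ge0 => s _; apply: int_ge0 => x.
exact: mulr_ge0 (gnorm2_ge0 _ _) (exprn_ge0 _ (rt8_ge0 _)).
Qed.

Let Ia_ge0 : 0 <= Ia.
Proof.
apply: Rintegral_ge0 => s _; apply: int_ge0 => x.
exact: mulr_ge0 (sqr_ge0 _) (exprn_ge0 _ (rt8_ge0 _)).
Qed.

Lemma mean_vst_bounds (C M0 : R) : (0 < K1)%N -> 1 < C ->
  2 * K2%:R * C0 * (19 + 8 * C0 ^+ 2) <= C -> 2 * K1%:R <= C -> K2%:R + 1 <= C ->
  (forall s, 0 < s < T ->
    (\int[leb3]_(x in eball 0%R (2 * R0)) (enorm (u s x) ^+ 2)%:E <= M0%:E)%E) ->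
  0 < macro_P u eta psi0 R0 t ->
  C * Num.max (Num.sqrt M0) (Num.sqrt R0) * Num.sqrt (macro_sigma u eta psi0 R0 t) <= r ->
  C^-1 * macro_P u eta psi0 R0 t <= mean_vst u eta psi r c t <=
  C * macro_P u eta psi0 R0 t.
Proof.
move=> K10 C1 CK CK1 CK2 uM P0 Cr; rewrite mean_vst_total.
have t0 : 0 < t by case/andP: t_slab.
have K1R : 0 < K1%:R :> R by rewrite ltr0n.
have [_ _ /andP[n1 n2] _] := cover.
have low := cover_lower C0 R0 r K1 K2 n c psi cover macro cutoffs.
have low1 x : psi0 x <= 1 * total_cutoff x by rewrite mul1r; exact: low.
have up x : total_cutoff x <= K2%:R * psi0 x by case/andP: (total_le x).
have F1 := le_final _ _ _ psi0_smooth total_smooth outside total_outside low1.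
have F2 := le_final _ _ _ total_smooth psi0_smooth total_outside outside up.
have G1 := le_gradient _ _ _ psi0_smooth total_smooth outside total_outside low1.
have G2 := le_gradient _ _ _ total_smooth psi0_smooth total_outside outside up.
rewrite mul1r in F1; rewrite mul1r -IdE in G1; rewrite -IdE in G2.
have bal lam (lam0 : 0 < lam) :=
  balance_estimate T t R0 r K2%:R C0 M0 lam u eta psi0 reg tT R00 r0 rT (ler0n _ K2) C00
  lam0 eta_cutoff psi0_smooth (macro_bound C0 R0 psi macro) (macro_support C0 R0 psi macro)
  dmacro uM total_cutoff total_smooth total_outside total_le total_transport total_laplacian.
exact: (ensemble_bounds K1%:R K2%:R n%:R t r R0 C0 C M0 Ia Id _ _ _ _ _ _ K1R (ler0n _ K2)
  t0 r0 rR C00 C1 CK CK1 CK2 n1 n2 Ia_ge0 Id_ge0 (final_ge0 psi0 psi0_ge0) F1 F2 G1 G2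
  macro_PE macro_EE bal P0 Cr).
Qed.

End Ensemble.

Theorem theorem4p1 (R : realType) (C0 : R) (K1 K2 : nat)
    (hC0 : 0 < C0) (hK1 : (0 < K1)%N) (hK2 : (0 < K2)%N) :
  exists C : R, 1 < C /\
  forall (T R0 : R) (u : R -> R3 R -> R3 R) (M0 : R)
         (eta : R -> R) (psi : R3 R -> R -> R3 R -> R),
    0 < T <= 1 -> 0 < R0 <= Num.sqrt T ->
    local_leray_solution u -> regular_on T u ->
    ereal_sup [set \int[leb3]_(x in eball 0%R (2 * R0)%R) (enorm (u t x) ^+ 2)%:E
              | t in `]0%R, T[]%E = M0%:E ->
    temporal_cutoff C0 T eta ->
    spatial_cutoff C0 0 R0 (psi 0 R0) ->
    forall t : R, 2 * T / 3 < t < T ->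
    let P := macro_P u eta (psi 0 R0) R0 t in
    let sigma := macro_sigma u eta (psi 0 R0) R0 t in
    let Rmin := C * Num.max (Num.sqrt M0) (Num.sqrt R0) * Num.sqrt sigma in
    0 < P -> Rmin < R0 ->
    forall r : R, Rmin <= r <= R0 ->
    forall (n : nat) (c : 'I_n -> R3 R),
      is_cover K1 K2 R0 r c ->
      (forall i : 'I_n, cover_cutoff C0 R0 (psi 0 R0) (c i) r (psi (c i) r)) ->
      C^-1 * P <= mean_vst u eta psi r c t <= C * P.
Proof.
pose D : R := 2 * K2%:R * C0 * (19 + 8 * C0 ^+ 2).
have C00 := ltW hC0.
have D0 : 0 <= D by rewrite !mulr_ge0// addr_ge0// mulr_ge0// sqr_ge0.
have k1 : 0 <= K1%:R :> R by [].
have k2 : 0 <= K2%:R :> R by [].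
(* [D] is the threshold at which the error is absorbed, 2 K1 serves the normalization of the
   average, K2 + 1 the upper bound, and the summand 2 also gives C > 1. *)
exists (2 + 2 * K1%:R + K2%:R + D); split; first by lra.
move=> T R0 u M0 eta psi /andP[T0 _] /andP[R00 RT] _ reg sup tc sc t tT P sigma Rmin P0 _
  r /andP[rmin rR] n c cov cut.
have RT2 : R0 ^+ 2 <= T.
  by rewrite -[leRHS](sqr_sqrtr (ltW T0)) ler_sqr ?nnegrE ?sqrtr_ge0// ltW.
have uM s : 0 < s < T ->
    (\int[leb3]_(x in eball 0%R (2 * R0)) (enorm (u s x) ^+ 2)%:E <= M0%:E)%E.
  by move=> sT; rewrite -sup; apply: ereal_sup_ubound; exists s => //=; rewrite in_itv.
by apply: (mean_vst_bounds C0 R0 r T t K1 K2 n c psi u eta hC0 cov sc cut reg tT RT2 tc _ M0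
  hK1 _ _ _ _ uM P0 rmin); rewrite -/D; lra.
Qed.
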